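(* Let $K,L\subset\mathbb R^n$ be convex bodies containing the origin in their interiors. Let $p>1$, let $q=p/(p-1)$, and assume that $|K|=|L|$. Put $r(u)=\dfrac{h_L(u)}{h_K(u)}$ for $u\in S^{n-1}$. Then $$ \int_{S^{n-1}} \left| \frac{r(u)^p}{1+\delta_p(K,L)}-1 \right|\,d\mu_K(u) \le \sqrt{2q\,\delta_p(K,L)}. $$ If, in addition, $K=-K$, then $$ \int_{S^{n-1}} \left| \left(\frac{h_L(u)}{h_K(u)}\right)^p - \left(\frac{h_L(-u)}{h_K(u)}\right)^p \right|\,d\mu_K(u) \le 2(1+\delta_p(K,L))\sqrt{2q\,\delta_p(K,L)}. $$ If, moreover (in addition to $K=-K$), there are constants $0<m\le M<\infty$ such that $mB_2^n\subset K\subset MB_2^n$ and $mB_2^n\subset L\subset MB_2^n$, then $$ \int_{S^{n-1}}|h_L(u)-h_L(-u)|\,d\mu_K(u) \le \frac{2M(1+\delta_p(K,L))}{p} \left(\frac{M}{m}\right)^{p-1} \sqrt{2q\,\delta_p(K,L)}. $$ In particular (under these same hypotheses), if $L_0=\frac12(L+(-L))$, then $L_0$ is centrally symmetric (that is, $L_0=-L_0$) and $$ \int_{S^{n-1}}|h_L(u)-h_{L_0}(u)|\,d\mu_K(u) \le \frac{M(1+\delta_p(K,L))}{p} \left(\frac{M}{m}\right)^{p-1} \sqrt{2q\,\delta_p(K,L)}. $$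
   Context: A convex body in $\mathbb R^n$ is a compact convex set with nonempty interior; $|K|$ is its volume ($n$-dimensional Lebesgue measure), $h_K(u)=\max_{x\in K}\langle x,u\rangle$ its support function, and $S_K$ its surface area measure on the unit sphere $S^{n-1}$. $B_2^n$ is the closed Euclidean unit ball centered at the origin, and $L+(-L)$ denotes the Minkowski sum. For convex bodies $K,L$ containing the origin in their interiors and $p>1$, the $L_p$ mixed volume is $$V_p(K,L)=\frac1n\int_{S^{n-1}}h_L(u)^p\,h_K(u)^{1-p}\,dS_K(u),$$ and the normalized cone-volume measure of $K$ is the probability measure on $S^{n-1}$ given by $$d\mu_K(u)=\frac{h_K(u)}{n|K|}\,dS_K(u).$$ If $|K|=|L|$, put $$\delta_p(K,L)=\frac{V_p(K,L)}{|K|}-1,$$ which is nonnegative by the $L_p$ Minkowski inequality. *)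

(* Defs.v *)
From HB Require Import structures.
From mathcomp Require Import all_boot all_order all_algebra.
From mathcomp Require Import all_classical all_reals all_analysis.

Set Implicit Arguments.
Unset Strict Implicit.
Unset Printing Implicit Defensive.

Import Order.TTheory GRing.Theory Num.Theory.
Import numFieldNormedType.Exports.

Local Open Scope classical_set_scope.
Local Open Scope ring_scope.

(* R^n is 'rV[R]_n.  The canonical norm of 'rV[R]_n is the sup norm; it induces
   the usual topology, but the Euclidean norm has to be defined separately. *)

Definition dot (R : realType) (n : nat) (x y : 'rV[R]_n) : R :=
  \sum_(i < n) x ord0 i * y ord0 i.

Definition enorm (R : realType) (n : nat) (x : 'rV[R]_n) : R :=
  Num.sqrt (dot x x).

Definition unit_ball (R : realType) (n : nat) : set 'rV[R]_n :=
  [set x | enorm x <= 1].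

Definition unit_sphere (R : realType) (n : nat) : set 'rV[R]_n :=
  [set u | enorm u = 1].

(* R^n with its Borel sigma-algebra *)
Definition borel (R : realType) (n : nat) :=
  g_sigma_algebraType (@open 'rV[R]_n).

(* n-dimensional Lebesgue measure of a Borel set, as the n-fold product of the
   one-dimensional one: the clause for n.+1 is the unfolding of the library's
   product measure [lebesgue_measure \x lebesgue_rV n] along R * R^n ~ R^n.+1,
   and R^0 is a point of mass 1. *)
Fixpoint lebesgue_rV (R : realType) (n : nat) : set 'rV[R]_n -> \bar R :=
  match n return set 'rV[R]_n -> \bar R with
  | 0 => fun A => (\1_A (0 : 'rV[R]_0))%:E
  | m.+1 => fun A =>
      (\int[@lebesgue_measure R]_t
         lebesgue_rV [set v : 'rV[R]_m | A (row_mx (t%:M : 'rV[R]_1) v)])%E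
  end.

Definition vol (R : realType) (n : nat) (A : set 'rV[R]_n) : R :=
  fine (lebesgue_rV A).

Definition convex_body (R : realType) (n : nat) (K : set 'rV[R]_n) : Prop :=
  [/\ compact K, convex_set K & interior K !=set0].

Definition support_fun (R : realType) (n : nat) (K : set 'rV[R]_n)
    (u : 'rV[R]_n) : R :=
  sup [set dot x u | x in K].

Definition scale_set (R : realType) (n : nat) (a : R) (A : set 'rV[R]_n) :
    set 'rV[R]_n :=
  [set a *: x | x in A].

Definition opp_set (R : realType) (n : nat) (A : set 'rV[R]_n) :
    set 'rV[R]_n :=
  [set - x | x in A].

Definition minkowski_sum (R : realType) (n : nat) (A B : set 'rV[R]_n) :
    set 'rV[R]_n :=
  [set x + y | x in A & y in B].

Definition nearest_point (R : realType) (n : nat) (K : set 'rV[R]_n)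
    (x y : 'rV[R]_n) : Prop :=
  K y /\ forall z, K z -> enorm (x - y) <= enorm (x - z).

(* The local parallel set A_e(K, w): the points x with 0 < d(K, x) <= e for
   which the unit vector pointing from the nearest point of K to x is in w. *)
Definition local_parallel_set (R : realType) (n : nat) (K : set 'rV[R]_n)
    (e : R) (w : set 'rV[R]_n) : set 'rV[R]_n :=
  [set x | exists y, [/\ nearest_point K x y,
                         0 < enorm (x - y) <= e &
                         w ((enorm (x - y))^-1 *: (x - y))]].

(* S is the surface area measure S_K of K, in the sense of Fenchel and Jessen
   (Schneider, Convex Bodies: The Brunn-Minkowski Theory, section 4.2): S_K(w)
   is the coefficient of the first power of e in the local Steiner formula
     |A_e(K, w)| = 1/n * \sum_(j < n) e^(n-j) * C(n,j) * S_j(K, w),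
   that is, of e * S_(n-1)(K, w).  S is a Borel measure on R^n; the condition
   forces it to be concentrated on the unit sphere. *)
Definition is_surface_area_measure (R : realType) (n : nat)
    (K : set 'rV[R]_n) (S : set (borel R n) -> \bar R) : Prop :=
  forall w : set (borel R n), measurable w ->
    ((lebesgue_rV (local_parallel_set K e w) * (e^-1)%:E)%E
       @[e --> (0 : R)^'+] --> S w).

Definition Lp_mixed_volume (R : realType) (n : nat)
    (S : {measure set (borel R n) -> \bar R}) (p : R) (K L : set 'rV[R]_n) : R :=
  n%:R^-1 * \int[S]_(u in @unit_sphere R n)
    (support_fun L u `^ p * support_fun K u `^ (1 - p)).

Definition cone_volume_measure (R : realType) (n : nat)
    (S : {measure set (borel R n) -> \bar R}) (K : set 'rV[R]_n)
    (A : set (borel R n)) : \bar R :=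
  (\int[S]_(u in A `&` @unit_sphere R n)
     (support_fun K u / (n%:R * vol K))%:E)%E.

Definition Lp_deficit (R : realType) (n : nat)
    (S : {measure set (borel R n) -> \bar R}) (p : R) (K L : set 'rV[R]_n) : R :=
  Lp_mixed_volume S p K L / vol K - 1.

(* Main.v *)
(* The measure mu_K is a probability measure with int r dmu_K >= 1, and both
   facts have to be derived from the local Steiner limit that defines S_K.

   For the lower bound on V_1(K, L) the point is that (K + tL) \ K is contained
   in the union of the local parallel sets A_(t b_i)(K, w_i) as soon as
   h_L <= b_i on w_i; Brunn-Minkowski then gives
   n |K| <= sum b_i S_K(w_i), hence n |K| <= int h_L dS_K when |K| = |L|.
   For the reverse bound int h_K dS_K <= n |K|, let d be the distance to K,
   n_x the outer normal at the point of K nearest to x, and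
   f = max(0, 1 - d / e).  Since d((1 + s) x) >= d(x) + s h_K(n_x), the
   difference f(x) - f((1 + s) x) dominates s a_i / e on A_(e - s a_i)(K, w_i)
   when a_i <= h_K on w_i, while its integral is at most n s |K + e B|.

   With a = 1/p and g = r^p / (1 + delta), one has int g dmu_K = 1 and
   int g^a dmu_K >= (1 + delta)^(-a) >= 1 - a delta.  The first estimate is
   then a Pinsker inequality for the f-divergence of 1 + a (t - 1) - t^a; the
   others follow from the evenness of S_K and the convexity of t^p. *)

Require Import Defs.
From HB Require Import structures.
From mathcomp Require Import all_boot all_order all_algebra.
From mathcomp Require Import all_classical all_reals all_analysis.
From mathcomp Require Import measurable_realfun ring lra.
Import Order.TTheory GRing.Theory Num.Theory.
Import numFieldNormedType.Exports.
Local Open Scope classical_set_scope.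
Local Open Scope ring_scope.

Set Implicit Arguments.
Unset Strict Implicit.
Unset Printing Implicit Defensive.

(** * Inequalities for real powers *)

(** The surface area measure is known only through limits of volumes of local parallel sets, one
    Borel set at a time. All the geometry is therefore done at positive radius for finite families
    of sets, namely the level bands, of height eta, of a support function on the sphere. Upper and
    lower sums differ by at most eta times the total mass, so what lets eta tend to 0 is the
    finiteness of that mass, itself a consequence of the cutoff estimate. In that estimate s is tied
    to the radius by s = eta e: each shell then has radius (1 - eta a_i) e, a fixed proportion of e,
    so the Steiner limit applies at fixed eta. The constant 2q is what the Pinsker inequality
    produces: its affine weight ((1 + a) + (2 - a) t) / 3 has integral 1 against a probability
    density, the generator has integral 1 - int g^a <= a delta, and 2 / (a (1 - a)) times a delta is
    2 q delta for a = 1/p. *)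

Section powR_inequalities.
Context {R : realType}.
Implicit Types (a b t y z : R).

(* Tangent line of [expR] at [b * ln y], evaluated at [ln y] and at [0]. *)
Lemma powR_le_affine b y : 0 <= b <= 1 -> 0 < y -> y `^ b <= 1 + b * (y - 1).
Proof.
move=> /andP[b0 b1] y0; rewrite /powR gt_eqF//; set E := expR (b * ln y).
have E0 : 0 < E by exact: expR_gt0.
have tangent x : E * (1 + (x - b * ln y)) <= expR x.
  rewrite -[leRHS](_ : E * expR (x - b * ln y) = _); last first.
    by rewrite -expRD; congr expR; ring.
  by rewrite ler_pM2l// expR_ge1Dx.
have := tangent (ln y); rewrite lnK ?posrE// => h1.
have := tangent 0; rewrite expR0 => h0.
have b1' : 0 <= 1 - b by lra.
by have := lerD (ler_wpM2l b0 h1) (ler_wpM2l b1' h0); lra.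
Qed.

(** Bernoulli for exponents at least 1: the concave bound with exponent 1/a, taken at the point z^a,
    reads z <= 1 + (z^a - 1)/a. *)
Lemma powR_ge_affine a z : 1 <= a -> 0 < z -> 1 + a * (z - 1) <= z `^ a.
Proof.
move=> a1 z0; have a0 : 0 < a by lra.
have := @powR_le_affine a^-1 (z `^ a).
rewrite invr_ge0 ltW// invf_le1// a1 => /(_ isT (powR_gt0 _ z0)).
rewrite -powRrM divff ?gt_eqF// (powRr1 (ltW z0)) => h.
have := ler_wpM2l (ltW a0) h.
rewrite mulrDr mulrA divff ?gt_eqF//; lra.
Qed.

(** Homogenised form of the concave tangent bound: take it at y/x and multiply by x. A vanishing x
    or y is treated apart, since that bound asks for a positive argument. *)
Lemma powR_amgm x y l : 0 < l < 1 -> 0 <= x -> 0 <= y ->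
  x `^ (1 - l) * y `^ l <= (1 - l) * x + l * y.
Proof.
move=> /andP[l0 l1]; rewrite le_eqVlt => /predU1P[<- y0|x0].
  by rewrite powR0 ?gt_eqF ?subr_gt0// mul0r mulr0 add0r mulr_ge0// ltW.
rewrite le_eqVlt => /predU1P[<-|y0].
  by rewrite (@powR0 _ l) ?gt_eqF// !mulr0 addr0 mulr_ge0 ?(ltW x0)// subr_ge0 ltW.
have := @powR_le_affine l (y / x); rewrite (ltW l0) (ltW l1) => /(_ isT (divr_gt0 y0 x0)) h.
have := ler_wpM2l (ltW x0) h.
rewrite [leRHS](_ : _ = (1 - l) * x + l * y); last by field; rewrite gt_eqF.
apply: le_trans; rewrite powRM ?invr_ge0 ?(ltW x0) ?(ltW y0)// powRB ?(gt_eqF x0) ?implybT//.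
rewrite (powRr1 (ltW x0)) -(powR_inv1 (ltW x0)) -powRrM mulN1r powRN le_eqVlt.
by apply/orP; left; apply/eqP; ring.
Qed.

(** Tangent line of t^p at b: Bernoulli at a/b, multiplied by b^p. *)
Lemma powR_sub_ge p a b : 1 <= p -> 0 < b -> b <= a ->
  p * b `^ (p - 1) * (a - b) <= a `^ p - b `^ p.
Proof.
move=> p1 b0 ba; have a0 : 0 < a by exact: lt_le_trans ba.
have := powR_ge_affine p1 (divr_gt0 a0 b0).
have bp0 := powR_gt0 p b0 => h.
have := ler_wpM2l (ltW bp0) h; rewrite -powRM ?divr_ge0 ?(ltW a0) ?(ltW b0)//.
rewrite [b * _]mulrC divfK ?gt_eqF// => h2.
rewrite lerBrDr (le_trans _ h2)// powRB ?(gt_eqF b0) ?implybT//.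
rewrite (powRr1 (ltW b0)).
rewrite le_eqVlt; apply/orP; left; apply/eqP; field; rewrite gt_eqF//.
Qed.

(** Two applications of the mean value theorem give f(t) = f2(d) (c - 1) (t - 1) with c between 1
    and t, and d between 1 and c; the two differences have the same sign. *)
Lemma ge0_second_derivative (f f1 f2 : R -> R) :
  (forall x : R, 0 < x -> is_derive x (1 : R) f (f1 x)) ->
  (forall x : R, 0 < x -> is_derive x (1 : R) f1 (f2 x)) ->
  (forall x : R, 0 < x -> 0 <= f2 x) -> f 1 = 0 -> f1 1 = 0 ->
  forall t : R, 0 < t -> 0 <= f t.
Proof.
move=> df df1 f2_ge0 f_1 f1_1.
have mvt (g g1 : R -> R) : (forall x : R, 0 < x -> is_derive x (1 : R) g (g1 x)) ->
  forall x y : R, 0 < x -> x < y -> exists2 c, x < c < y & g y - g x = g1 c * (y - x).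
  move=> dg x y x0 xy; have [||c] := @MVT R g g1 x y xy.
  - by move=> z; rewrite in_itv/= => /andP[xz _]; apply: dg; exact: lt_trans xz.
  - apply: derivable_within_continuous => z; rewrite in_itv/= => /andP[xz _].
    by have [] := dg _ (lt_le_trans x0 xz).
  - by rewrite in_itv/= => cxy; exists c.
move=> t t0; have [t1|t1|->] := ltgtP t 1; last by rewrite f_1.
- have [c /andP[tc c1]] := mvt _ _ df _ _ t0 t1; rewrite f_1 sub0r => fE.
  have c0 : 0 < c by exact: lt_trans tc.
  have [d /andP[cd d1]] := mvt _ _ df1 _ _ c0 c1; rewrite f1_1 sub0r => f1E.
  have d2 := f2_ge0 _ (lt_trans c0 cd).
  have -> : f t = f2 d * (1 - c) * (1 - t).
    by rewrite -(opprK (f t)) fE -(opprK (f1 c)) f1E; ring.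
  by rewrite !mulr_ge0// subr_ge0 ltW.
- have [c /andP[tc c1]] := mvt _ _ df _ _ ltr01 t1; rewrite f_1 subr0 => fE.
  have [d /andP[cd d1]] := mvt _ _ df1 _ _ ltr01 tc; rewrite f1_1 subr0 => f1E.
  have d2 := f2_ge0 _ (lt_trans ltr01 cd).
  by rewrite fE f1E !mulr_ge0// subr_ge0 ltW.
Qed.

(* A pointwise Pinsker inequality for the f-divergence generated by
   [1 + a (t - 1) - t^a]; the affine weight makes the third-order terms at
   [t = 1] agree. *)
Lemma pinsker_pointwise a t : 0 < a < 1 -> 0 < t ->
  a * (1 - a) / 2 * (t - 1) ^+ 2 <=
  ((1 + a) + (2 - a) * t) / 3 * (1 + a * (t - 1) - t `^ a).
Proof.
move=> /andP[a0 a1] t0; rewrite -subr_ge0.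
pose w t := ((1 + a) + (2 - a) * t) / 3.
(* G is the right side minus the left side; it vanishes at 1 together with its derivative [G1]. *)
pose G t := w t * (1 + a * (t - 1) - t `^ a) - a * (1 - a) / 2 * (t - 1) ^+ 2.
pose G1 t := (2 - a) / 3 * (1 + a * (t - 1) - t `^ a)
  + w t * (a - a * t `^ (a - 1)) - a * (1 - a) * (t - 1).
pose G2 t := a / 3 * (1 + a) *
  (1 - (2 - a) * t `^ (a - 1) + (1 - a) * t `^ (a - 1 - 1)).
rewrite -/(w t) -/(G t); apply: (@ge0_second_derivative G G1 G2 _ _ _ _ _ t t0).
- move=> x x0; have dx := is_derive1_powR a x0.
  rewrite /G /w; apply: is_derive_eq.
  by rewrite /G1 /w /GRing.scale/=; field.
- move=> x x0; have dx := is_derive1_powR a x0.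
  have dx1 := is_derive1_powR (a - 1) x0.
  rewrite /G1 /w; apply: is_derive_eq.
  rewrite /G2 /GRing.scale/=.
  have -> : x `^ (a - 1) = x * x `^ (a - 1 - 1).
    transitivity (x `^ (a - 1 - 1) * x `^ 1).
      by rewrite -powRD ?subrK// (gt_eqF x0) implybT.
    by rewrite (powRr1 (ltW x0)) mulrC.
  by field.
(* With y = x^(a-1) one has x^(a-2) = y^b for b = (2-a)/(1-a) >= 1. Bernoulli for y^b, multiplied by
   1 - a, says exactly that the bracket in [G2] is nonnegative. *)
- move=> x x0; rewrite /G2.
  have h1a : 0 < 1 - a by lra.
  have := @powR_ge_affine ((2 - a) / (1 - a)) (x `^ (a - 1)).
  rewrite ler_pdivlMr// mul1r lerD2r ler1n => /(_ isT (powR_gt0 _ x0)).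
  rewrite -powRrM (_ : (a - 1) * _ = a - 1 - 1); last by field; rewrite gt_eqF.
  move=> /(ler_wpM2l (ltW h1a)).
  rewrite mulrDr mulr1 mulrA (mulrC (1 - a)) divfK ?gt_eqF// => h.
  by apply: mulr_ge0; [rewrite mulr_ge0 ?divr_ge0//; lra|lra].
- by rewrite /G powR1; field.
- by rewrite /G1 !powR1; field.
Qed.

End powR_inequalities.

(** * Lebesgue measure on row vectors *)

Section borel_rV.
Context {R : realType}.

Lemma ball_rVP n (x y : 'rV[R]_n) (e : R) : 0 < e ->
  ball x e y <-> forall j, `|x ord0 j - y ord0 j| < e.
Proof.
move=> e0; split.
  by move=> [_ xy] j; have := xy ord0 j.
move=> xy; split => // i j; rewrite (ord1 i); exact: xy.
Qed.

(* Every open set is a countable union of cubes with rational centres. *)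
Lemma measurable_rV d (T : measurableType d) n (D : set T)
    (f : T -> borel R n) :
  (forall j, measurable_fun D (fun x => (f x : 'rV[R]_n) ord0 j)) ->
  measurable_fun D f.
Proof.
move=> mf mD.
apply: (@measurability _ _ T (borel R n) D f (@open 'rV[R]_n) erefl _ mD).
move=> _ [U oU <-].
pose box (i : 'rV[rat]_n * nat) : set 'rV[R]_n :=
  ball (map_mx ratr i.1 : 'rV[R]_n) (i.2.+1%:R^-1).
pose F i := if `[< box i `<=` U >] then D `&` f @^-1` box i else set0.
have -> : D `&` f @^-1` U = \bigcup_i F i.
  apply/seteqP; split => [x [Dx Ux]|x [i _]]; last first.
    by rewrite /F; case: asboolP => // iU [Dx /iU].
  move: oU; rewrite openE => /(_ _ Ux)/nbhs_ballP [e /= e0 eU].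
  have [k ke] : exists k : nat, k.+1%:R^-1 < e / 2.
    near \oo => k; exists k; near: k.
    by apply: near_infty_natSinv_lt (PosNum (divr_gt0 e0 (ltr0Sn R 1))).
  have k0 : 0 < k.+1%:R^-1 :> R by rewrite invr_gt0.
  have qP j : {q : rat | `|ratr q - (f x : 'rV[R]_n) ord0 j| < k.+1%:R^-1}.
    apply: cid; have := @rat_in_itvoo R ((f x : 'rV[R]_n) ord0 j - k.+1%:R^-1)
       ((f x : 'rV[R]_n) ord0 j + k.+1%:R^-1).
    case; first by rewrite ltrBlDr -addrA ltrDl addr_gt0.
    by move=> q; rewrite in_itv/= => qx; exists q; rewrite ltr_distl.
  exists (\row_j sval (qP j), k) => //.
  rewrite /F; case: asboolP.
    move=> _; split=> //; apply/ball_rVP => // j; rewrite !mxE.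
    by case: (qP j).
  move=> abs; exfalso; apply: abs => y /ball_rVP yk; apply: eU; apply/ball_rVP => // j.
  have := yk k0 j; rewrite !mxE; case: (qP j) => q /= qx yq.
  have -> : (f x : 'rV[R]_n) ord0 j - y ord0 j
    = - (ratr q - (f x : 'rV[R]_n) ord0 j) + (ratr q - y ord0 j) by lra.
  rewrite (le_lt_trans (ler_normD _ _))// normrN.
  by rewrite [ltRHS]splitr ltrD// (lt_trans _ ke).
apply: countable_bigcupT_measurable => // i; rewrite /F; case: asboolP => // _.
have -> : D `&` f @^-1` box i = D `&` \bigcap_(j in [set: 'I_n]) (D `&`
    (fun x => (f x : 'rV[R]_n) ord0 j) @^-1`
       [set y | `|ratr (i.1 ord0 j) - y| < i.2.+1%:R^-1]).
  apply/seteqP; split => x [Dx].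
    move=> /ball_rVP bx; split => // j _; split => //=.
    by have := bx _ j; rewrite !mxE; apply; rewrite invr_gt0.
  move=> bx; split => //; apply/ball_rVP; first by rewrite invr_gt0.
  by move=> j; rewrite !mxE; have [] := bx j I.
apply: measurableI => //; apply: fin_bigcap_measurable => // j _; apply: mf => //.
rewrite (_ : [set y | _] = ball (ratr (i.1 ord0 j) : R) (i.2.+1%:R^-1))//.
by apply: open_measurable; apply: ball_open; rewrite invr_gt0.
Unshelve. all: by end_near. Qed.

Lemma continuous_measurable_rV n (f : 'rV[R]_n -> R) :
  continuous f -> measurable_fun setT (f : borel R n -> R).
Proof.
move=> cf; apply: (measurability _ (RGenOpens.measurableE R)).
move=> _ [_ [a [b ->] <-]]; rewrite setTI; apply: sub_sigma_algebra.
by move/continuousP : cf; apply; exact: interval_open.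
Qed.

Lemma continuous_measurable_rVV n m (f : 'rV[R]_n -> 'rV[R]_m) :
  continuous f -> measurable_fun setT (f : borel R n -> borel R m).
Proof.
move=> cf; apply: (@measurability _ _ (borel R n) (borel R m) setT f (@open 'rV[R]_m) erefl).
move=> _ [U oU <-]; rewrite setTI; apply: sub_sigma_algebra.
by move/continuousP : cf; exact.
Qed.

Lemma open_measurable_rV n (A : set 'rV[R]_n) :
  open A -> measurable (A : set (borel R n)).
Proof. exact: sub_sigma_algebra. Qed.

Lemma closed_measurable_rV n (A : set 'rV[R]_n) :
  closed A -> measurable (A : set (borel R n)).
Proof.
by move=> cA; rewrite -(setCK A); apply: measurableC; apply: open_measurable_rV;
  rewrite openC.
Qed.

Lemma measurable_coord n (j : 'I_n) :
  measurable_fun setT (fun x : borel R n => (x : 'rV[R]_n) ord0 j).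
Proof. by apply: continuous_measurable_rV => x; exact: coord_continuous. Qed.

Lemma coord_norm_le n (x : 'rV[R]_n) j : `|x ord0 j| <= `|x|.
Proof.
rewrite [leRHS]mx_normrE; exact: (@le_bigmax _ _ _ 0 (fun i => `|x i.1 i.2|) (ord0, j)).
Qed.

(** The slices in the recursion for [lebesgue_rV] are the sections of preimages under this map,
    which ties the recursion to product measures. *)
Definition consrV m (z : measurableTypeR R * borel R m) : borel R m.+1 :=
  row_mx (z.1%:M : 'rV[R]_1) (z.2 : 'rV[R]_m).

Lemma consrVl m z k : (@consrV m z : 'rV[R]_(1 + m)) ord0 (lshift m k) = z.1.
Proof.
by apply: etrans (row_mxEl _ _ _ _) _; rewrite mxE (ord1 k) eqxx mulr1n.
Qed.

Lemma consrVr m z k : (@consrV m z : 'rV[R]_(1 + m)) ord0 (rshift 1 k) = (z.2 : 'rV[R]_m) ord0 k.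
Proof. exact: row_mxEr. Qed.

Lemma measurable_consrV m : measurable_fun setT (@consrV m).
Proof.
apply: measurable_rV => j.
case: (@split_ordP 1 m j) => k ->.
  by under eq_fun do rewrite consrVl; exact: measurable_fst.
under eq_fun do rewrite consrVr.
have ms : measurable_fun [set: measurableTypeR R * borel R m] snd.
  exact: measurable_snd.
exact: (measurableT_comp (measurable_coord k) ms).
Qed.

Lemma measurable_section m (t : R) (A : set 'rV[R]_m.+1) :
  measurable (A : set (borel R m.+1)) ->
  measurable ([set v | A (row_mx (t%:M : 'rV[R]_1) v)] : set (borel R m)).
Proof.
move=> mA.
have mf : measurable_fun setT (@consrV m \o (fun v : borel R m => (t, v))).
  by apply: measurableT_comp; [exact: measurable_consrV|exact: pair1_measurable].
by rewrite -[X in measurable X]setTI; exact: mf.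
Qed.

End borel_rV.

(** A propositional wrapper: in the induction on the dimension each measure is built from one that
    is only known to exist, so the structure has to be produced inside a proof. *)
Lemma sigma_finite_measure_of d (T : measurableType d) (R : realType)
    (m : set T -> \bar R) :
  m set0 = 0%E -> (forall A, (0 <= m A)%E) -> semi_sigma_additive m ->
  sigma_finite setT m ->
  exists mu : {sigma_finite_measure set T -> \bar R}, mu = m :> (set T -> \bar R).
Proof.
move=> m0 mge0 madd msf.
pose h1 := isMeasure.Build d T R m m0 mge0 madd.
pose mu1 : {measure set T -> \bar R} := HB.pack m h1.
pose h0 := isSFinite.Build d T R m
  (sfinite_measure_sigma_finite (mu := mu1) msf).
pose h2 := isSigmaFinite.Build d T R m msf.
pose mu : {sigma_finite_measure set T -> \bar R} := HB.pack m h1 h0 h2.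
by exists mu.
Qed.

Section lebesgue.
Context {R : realType}.

Lemma lebesgue_itvNr (M : R) : 0 <= M ->
  @lebesgue_measure R `[- M, M]%classic = (2 * M)%:E.
Proof.
move=> M0; rewrite lebesgue_measure_itv/= lte_fin; case: ifPn => MM.
  by rewrite -EFinD; congr EFin; ring.
by congr EFin; lra.
Qed.

Definition cube n (M : R) : set 'rV[R]_n := [set x | forall j, `|x ord0 j| <= M].
Arguments cube : clear implicits.

Lemma measurable_cube n M : measurable (cube n M : set (borel R n)).
Proof.
rewrite [X in measurable X](_ : _ = \bigcap_(j in [set: 'I_n])
    (fun x : borel R n => (x : 'rV[R]_n) ord0 j) @^-1` `[- M, M]); last first.
  by apply/seteqP; split => x /= cx j => [_|]; [|have := cx j I];
    rewrite /= in_itv/= -ler_norml.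
apply: fin_bigcap_measurable => // j _.
rewrite -[X in measurable X]setTI; exact: measurable_coord.
Qed.

Lemma bigcup_cube n : \bigcup_k cube n k%:R = setT.
Proof.
apply/seteqP; split => // x _; exists (Num.bound `|x|) => // j.
by rewrite (le_trans (coord_norm_le x j))// ltW// archi_boundP.
Qed.

(** Induction on the dimension, transporting the product of the one-dimensional measure and the
    measure in dimension m along [consrV]. The volume of cubes is part of the induction because it
    supplies the sigma-finiteness that the next product requires. *)
Lemma lebesgue_rV_measure n :
  exists mu : {sigma_finite_measure set (borel R n) -> \bar R},
    (forall A, measurable A -> mu A = lebesgue_rV (A : set 'rV[R]_n)) /\
    (forall M, 0 <= M -> mu (cube n M) = ((2 * M) ^+ n)%:E).
Proof.
elim: n => [|m [mu [muE mucube]]].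
  exists (@dirac _ (borel R 0) (0 : 'rV[R]_0) R : probability (borel R 0) R).
  split => // M M0; rewrite /= diracE mem_set// => -[//].
pose P : {measure set (measurableTypeR R * borel R m)%type -> \bar R} :=
  (@lebesgue_measure R \x mu)%E.
have mc (A : set (borel R m.+1)) : measurable A -> measurable (@consrV R m @^-1` A).
  by move=> mA; rewrite -[X in measurable X]setTI; exact: measurable_consrV.
have cubeE M : 0 <= M -> P (@consrV R m @^-1` cube m.+1 M) = ((2 * M) ^+ m.+1)%:E.
  move=> M0; rewrite (_ : _ @^-1` _ = `[- M, M]%classic `*` cube m M).
    apply: etrans (product_measure1E _ _ _ _) _ => //; first exact: measurable_cube.
    by rewrite mucube// exprS EFinM -lebesgue_itvNr.
  apply/seteqP; split => [[t v] /= tv|[t v] /= [tM vM] j].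
    split; first by have := tv (lshift m ord0 : 'I_(1 + m)); rewrite consrVl in_itv/= -ler_norml.
    by move=> j; have := tv (rshift 1 j : 'I_(1 + m)); rewrite consrVr.
  case: (@split_ordP 1 m j) => k ->; rewrite ?consrVl ?consrVr//=.
  by rewrite ler_norml; move: tM; rewrite in_itv.
have [||||nu nuE] := @sigma_finite_measure_of _ (borel R m.+1) R
    (fun A => P (@consrV R m @^-1` A)).
- by rewrite preimage_set0 measure0.
- by move=> A; exact: measure_ge0.
- move=> F mF tF mUF; rewrite preimage_bigcup.
  apply: measure_semi_sigma_additive.
  + by move=> i; exact: mc.
  + apply/trivIsetP => /= i j _ _ ij; rewrite -preimage_setI.
    by move/trivIsetP : tF => /(_ _ _ _ _ ij) ->//; rewrite preimage_set0.
  + by rewrite -preimage_bigcup; exact: mc.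
- exists (fun k => cube m.+1 k%:R); first by rewrite bigcup_cube.
  by move=> k; split; [exact: measurable_cube|rewrite cubeE// ltry].
exists nu; split => [A mA|]; rewrite nuE//.
rewrite /P /= /product_measure1.
apply: eq_integral => t _ /=; rewrite muE; last first.
  by apply: measurable_xsection; exact: mc.
by congr lebesgue_rV; apply/seteqP; split => v /=; rewrite /xsection/= ?inE.
Qed.

End lebesgue.
Arguments cube {R} n M.

(** [lebesgue_rV] is a bare function on all sets; this is a bundled measure that agrees with it on
    Borel sets. *)
Definition lebV (R : realType) n : {sigma_finite_measure set (borel R n) -> \bar R} :=
  sval (cid (@lebesgue_rV_measure R n)).

Definition pushforward_measure d d' (T1 : measurableType d) (T2 : measurableType d')
    (R : realType) (m : {measure set T1 -> \bar R}) (f : T1 -> T2)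
    (mf : measurable_fun setT f) : {measure set T2 -> \bar R}.
Proof. by refine (pushforward m f : {measure set T2 -> \bar R}); exact: mf. Defined.

(** * Lebesgue measure under dilations *)

Section scaling.
Context {R : realType}.
Implicit Types (a : R).

Lemma lebVE n (A : set (borel R n)) : measurable A -> lebesgue_rV (A : set 'rV[R]_n) = lebV R n A.
Proof. by rewrite /lebV; case: cid => mu [muE _] /= /muE. Qed.

Lemma lebV_cube n (M : R) : 0 <= M -> lebV R n (cube n M) = ((2 * M) ^+ n)%:E.
Proof. by rewrite /lebV; case: cid => mu [_ muE] /= /muE. Qed.

Lemma measurable_mulr a : measurable_fun setT ( *%R a : measurableTypeR R -> measurableTypeR R).
Proof. exact: mulrl_measurable. Qed.

(** Uniqueness of Lebesgue measure: the right side is a measure, and it has the correct value on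
    half-open intervals. *)
Lemma lebesgue_measure_mul_gt0 a (A : set (measurableTypeR R)) : 0 < a -> measurable A ->
  lebesgue_measure A = (a%:E * lebesgue_measure (( *%R a : measurableTypeR R -> measurableTypeR R) @^-1` A))%E.
Proof.
move=> a0 mA.
pose c := NngNum (ltW a0).
rewrite -[RHS]/(mscale c
  (pushforward_measure lebesgue_measure (measurable_mulr a)) A).
apply: lebesgue_measure_unique => //= _ [[x y]] _ <-.
transitivity (a%:E * @lebesgue_measure R `](x / a)%R, (y / a)%R]%classic)%E; last first.
  congr (_ * lebesgue_measure _)%E; apply/seteqP; split => t /=;
  by rewrite !in_itv/= ltr_pdivrMr// ler_pdivlMr// mulrC.
rewrite !lebesgue_measure_itv/= !lte_fin ltr_pM2r ?invr_gt0//.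
case: ifPn => _; last by rewrite mule0.
by rewrite -!EFinB -EFinM -mulrBl mulrCA divff ?mulr1// gt_eqF.
Qed.

Lemma lebesgue_measure_mul a (A : set (measurableTypeR R)) : a != 0 -> measurable A ->
  lebesgue_measure A = (`|a|%:E * lebesgue_measure (( *%R a : measurableTypeR R -> measurableTypeR R) @^-1` A))%E.
Proof.
move=> a0 mA; have [a_ge0|a_lt0] := leP 0 a.
  by rewrite ger0_norm//; apply: lebesgue_measure_mul_gt0 => //; rewrite lt_def a0.
rewrite ltr0_norm// -(lebesgue_measureN mA) /pushforward.
rewrite [LHS](@lebesgue_measure_mul_gt0 (- a)) ?oppr_gt0//; last first.
  have mo : measurable_fun setT (-%R : measurableTypeR R -> measurableTypeR R).
    exact: oppr_measurable.
  by rewrite -[X in measurable X]setTI; exact: mo.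
by congr (_ * lebesgue_measure _)%E; apply/seteqP; split => t /=; rewrite mulNr opprK.
Qed.

Lemma ge0_integral_mul a (f : measurableTypeR R -> \bar R) : a != 0 ->
  measurable_fun setT f -> (forall t, 0 <= f t)%E ->
  (\int[@lebesgue_measure R]_t f t = `|a|%:E * \int[@lebesgue_measure R]_t f (a * t)%R)%E.
Proof.
move=> a0 mf f0.
have na0 : 0 < `|a| by rewrite normr_gt0.
pose c := NngNum (ltW na0).
transitivity (\int[mscale c
    (pushforward_measure lebesgue_measure (measurable_mulr a))]_t f t)%E.
  by apply: eq_measure_integral => A mA _; rewrite [LHS](lebesgue_measure_mul a0).
rewrite ge0_integral_mscale//; congr (_ * _)%E.
by rewrite ge0_integral_pushforward//; exact: measurable_mulr.
Qed.

Lemma section_scale m a (A : set 'rV[R]_m.+1) (t : R) :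
  [set v : 'rV[R]_m | A (a *: row_mx (t%:M : 'rV[R]_1) v)] =
  [set v | A (row_mx ((a * t)%:M : 'rV[R]_1) (a *: v))].
Proof.
by apply/seteqP; split => v /=; rewrite -scale_scalar_mx -scale_row_mx.
Qed.

Lemma measurable_preimage_scale n a (A : set 'rV[R]_n) :
  measurable (A : set (borel R n)) ->
  measurable ([set x | A (a *: x)] : set (borel R n)).
Proof.
move=> mA; rewrite -[X in measurable X]setTI.
have mf : measurable_fun setT ( *:%R a : borel R n -> borel R n).
  by apply: continuous_measurable_rVV => x; exact: scaler_continuous.
exact: mf.
Qed.

Lemma lebesgue_rV_ge0 n (A : set 'rV[R]_n) : (0 <= lebesgue_rV A)%E.
Proof.
elim: n A => [|n IH] A /=; first by rewrite lee_fin indicE.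
by apply: integral_ge0 => t _; exact: IH.
Qed.

Lemma measurable_section_lebesgue m (A : set 'rV[R]_m.+1) :
  measurable (A : set (borel R m.+1)) ->
  measurable_fun setT (fun t : measurableTypeR R =>
     lebesgue_rV [set v | A (row_mx (t%:M : 'rV[R]_1) v)]).
Proof.
move=> mA.
have mP : measurable (@consrV R m @^-1` A).
  by rewrite -[X in measurable X]setTI; exact: measurable_consrV.
have := measurable_fun_xsection (lebV R m) mP.
apply: eq_measurable_fun => t _ /=; rewrite -lebVE; last exact: measurable_xsection.
by congr lebesgue_rV; apply/seteqP; split => v /=; rewrite /xsection/= ?inE.
Qed.

(** The outer one-dimensional integral contributes one factor |a|, and the induction hypothesis on
    the slices contributes the remaining ones. *)
Lemma lebesgue_rV_preimage_scale n a (A : set 'rV[R]_n) : a != 0 ->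
  measurable (A : set (borel R n)) ->
  lebesgue_rV A = ((`|a| ^+ n)%:E * lebesgue_rV [set x | A (a *: x)])%E.
Proof.
move=> a0; elim: n A => [|m IH] A mA.
  by rewrite expr0 mul1e /= !indicE; do 3 congr (_ _);
    apply/asboolP/asboolP => /=; rewrite scaler0.
rewrite [LHS]/= [LHS](ge0_integral_mul a0)//; last 2 first.
- exact: measurable_section_lebesgue.
- by move=> t; exact: lebesgue_rV_ge0.
rewrite exprS EFinM -muleA; congr (_ * _)%E.
rewrite -ge0_integralZl//=; last 2 first.
- apply: (@measurable_section_lebesgue _ [set x | A (a *: x)]).
  exact: measurable_preimage_scale.
- by move=> *; exact: lebesgue_rV_ge0.
apply: eq_integral => t _; rewrite IH; last exact: measurable_section.
by rewrite section_scale.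
Qed.

End scaling.

(** * The Brunn-Minkowski inequality *)

Section prekopa_leindler.
Context {R : realType}.
Local Notation leb := (@lebesgue_measure R).

(** The infimum and the supremum of I need not belong to I; points of I within e/2 of them serve as
    substitutes. *)
Lemma approx_length (I : set R) (M e : R) : measurable I -> I !=set0 ->
  (forall t, I t -> `|t| <= M) -> 0 < e ->
  exists t1 t2, [/\ I t1, I t2 & (leb I <= (t2 - t1 + e)%:E)%E].
Proof.
move=> mI I0 IM e0.
have supI : has_sup I.
  by split => //; exists M => t /IM; rewrite ler_norml => /andP[].
have infI : has_inf I.
  by split => //; exists (- M) => t /IM; rewrite ler_norml => /andP[].
have e2 : 0 < e / 2 by rewrite divr_gt0.
have [t1 It1 t1e] := inf_adherent e2 infI.
have [t2 It2 t2e] := sup_adherent e2 supI.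
exists t1, t2; split => //.
apply: (@le_trans _ _ (leb `[inf I, sup I]%classic)).
  apply: le_measure; rewrite ?inE//.
  move=> t It /=; rewrite in_itv/=; apply/andP; split.
    by apply: ge_inf => //; case: infI.
  by apply: ub_le_sup => //; case: supI.
rewrite lebesgue_measure_itv/=; case: ifPn => _; rewrite -?EFinB lee_fin; first by lra.
have : t1 <= sup I by apply: ub_le_sup => //; case: supI.
have : inf I <= t2 by apply: ge_inf => //; case: infI.
lra.
Qed.

(** With t1, t2 and s1, s2 nearly spanning I and J, the set E contains the segment from (1-l) t1 + l
    s1 to (1-l) t2 + l s2, whose length reaches the left side up to e. *)
Lemma brunn_minkowski1 (I J E : set R) (M l : R) : 0 < l < 1 ->
  measurable I -> measurable J -> measurable E ->
  I !=set0 -> J !=set0 -> is_interval I -> is_interval J ->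
  (forall t, I t -> `|t| <= M) -> (forall t, J t -> `|t| <= M) ->
  (forall t s, I t -> J s -> E ((1 - l) * t + l * s)) ->
  ((1 - l)%:E * leb I + l%:E * leb J <= leb E)%E.
Proof.
move=> /andP[l0 l1] mI mJ mE I0 J0 iI iJ IM JM IJE.
apply/lee_addgt0Pr => e e0.
have [t1 [t2 [It1 It2 lI]]] := approx_length mI I0 IM e0.
have [s1 [s2 [Js1 Js2 lJ]]] := approx_length mJ J0 JM e0.
apply: (@le_trans _ _ ((1 - l)%:E * (t2 - t1 + e)%:E + l%:E * (s2 - s1 + e)%:E)%E).
  by apply: leeD; apply: lee_wpmul2l => //; rewrite lee_fin; lra.
rewrite -!EFinM -EFinD.
rewrite (_ : (1 - l) * (t2 - t1 + e) + l * (s2 - s1 + e) = ((1 - l) * (t2 - t1) + l * (s2 - s1)) + e); last by ring.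
rewrite EFinD leeD2r//.
set x1 := (1 - l) * t1 + l * s1; set x2 := (1 - l) * t2 + l * s2.
have [x12|x12] := ltP x1 x2; last first.
  by apply: le_trans (measure_ge0 _ _); rewrite lee_fin; move: x12; rewrite /x1 /x2; lra.
apply: (@le_trans _ _ (leb `[x1, x2]%classic)).
  by rewrite lebesgue_measure_itv/= lte_fin x12 -EFinB lee_fin /x1 /x2; lra.
apply: le_measure; rewrite ?inE//.
move=> x /=; rewrite in_itv/= => /andP[x1x xx2].
(* The point x sits at relative position c between x1 and x2; the points at the same position
   between t1 and t2, and between s1 and s2, combine to x. The order of the endpoints is not known,
   whence the two cases in [between]. *)
pose c := (x - x1) / (x2 - x1).
have d0 : 0 < x2 - x1 by rewrite subr_gt0.
have c0 : 0 <= c by rewrite divr_ge0 ?(ltW d0) ?subr_ge0.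
have c1 : c <= 1 by rewrite ler_pdivrMr// mul1r lerD2r.
have between (A : set R) a b : is_interval A -> A a -> A b -> A (a + c * (b - a)).
  move=> iA Aa Ab; have [ab|ba] := leP a b.
    apply: (iA a b) => //; apply/andP; split; nra.
  apply: (iA b a) => //; apply/andP; split; nra.
have -> : x = (1 - l) * (t1 + c * (t2 - t1)) + l * (s1 + c * (s2 - s1)).
  have : c * (x2 - x1) = x - x1 by rewrite divfK// gt_eqF.
  rewrite /x1 /x2 => h; lra.
by apply: IJE; exact: between.
Qed.

(** Fubini on the part of the region under the graph of k below height 1. The levels stop at 1
    because two functions normalised to supremum 1 have nonempty superlevel sets at every level
    below 1. *)
Lemma layer_cake01 (k : R -> R) : measurable_fun setT k -> (forall t, 0 <= k t) ->
  (\int[leb]_(c in `]0%R, 1%R[) leb [set t | (c <= k t)%R] =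
   \int[leb]_t (Num.min (k t) 1)%:E)%E.
Proof.
move=> mk k0.
pose U : set (measurableTypeR R * measurableTypeR R) :=
  [set z | 0 < z.1 < 1 /\ z.1 <= k z.2].
have mU : measurable U.
  rewrite (_ : U = (fst @^-1` `]0, 1[) `&` [set z | z.1 <= k z.2]); last first.
    by apply/seteqP; split => z; rewrite /U/= in_itv.
  apply: measurableI.
    by rewrite -[X in measurable X]setTI; apply: measurable_fst.
  rewrite -[X in measurable X]setTI; apply: measurable_fun_le => //.
  by apply: (measurableT_comp mk); exact: measurable_snd.
have indicU c t : (\1_U (c, t) : R) =
    \1_(`]0, 1[%classic : set R) c * \1_[set t | c <= k t] t.
  rewrite !indicE -natrM mulnb; congr ((nat_of_bool _)%:R).
  by apply/idP/andP; rewrite !inE /U/= ?in_itv.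
have mkc c : measurable [set t | c <= k t].
  rewrite -[X in measurable X]setTI; apply: measurable_fun_le => //.
have E1 c : (\int[leb]_t (\1_U (c, t))%:E =
    (\1_(`]0, 1[%classic : set R) c)%:E * leb [set t | (c <= k t)%R])%E.
  under eq_integral => t _ do rewrite indicU EFinM.
  rewrite ge0_integralZl//=.
    by rewrite integral_indic ?setIT//; exact: mkc.
  by apply/measurable_EFinP; apply: measurable_indic; exact: mkc.
have E2 t : (\int[leb]_c (\1_U (c, t))%:E = (Num.min (k t) 1)%:E)%E.
  have -> : (fun c => (\1_U (c, t))%:E) =
      (fun c => (\1_([set c | 0 < c < 1 /\ c <= k t]) c)%:E) :> (R -> \bar R).
    by apply/funext => c; rewrite !indicE.
  have setE : [set c | 0 < c < 1 /\ c <= k t] =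
      (if k t < 1 then `]0, k t]%classic else `]0, 1[%classic) :> set R.
    apply/seteqP; split => c; case: ifPn => kt1 /=; rewrite in_itv/=.
    - by move=> [/andP[-> _] ->].
    - by move=> [].
    - by move=> /andP[-> ckt]; rewrite (le_lt_trans ckt).
    - move=> /andP[-> c1]; split => //; rewrite leNgt; apply: contra kt1 => kc.
      exact: lt_trans c1.
  rewrite setE integral_indic//; last by case: ifPn => _; exact: measurable_itv.
  rewrite setIT minElt; case: ifPn => kt1.
    rewrite [LHS]lebesgue_measure_itv/= lte_fin -EFinB subr0; case: ifPn => //.
    rewrite -leNgt => h; suff -> : k t = 0 by [].
    by apply/eqP; rewrite eq_le h k0.
  by rewrite [LHS]lebesgue_measure_itv/= lte_fin ltr01 -EFinB subr0.
transitivity (\int[leb]_c \int[leb]_t (\1_U (c, t))%:E)%E.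
  rewrite integral_mkcond; apply: eq_integral => c _; rewrite E1.
  by rewrite patchE indicE; case: ifPn => _; rewrite ?mul1e ?mul0e.
transitivity (\int[leb]_t \int[leb]_c (\1_U (c, t))%:E)%E.
  apply: (@fubini_tonelli _ _ _ _ R leb leb (fun z => (\1_U z)%:E)) => //.
  by apply/measurable_EFinP; exact: measurable_indic.
by apply: eq_integral => t _; exact: E2.
Qed.

Lemma measurable_superlevel (k : R -> R) (D : set (measurableTypeR R)) :
  measurable_fun setT k ->
  measurable_fun D (fun c : measurableTypeR R => leb [set t | (c <= k t)%R]).
Proof.
move=> mk; apply: measurable_funTS.
pose U : set (measurableTypeR R * measurableTypeR R) := [set z | z.1 <= k z.2].
have mU : measurable U.
  rewrite -[X in measurable X]setTI; apply: measurable_fun_le => //.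
  by apply: (measurableT_comp mk); exact: measurable_snd.
have := measurable_fun_xsection leb mU.
apply: eq_measurable_fun => c _ /=; congr (leb _).
by apply/seteqP; split => t; rewrite /xsection /= inE.
Qed.

(** After division of f and g by their suprema, both have nonempty superlevel sets at every level
    below 1, so the one-dimensional inequality applies level by level. Integration over the levels
    gives the arithmetic mean of the normalised integrals, and AM-GM the geometric one. *)
Lemma prekopa_leindler1 (f g h : R -> R) (M B l a b c : R) : 0 < l < 1 ->
  measurable_fun setT f -> measurable_fun setT g -> measurable_fun setT h ->
  (forall t, 0 <= f t) -> (forall t, 0 <= g t) -> (forall t, 0 <= h t) ->
  (forall x, is_interval [set t | x <= f t]) ->
  (forall x, is_interval [set t | x <= g t]) ->
  (forall t, f t != 0 -> `|t| <= M) -> (forall t, g t != 0 -> `|t| <= M) ->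
  (forall t, f t <= B) -> (forall t, g t <= B) ->
  (forall t s, f t `^ (1 - l) * g s `^ l <= h ((1 - l) * t + l * s)) ->
  (\int[leb]_t (f t)%:E = a%:E)%E -> (\int[leb]_t (g t)%:E = b%:E)%E ->
  (\int[leb]_t (h t)%:E = c%:E)%E ->
  a `^ (1 - l) * b `^ l <= c.
Proof.
move=> l01 mf mg mh f0 g0 h0 If Ig Mf Mg Bf Bg fgh fa gb hc.
have /andP[l0 l1] := l01.
have l1' : 0 < 1 - l by rewrite subr_gt0.
have c0 : 0 <= c by rewrite -lee_fin -hc; apply: integral_ge0 => t _; rewrite lee_fin.
have sup_f (k : R -> R) : (forall t, 0 <= k t) -> (forall t, k t <= B) ->
    (forall t, k t <= sup (range k)) /\
    ((\int[leb]_t (k t)%:E = 0)%E \/ 0 < sup (range k)).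
  move=> k0 kB.
  have ksup t : k t <= sup (range k).
    by apply: ub_le_sup; [exists B => _ [s _ <-]|exists t].
  split => //; have [|s0] := ltP 0 (sup (range k)); first by right.
  left; rewrite (eq_integral (cst 0%E)) ?integral0// => t _; congr EFin.
  by apply/eqP; rewrite eq_le k0 (le_trans (ksup t)).
(* A function with supremum at most 0 vanishes identically, and then the left side of the claim is
   0. *)
have [fF [f00|F0]] := sup_f f f0 Bf.
  by move: fa; rewrite f00 => -[<-]; rewrite powR0 ?gt_eqF// mul0r.
have [gG [g00|G0]] := sup_f g g0 Bg.
  by move: gb; rewrite g00 => -[<-]; rewrite (@powR0 _ l) ?gt_eqF// mulr0.
set F := sup (range f) in fF F0; set G := sup (range g) in gG G0.
pose H := F `^ (1 - l) * G `^ l.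
have H0 : 0 < H by rewrite mulr_gt0// powR_gt0.
have norm_ge0 (k : R -> R) K : 0 < K -> (forall t, 0 <= k t) -> forall t, 0 <= k t / K.
  by move=> K0 k0 t; rewrite divr_ge0// ltW.
have norm_meas (k : R -> R) K : measurable_fun setT k ->
    measurable_fun setT (fun t => k t / K).
  by move=> mk; apply: measurable_funM.
have norm_int (k : R -> R) K x : 0 < K -> measurable_fun setT k ->
    (forall t, 0 <= k t) -> (\int[leb]_t (k t)%:E = x%:E)%E ->
    (\int[leb]_t (k t / K)%:E = (x / K)%:E)%E.
  move=> K0 mk k0 kx; under eq_integral => t _ do rewrite EFinM.
  rewrite ge0_integralZr//.
  - by rewrite kx -EFinM.
  - exact/measurable_EFinP.
  - by move=> t _; rewrite lee_fin.
  - by rewrite lee_fin invr_ge0 ltW.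
have level_bm x : 0 < x < 1 ->
   ((1 - l)%:E * leb [set t | (x <= f t / F)%R] +
    l%:E * leb [set t | (x <= g t / G)%R] <= leb [set t | (x <= h t / H)%R])%E.
  move=> /andP[x0 x1].
  have level (k : R -> R) K : 0 < K -> [set t | x <= k t / K] = [set t | x * K <= k t].
    by move=> K0; apply/seteqP; split => t /=; rewrite ler_pdivlMr.
  have mlevel (k : R -> R) y : measurable_fun setT k -> measurable [set t | y <= k t].
    by move=> mk; rewrite -[X in measurable X]setTI; apply: measurable_fun_le.
  have level0 (k : R -> R) : 0 < sup (range k) -> [set t | x * sup (range k) <= k t] !=set0.
    move=> K0; have : x * sup (range k) < sup (range k) by rewrite gtr_pMl.
    by move=> /sup_gt[|_ [t _ <-] kt]; [exists (k 0), 0|exists t; exact: ltW].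
  have nz (k : R -> R) K t : 0 < K -> x * K <= k t -> k t != 0.
    by move=> K0 kt; rewrite gt_eqF// (lt_le_trans _ kt)// mulr_gt0.
  rewrite !level//.
  apply: (@brunn_minkowski1 _ _ _ M) => //; try exact: mlevel; try exact: level0.
  - by move=> t /= ft; apply: Mf; exact: nz ft.
  - by move=> t /= ft; apply: Mg; exact: nz ft.
  - move=> t s /= ft gs; apply: le_trans (fgh t s).
    have -> : x * H = (x * F) `^ (1 - l) * (x * G) `^ l.
      rewrite !powRM ?(ltW F0) ?(ltW G0) ?(ltW x0)// mulrACA -powRD ?subrK ?(powRr1 (ltW x0))//.
      by rewrite (gt_eqF x0) implybT.
    have xF : 0 <= x * F by rewrite mulr_ge0// ltW.
    have xG : 0 <= x * G by rewrite mulr_ge0// ltW.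
    by apply: ler_pM; rewrite ?powR_ge0//; apply: ge0_ler_powR;
      rewrite ?nnegrE ?(ltW l0) ?(ltW l1').
(* The quotient h / H may exceed 1, so only its layers up to height 1 are compared, through the
   minimum with 1. *)
have key : (1 - l) * (a / F) + l * (b / G) <= c / H.
  rewrite -lee_fin EFinD !EFinM.
  have int_level (k : R -> R) K x : 0 < K -> measurable_fun setT k ->
      (forall t, 0 <= k t) -> (forall t, k t <= K) ->
      (\int[leb]_t (k t)%:E = x%:E)%E ->
      (\int[leb]_(y in `]0%R, 1%R[) leb [set t | (y <= k t / K)%R] = (x / K)%:E)%E.
    move=> K0 mk k0 kK kx; rewrite layer_cake01//; [|exact: norm_meas|exact: norm_ge0].
    rewrite -(norm_int _ _ _ K0 mk k0 kx); apply: eq_integral => t _.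
    by congr EFin; apply/min_idPl; rewrite ler_pdivrMr// mul1r.
  rewrite -!EFinM (EFinM (1 - l)) (EFinM l).
  rewrite -(int_level f F a)// -(int_level g G b)//.
  rewrite -(norm_int h H c)//.
  apply: (@le_trans _ _ (\int[leb]_t (Num.min (h t / H) 1)%:E)%E); last first.
    apply: ge0_le_integral => //.
    - by move=> t _; rewrite lee_fin le_min ler01 norm_ge0.
    - apply/measurable_EFinP; apply: measurable_minr => //; exact: norm_meas.
    - by apply/measurable_EFinP; exact: norm_meas.
    - by move=> t _; rewrite lee_fin ge_min lexx.
  rewrite -layer_cake01; [|exact: norm_meas|exact: norm_ge0].
  rewrite -!ge0_integralZl//.
  - rewrite -ge0_integralD//.
    + apply: ge0_le_integral => //.
      * by move=> x _; rewrite adde_ge0 ?mule_ge0 ?lee_fin ?(ltW l0) ?(ltW l1').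
      * apply: emeasurable_funD; apply: emeasurable_funM => //;
        exact: measurable_superlevel (norm_meas _ _ _).
      * exact: measurable_superlevel (norm_meas _ _ _).
    + by move=> x _; rewrite mule_ge0 ?lee_fin ?(ltW l1').
    + apply: emeasurable_funM => //; exact: measurable_superlevel (norm_meas _ _ _).
    + by move=> x _; rewrite mule_ge0 ?lee_fin ?(ltW l0).
    + apply: emeasurable_funM => //; exact: measurable_superlevel (norm_meas _ _ _).
  - exact: measurable_superlevel (norm_meas _ _ _).
  - exact: ltW.
  - exact: measurable_superlevel (norm_meas _ _ _).
  - exact: ltW.
have a0 : 0 <= a by rewrite -lee_fin -fa; apply: integral_ge0 => t _; rewrite lee_fin.
have b0 : 0 <= b by rewrite -lee_fin -gb; apply: integral_ge0 => t _; rewrite lee_fin.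
have aF0 : 0 <= a / F by rewrite divr_ge0// ltW.
have bG0 : 0 <= b / G by rewrite divr_ge0// ltW.
have := le_trans (powR_amgm l01 aF0 bG0) key.
rewrite ler_pdivlMr//; apply: le_trans; rewrite /H mulrACA -!powRM ?(ltW F0) ?(ltW G0)//.
by rewrite !divfK ?gt_eqF.
Qed.

End prekopa_leindler.

(** * From dimension one to dimension n by slicing *)

Section brunn_minkowski.
Context {R : realType}.
Local Notation leb := (@lebesgue_measure R).

(** Convexity with a plain real coefficient in [0, 1], in place of the bundled unit-interval type
    behind [convex_set]. *)
Definition convex_closed n (A : set 'rV[R]_n) :=
  forall x y, A x -> A y -> forall c : R, 0 <= c <= 1 -> A ((1 - c) *: x + c *: y).

Lemma lebV_sub_cube n (A : set (borel R n)) (M : R) : 0 <= M -> measurable A ->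
  A `<=` cube n M -> (lebV R n A <= ((2 * M) ^+ n)%:E)%E.
Proof.
move=> M0 mA AM; rewrite -lebV_cube//; apply: le_measure; rewrite ?inE//.
exact: measurable_cube.
Qed.

Lemma lebV_fin_num n (A : set (borel R n)) (M : R) : 0 <= M -> measurable A ->
  A `<=` cube n M -> lebV R n A \is a fin_num.
Proof.
move=> M0 mA AM; rewrite ge0_fin_numE ?measure_ge0//.
by rewrite (le_lt_trans (lebV_sub_cube M0 mA AM))// ltry.
Qed.

Definition slice m (A : set 'rV[R]_m.+1) (t : R) : set 'rV[R]_m :=
  [set v | A (row_mx (t%:M : 'rV[R]_1) v)].

Lemma slice_comb m (a b t s : R) (v w : 'rV[R]_m) :
  row_mx ((a * t + b * s)%:M : 'rV[R]_1) (a *: v + b *: w) =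
  a *: row_mx (t%:M : 'rV[R]_1) v + b *: row_mx (s%:M : 'rV[R]_1) w.
Proof. by rewrite !scale_row_mx add_row_mx !scale_scalar_mx raddfD. Qed.

Lemma slice_cube m M t (A : set 'rV[R]_m.+1) : A `<=` cube m.+1 M ->
  slice A t `<=` cube m M.
Proof.
by move=> AM v /AM Av j; rewrite -(consrVr (t, v)); exact: Av.
Qed.

Lemma slice_supp m M t (A : set 'rV[R]_m.+1) : A `<=` cube m.+1 M ->
  slice A t !=set0 -> `|t| <= M.
Proof.
move=> AM [v /AM /(_ (lshift m ord0 : 'I_(1 + m)))].
by rewrite (consrVl (t, v)).
Qed.

(** Induction on the dimension: the slice volumes of A, B and C satisfy the hypotheses of the
    one-dimensional functional inequality, the multiplicative one by the induction hypothesis. C is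
    any Borel set containing the combinations, so that no Minkowski sum has to be shown
    measurable. *)
Lemma brunn_minkowski_mult n (A B C : set (borel R n)) (M l : R) :
  0 < l < 1 -> 0 <= M ->
  measurable A -> measurable B -> measurable C ->
  A `<=` cube n M -> B `<=` cube n M -> C `<=` cube n M ->
  convex_closed A -> convex_closed B ->
  (forall x y : 'rV[R]_n, A x -> B y -> C ((1 - l) *: x + l *: y)) ->
  fine (lebV R n A) `^ (1 - l) * fine (lebV R n B) `^ l <= fine (lebV R n C).
Proof.
move=> + M0; elim: n A B C l => [|m IH] A B C l l01 mA mB mC AM BM CM cA cB ABC.
  have /andP[l0 l1] := l01.
  rewrite -!lebVE//= !indicE.
  have [A0|A0] := boolP (_ \in A); last by rewrite powR0 ?mul0r ?ler0n// gt_eqF// subr_gt0.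
  have [B0|B0] := boolP (_ \in B); last by rewrite (@powR0 _ l) ?mulr0 ?ler0n// gt_eqF.
  rewrite !powR1 mul1r mem_set//.
  move: A0 B0; rewrite !inE => A0 B0; have := ABC _ _ A0 B0.
  by rewrite !scaler0 addr0.
have mS (X : set (borel R m.+1)) t : measurable X -> measurable (slice X t : set (borel R m)).
  exact: measurable_section.
have sfin (X : set (borel R m.+1)) t : measurable X -> X `<=` cube m.+1 M ->
    lebV R m (slice X t) \is a fin_num.
  by move=> mX XM; apply: lebV_fin_num M0 (mS _ _ mX) _; exact: slice_cube.
have smeas (X : set (borel R m.+1)) : measurable X ->
    measurable_fun setT (fun t : measurableTypeR R => fine (lebV R m (slice X t))).
  move=> mX; have mf : measurable_fun setT
      (fun t : measurableTypeR R => lebV R m (slice X t)).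
    apply: eq_measurable_fun (measurable_section_lebesgue mX) => t _.
    by rewrite lebVE//; exact: mS.
  exact: (measurableT_comp (@fine_measurable R setT measurableT) mf).
have sint (X : set (borel R m.+1)) : measurable X -> X `<=` cube m.+1 M ->
    (\int[leb]_t (fine (lebV R m (slice X t)))%:E = (fine (lebV R m.+1 X))%:E)%E.
  move=> mX XM; rewrite fineK; last exact: lebV_fin_num M0 mX XM.
  rewrite -lebVE//=; apply: eq_integral => t _; rewrite fineK; last exact: sfin.
  by rewrite lebVE//; exact: mS.
have convS (X : set (borel R m.+1)) t : convex_closed X -> convex_closed (slice X t).
  move=> cX x y Xx Xy c c01; rewrite /slice/=.
  by have := cX _ _ Xx Xy c c01; rewrite -slice_comb -mulrDl subrK mul1r.
have supp (X : set (borel R m.+1)) t : measurable X -> X `<=` cube m.+1 M ->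
    fine (lebV R m (slice X t)) != 0 -> `|t| <= M.
  move=> mX XM; apply: contra_neqP => tM.
  have -> : slice X t = set0.
    by apply/seteqP; split => // v Xv; apply: tM; apply: slice_supp XM _; exists v.
  by rewrite measure0.
have sle (X : set (borel R m.+1)) t : measurable X -> X `<=` cube m.+1 M ->
    fine (lebV R m (slice X t)) <= (2 * M) ^+ m.
  move=> mX XM; rewrite -lee_fin fineK; last exact: sfin.
  by apply: lebV_sub_cube => //; [exact: mS|exact: slice_cube].
have sge0 (X : set (borel R m.+1)) t : 0 <= fine (lebV R m (slice X t)).
  exact: fine_ge0.
(* Quasi-concavity of the slice volume: the induction hypothesis applied to three slices of the same
   convex set, at t, at s and at a point u between them. *)
have itv (X : set (borel R m.+1)) x : measurable X -> X `<=` cube m.+1 M ->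
    convex_closed X -> is_interval [set t | x <= fine (lebV R m (slice X t))].
  move=> mX XM cX t s /= xt xs u /andP[tu us].
  have [x0|x0] := leP x 0; first exact: le_trans x0 (sge0 _ _).
  move: tu us; rewrite le_eqVlt => /predU1P[<-//|tu].
  rewrite le_eqVlt => /predU1P[->//|us].
  have ts : 0 < s - t by rewrite subr_gt0 (lt_trans tu).
  pose c := (u - t) / (s - t).
  have c01 : 0 < c < 1.
    apply/andP; split; first by rewrite divr_gt0// subr_gt0.
    by rewrite ltr_pdivrMr// mul1r ltrD2r.
  have uE : u = (1 - c) * t + c * s.
    have : c * (s - t) = u - t by rewrite divfK// gt_eqF.
    by move=> h; lra.
  have := IH (slice X t) (slice X s) (slice X u) c c01.
  move=> /(_ (mS _ _ mX) (mS _ _ mX) (mS _ _ mX) (slice_cube XM) (slice_cube XM)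
    (slice_cube XM) (convS _ _ cX) (convS _ _ cX)).
  have /andP[c0 c1] := c01.
  move=> h; apply: le_trans (h _); last first.
    move=> v w Xv Xw; rewrite /slice/= uE slice_comb; apply: cX => //.
    by rewrite !ltW.
  rewrite -[leLHS](powRr1 (ltW x0)) -{1}(subrK c 1) powRD ?(gt_eqF x0) ?implybT//.
  by apply: ler_pM; rewrite ?powR_ge0//; apply: ge0_ler_powR;
    rewrite ?nnegrE ?(ltW c0) ?(ltW x0)// subr_ge0 ltW.
apply: (@prekopa_leindler1 R _ _ _ M ((2 * M) ^+ m) l _ _ _ l01
  (smeas A mA) (smeas B mB) (smeas C mC)) => //.
- by move=> x; exact: itv.
- by move=> x; exact: itv.
- by move=> t; exact: supp.
- by move=> t; exact: supp.
- by move=> t; exact: sle.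
- by move=> t; exact: sle.
- move=> t s; apply: IH => //; try exact: mS; try exact: slice_cube; try exact: convS.
  by move=> v w Av Bw; rewrite /slice/= slice_comb; exact: ABC.
- exact: sint.
- exact: sint.
- exact: sint.
Qed.

(** For equal volumes the geometric mean of the two is their common value. *)
Lemma brunn_minkowski_eq n (A B C : set (borel R n)) (M l : R) :
  0 < l < 1 -> 0 <= M ->
  measurable A -> measurable B -> measurable C ->
  A `<=` cube n M -> B `<=` cube n M -> C `<=` cube n M ->
  convex_closed A -> convex_closed B ->
  (forall x y : 'rV[R]_n, A x -> B y -> C ((1 - l) *: x + l *: y)) ->
  fine (lebV R n A) = fine (lebV R n B) ->
  fine (lebV R n A) <= fine (lebV R n C).
Proof.
move=> l01 M0 mA mB mC AM BM CM cA cB ABC AB.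
have := brunn_minkowski_mult l01 M0 mA mB mC AM BM CM cA cB ABC.
rewrite -AB -powRD ?subrK ?powRr1 ?fine_ge0//.
by rewrite oner_eq0.
Qed.

End brunn_minkowski.

(** * Euclidean geometry of convex bodies *)

Ltac vring := apply/rowP => ?; rewrite !mxE; ring.

Section dot_enorm.
Context {R : realType} {n : nat}.
Implicit Types (x y z : 'rV[R]_n).

Lemma dotC x y : dot x y = dot y x.
Proof. by rewrite /dot; apply: eq_bigr => i _; rewrite mulrC. Qed.

Lemma dotDl x y z : dot (x + y) z = dot x z + dot y z.
Proof. by rewrite /dot -big_split/=; apply: eq_bigr => i _; rewrite mxE mulrDl. Qed.

Lemma dotZl (a : R) x z : dot (a *: x) z = a * dot x z.
Proof. by rewrite /dot mulr_sumr; apply: eq_bigr => i _; rewrite mxE mulrA. Qed.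

Lemma dotDr x y z : dot z (x + y) = dot z x + dot z y.
Proof. by rewrite dotC dotDl !(dotC z). Qed.

Lemma dotZr (a : R) x z : dot z (a *: x) = a * dot z x.
Proof. by rewrite dotC dotZl dotC. Qed.

Lemma dotNl x z : dot (- x) z = - dot x z.
Proof. by rewrite -scaleN1r dotZl mulN1r. Qed.

Lemma dotNr x z : dot z (- x) = - dot z x.
Proof. by rewrite dotC dotNl dotC. Qed.

Lemma dotBl x y z : dot (x - y) z = dot x z - dot y z.
Proof. by rewrite dotDl dotNl. Qed.

Lemma dotBr x y z : dot z (x - y) = dot z x - dot z y.
Proof. by rewrite dotDr dotNr. Qed.

Lemma dot_ge0 x : 0 <= dot x x.
Proof. by rewrite /dot sumr_ge0// => i _; rewrite -expr2 sqr_ge0. Qed.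

Lemma enorm_ge0 x : 0 <= enorm x.
Proof. exact: sqrtr_ge0. Qed.

Lemma sqr_enorm x : enorm x ^+ 2 = dot x x.
Proof. by rewrite sqr_sqrtr// dot_ge0. Qed.

Lemma enormZ (a : R) x : enorm (a *: x) = `|a| * enorm x.
Proof. by rewrite /enorm dotZl dotZr mulrA sqrtrM -?expr2 ?sqr_ge0// sqrtr_sqr. Qed.

Lemma enormN x : enorm (- x) = enorm x.
Proof. by rewrite -scaleN1r enormZ normrN1 mul1r. Qed.

Lemma enorm0 : enorm (0 : 'rV[R]_n) = 0.
Proof. by rewrite -(scale0r 0) enormZ normr0 mul0r. Qed.

Lemma enorm_distC x y : enorm (x - y) = enorm (y - x).
Proof. by rewrite -enormN opprB. Qed.

Lemma coord_le_enorm x i : `|x ord0 i| <= enorm x.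
Proof.
rewrite -sqrtr_sqr ler_wsqrtr// /dot (bigD1 i)//= -expr2 lerDl.
by rewrite sumr_ge0// => j _; rewrite -expr2 sqr_ge0.
Qed.

Lemma enorm_eq0 x : enorm x = 0 -> x = 0.
Proof.
move=> x0; apply/rowP => i; rewrite mxE; apply/normr0_eq0/eqP.
by rewrite -normr_le0 normr_id -x0 coord_le_enorm.
Qed.

Lemma enorm_gt0 x : x != 0 -> 0 < enorm x.
Proof.
by move=> x0; rewrite lt_def enorm_ge0 andbT; apply: contra_neq x0; exact: enorm_eq0.
Qed.

Lemma enorm_le_norm x : enorm x <= n%:R * `|x|.
Proof.
rewrite -(@ler_pXn2r _ 2) ?nnegrE ?enorm_ge0 ?mulr_ge0// sqr_enorm.
apply: (@le_trans _ _ (\sum_(i < n) `|x| ^+ 2)).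
  apply: ler_sum => i _; rewrite -expr2 -real_normK ?num_real//.
  by rewrite lerXn2r ?nnegrE ?normr_ge0// coord_norm_le.
rewrite sumr_const card_ord -[leLHS]mulr_natl exprMn ler_wpM2r ?sqr_ge0//.
by rewrite -natrX ler_nat; case: (n) => // k; exact: leq_pmulr.
Qed.

Lemma cauchy_schwarz x y : dot x y <= enorm x * enorm y.
Proof.
have [->|x0] := eqVneq x 0.
  by rewrite -(scale0r (0 : 'rV[R]_n)) dotZl enormZ normr0 !mul0r.
have [->|y0] := eqVneq y 0.
  by rewrite -(scale0r (0 : 'rV[R]_n)) dotZr enormZ normr0 !mul0r mulr0.
have ex := enorm_gt0 x0; have ey := enorm_gt0 y0.
have := dot_ge0 (enorm y *: x - enorm x *: y).
rewrite !dotBl !dotBr !dotZl !dotZr -!sqr_enorm (dotC y x) => h.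
rewrite -(@ler_pM2l _ (2 * enorm x * enorm y)) ?mulr_gt0//; nra.
Qed.

Lemma norm_dot x y : `|dot x y| <= enorm x * enorm y.
Proof. by rewrite ler_norml cauchy_schwarz andbT lerNl -dotNl -(enormN x) cauchy_schwarz. Qed.

Lemma enorm_triangle x y : enorm (x + y) <= enorm x + enorm y.
Proof.
have h : 0 <= enorm x + enorm y by rewrite addr_ge0// enorm_ge0.
rewrite -(@ler_pXn2r _ 2) ?nnegrE ?enorm_ge0//.
rewrite sqr_enorm dotDl !dotDr (dotC y x) sqrrD !sqr_enorm.
have := cauchy_schwarz x y; lra.
Qed.

Lemma enorm_lipschitz x y : `|enorm x - enorm y| <= enorm (x - y).
Proof.
have := enorm_triangle (x - y) y; have := enorm_triangle (y - x) x.
rewrite !subrK (enorm_distC y x) => h1 h2; rewrite ler_norml; lra.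
Qed.

(** The topology is that of the sup norm, whereas the estimates are Euclidean; the factor n of
    [enorm_le_norm] links the two. *)
Lemma lipschitz_continuous_rV (f : 'rV[R]_n -> R) (C : R) :
  (forall x y, `|f x - f y| <= C * enorm (x - y)) -> continuous f.
Proof.
move=> fC x; apply/(@cvgrPdist_le _ _ _ (nbhs x)) => e e0.
pose D := (`|C| * n%:R + 1).
have D0 : 0 < D by rewrite ltr_wpDl// mulr_ge0.
near=> y; apply: le_trans (fC _ _) _.
apply: (@le_trans _ _ (`|C| * (n%:R * `|x - y|))).
  apply: le_trans (ler_wpM2r (enorm_ge0 _) (ler_norm C)) _.
  by rewrite ler_wpM2l// enorm_le_norm.
have : `|x - y| < e / D.
  near: y; apply/nbhs_ballP; exists (e / D); first by rewrite /= divr_gt0.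
  by move=> z; rewrite mx_norm_ball.
rewrite ltr_pdivlMr// /D => h; apply: le_trans (ltW h).
by rewrite mulrA [leRHS]mulrC ler_wpM2r// lerDl.
Unshelve. all: by end_near. Qed.

End dot_enorm.

Lemma lipschitz_continuous_rVV (R : realType) n m (f : 'rV[R]_n -> 'rV[R]_m) (C : R) :
  (forall x y, enorm (f x - f y) <= C * enorm (x - y)) -> continuous f.
Proof.
move=> fC x A /nbhs_ballP[e /= e0 eA].
pose D := `|C| * n%:R + 1.
have D0 : 0 < D by rewrite ltr_wpDl// mulr_ge0.
apply/nbhs_ballP; exists (e / D); first by rewrite /= divr_gt0.
move=> y; rewrite mx_norm_ball /ball_/= ltr_pdivlMr// => xy; apply/eA/ball_rVP => // j.
apply: le_lt_trans xy.
have -> : f x ord0 j - f y ord0 j = (f x - f y) ord0 j by rewrite !mxE.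
apply: le_trans (coord_le_enorm _ j) _; apply: le_trans (fC _ _) _.
apply: le_trans (ler_wpM2r (enorm_ge0 _) (ler_norm C)) _.
apply: le_trans (ler_wpM2l (normr_ge0 C) (enorm_le_norm _)) _.
by rewrite mulrA [leRHS]mulrC ler_wpM2r// lerDl.
Qed.

(** * Metric projection onto a compact convex set *)

Section projection.
Context {R : realType} {n : nat} (K : set 'rV[R]_n).
Hypotheses (cK : compact K) (vK : convex_closed K) (K0 : K !=set0).
Implicit Types (x y z : 'rV[R]_n).

Lemma nearest_point_exists x : exists y, nearest_point K x y.
Proof.
have := @EVT_min_rV R n (fun y => enorm (x - y)) K K0 cK.
case.
  apply: continuous_subspaceT.
  apply: (@lipschitz_continuous_rV _ _ _ 1) => y z; rewrite mul1r.
  apply: le_trans (enorm_lipschitz _ _) _.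
  by rewrite (_ : _ - _ = z - y) 1?enorm_distC//; vring.
move=> y; rewrite inE => Ky ymin; exists y; split => // z Kz.
by apply: ymin; rewrite inE.
Qed.

(** The default 0 is never a fallback: a nearest point exists by compactness. *)
Definition nearest x := xget 0 [set y | nearest_point K x y].

Lemma nearestP x : nearest_point K x (nearest x).
Proof. by rewrite /nearest; case: xgetP => // abs; case: (nearest_point_exists x) => y /abs. Qed.

Lemma nearest_in x : K (nearest x). Proof. by have [] := nearestP x. Qed.

(** First-order condition for the minimal distance, obtained by moving from y towards z inside K. *)
Lemma nearest_point_dot x y z : nearest_point K x y -> K z -> dot (x - y) (z - y) <= 0.
Proof.
move=> [Ky ymin] Kz; rewrite leNgt; apply/negP => d0.
set d := dot _ _ in d0; set s := dot (z - y) (z - y).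
have s0 : 0 <= s by exact: dot_ge0.
have cmp c : 0 <= c <= 1 -> 2 * c * d <= c ^+ 2 * s.
  move=> c01; have := ymin _ (vK Ky Kz c01).
  have -> : x - ((1 - c) *: y + c *: z) = (x - y) - c *: (z - y).
    vring.
  rewrite -(@ler_pXn2r _ 2 _ (enorm (x - y))) ?nnegrE ?enorm_ge0// !sqr_enorm.
  rewrite /d /s; move: (x - y) (z - y) => A B.
  rewrite dotBl !dotBr !dotZl !dotZr (dotC B A) expr2; lra.
(* If d > 0, minimality along the segment gives 2 d <= c s for every c in (0, 1]. This c makes c s <
   d, and its denominator is positive even when s = 0. *)
pose c := d / (d + s).
have ds : 0 < d + s by rewrite ltr_wpDr.
have c0 : 0 < c by rewrite divr_gt0.
have c1 : c <= 1 by rewrite ler_pdivrMr// mul1r lerDl.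
have := cmp c; rewrite (ltW c0) c1 => /(_ isT).
have : c * (d + s) = d by rewrite divfK// gt_eqF.
rewrite expr2 => h1 h2.
have : 2 * d <= c * s by rewrite -(ler_pM2l c0); lra.
nra.
Qed.

Lemma nearest_point_uniq x y y' : nearest_point K x y -> nearest_point K x y' -> y = y'.
Proof.
move=> ny ny'.
have h1 := nearest_point_dot ny (proj1 ny').
have h2 := nearest_point_dot ny' (proj1 ny).
apply/eqP; rewrite -subr_eq0; apply/eqP/enorm_eq0/eqP.
rewrite -sqrf_eq0 sqr_enorm eq_le dot_ge0 andbT.
move: h1 h2; rewrite !dotBl !dotBr (dotC y' y).
by move: (dot x y) (dot x y') (dot y y) (dot y y') (dot y' y') => a b c d f; lra.
Qed.

Lemma nearest_pointE x y : nearest_point K x y <-> y = nearest x.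
Proof.
split => [nx|->]; last exact: nearestP.
exact: nearest_point_uniq nx (nearestP x).
Qed.

(** Adding the two variational inequalities bounds the squared distance of the projections by their
    inner product with x - z; Cauchy-Schwarz then cancels one factor. *)
Lemma nearest_lipschitz x z : enorm (nearest x - nearest z) <= enorm (x - z).
Proof.
have h1 := nearest_point_dot (nearestP x) (nearest_in z).
have h2 := nearest_point_dot (nearestP z) (nearest_in x).
have h3 := cauchy_schwarz (x - z) (nearest x - nearest z).
have [->|d0] := eqVneq (enorm (nearest x - nearest z)) 0; first exact: enorm_ge0.
have d1 : 0 < enorm (nearest x - nearest z) by rewrite lt_def d0 enorm_ge0.
rewrite -(ler_pM2r d1) -expr2 sqr_enorm (le_trans _ h3)//.
move: h1 h2; rewrite !dotBl !dotBr (dotC (nearest z) (nearest x)); lra.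
Qed.

Definition body_dist x := enorm (x - nearest x).

(** A unit vector only off K; for x in K the value is the zero vector. *)
Definition outer_normal x := (body_dist x)^-1 *: (x - nearest x).

Lemma body_dist_ge0 x : 0 <= body_dist x. Proof. exact: enorm_ge0. Qed.

Lemma body_dist_le x z : K z -> body_dist x <= enorm (x - z).
Proof. by have [_ h] := nearestP x; exact: h. Qed.

Lemma nearest_id x : K x -> nearest x = x.
Proof.
move=> Kx; apply/eqP; rewrite eq_sym -subr_eq0; apply/eqP/enorm_eq0/eqP.
by rewrite eq_le enorm_ge0 andbT (le_trans (body_dist_le x Kx))// subrr enorm0.
Qed.

Lemma body_dist_eq0 x : body_dist x = 0 <-> K x.
Proof.
split => [/enorm_eq0/eqP|Kx]; last by rewrite /body_dist nearest_id// subrr enorm0.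
by rewrite subr_eq0 => /eqP ->; exact: nearest_in.
Qed.

Lemma body_dist_gt0 x : ~ K x <-> 0 < body_dist x.
Proof.
rewrite lt_def body_dist_ge0 andbT; split => [Kx|/eqP + /body_dist_eq0//].
by apply/eqP => /body_dist_eq0.
Qed.

Lemma body_dist_lipschitz x z : `|body_dist x - body_dist z| <= enorm (x - z).
Proof.
have h x' z' : body_dist x' <= body_dist z' + enorm (x' - z').
  apply: le_trans (body_dist_le x' (nearest_in z')) _.
  rewrite (_ : x' - nearest z' = (z' - nearest z') + (x' - z')); last by vring.
  exact: enorm_triangle.
have := h x z; have := h z x; rewrite (enorm_distC z x) ler_norml.
by move: (body_dist x) (body_dist z) (enorm _) => a b c; lra.
Qed.

Lemma body_dist_continuous : continuous body_dist.
Proof.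
by apply: (@lipschitz_continuous_rV _ _ _ 1) => x z; rewrite mul1r body_dist_lipschitz.
Qed.

Lemma nearest_continuous : continuous nearest.
Proof.
by apply: (@lipschitz_continuous_rVV _ _ _ _ 1) => x z; rewrite mul1r nearest_lipschitz.
Qed.

Lemma normal_continuous x : 0 < body_dist x -> {for x, continuous outer_normal}.
Proof.
move=> x0; have ex : body_dist x != 0 by rewrite gt_eqF.
have h1 := @cvgV R _ (nbhs x) _ body_dist (body_dist x) ex (@body_dist_continuous x).
have h2 := @cvgB R _ _ (nbhs x) _ id nearest x (nearest x) cvg_id (@nearest_continuous x).
exact: (@cvgZ R _ _ (nbhs x) _ _ _ _ _ (h1 _) (h2 _)).
Qed.

Lemma enorm_normal x : 0 < body_dist x -> enorm (outer_normal x) = 1.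
Proof. by move=> x0; rewrite enormZ ger0_norm ?invr_ge0 ?body_dist_ge0// mulVf// gt_eqF. Qed.

Lemma normal_dot x z : K z -> dot (outer_normal x) (z - nearest x) <= 0.
Proof.
move=> Kz; rewrite dotZl; apply: mulr_ge0_le0; first by rewrite invr_ge0 body_dist_ge0.
exact: nearest_point_dot (nearestP x) Kz.
Qed.

Lemma body_decomp x : 0 < body_dist x -> x = nearest x + body_dist x *: outer_normal x.
Proof.
by move=> x0; rewrite scalerA divff ?gt_eqF// scale1r addrC subrK.
Qed.

(** Uniqueness of the nearest point replaces the existential by the functions [body_dist] and
    [outer_normal], whose continuity off K yields measurability. *)
Lemma local_parallel_setE (e : R) (w : set 'rV[R]_n) :
  local_parallel_set K e w = [set x | 0 < body_dist x <= e /\ w (outer_normal x)].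
Proof.
apply/seteqP; split => x /=.
  by move=> [y [/nearest_pointE -> xe wx]].
by move=> [xe wx]; exists (nearest x); split => //; exact: nearestP.
Qed.

Lemma measurable_body_dist_le (e : R) : measurable ([set x | body_dist x <= e] : set (borel R n)).
Proof.
apply: closed_measurable_rV; rewrite (_ : [set x | _] = body_dist @^-1` [set y | y <= e])//.
by apply: closed_comp; [move=> x _; exact: body_dist_continuous|exact: closed_le].
Qed.

Lemma measurable_local_parallel_set (e : R) (w : set (borel R n)) : measurable w ->
  measurable (local_parallel_set K e w : set (borel R n)).
Proof.
move=> mw; rewrite local_parallel_setE.
have oD : open [set x | 0 < body_dist x].
  rewrite (_ : [set x | _] = body_dist @^-1` [set y | 0 < y])//.
  by apply: open_comp; [move=> x _; exact: body_dist_continuous|exact: open_gt].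
(* Continuity of [outer_normal] is available only off K, so its measurability is established on that
   open set. *)
have mn : measurable_fun ([set x | 0 < body_dist x] : set (borel R n))
    (outer_normal : borel R n -> borel R n).
  move=> mD; apply: (@measurability _ _ (borel R n) (borel R n) _ _ (@open 'rV[R]_n) erefl _ mD).
  move=> _ [U oU <-]; apply: sub_sigma_algebra.
  rewrite openE => x [Dx Ux]; apply: filterI; first exact: open_nbhs_nbhs.
  by apply: normal_continuous => //; exact: open_nbhs_nbhs.
rewrite (_ : [set x | _] = ([set x | 0 < body_dist x] `&` outer_normal @^-1` w) `&`
   [set x | body_dist x <= e]); last first.
  apply/seteqP; split => x /=; first by move=> [/andP[]].
  by move=> [[-> ?] ->].
apply: measurableI; last exact: measurable_body_dist_le.
by apply: mn => //; exact: open_measurable_rV.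
Qed.

End projection.

(** * Support functions and their relation to the distance *)

Section support_function.
Context {R : realType} {n : nat} (K : set 'rV[R]_n).
Hypotheses (cK : compact K) (K0 : K !=set0).
Implicit Types (x y z u v : 'rV[R]_n).

Lemma support_attained u : exists2 x, K x & support_fun K u = dot x u.
Proof.
have dotu_cont : {within K, continuous (fun x => dot x u)}.
  apply: continuous_subspaceT; apply: (@lipschitz_continuous_rV _ _ _ (enorm u)) => x y.
  by rewrite -dotBl mulrC norm_dot.
have [x xK xmax] := @EVT_max_rV R n (fun x => dot x u) K K0 cK dotu_cont.
rewrite inE in xK; exists x => //; apply/eqP; rewrite eq_le; apply/andP; split.
  apply: ge_sup; first by exists (dot x u), x.
  by move=> _ [y Ky <-]; apply: xmax; rewrite inE.
apply: ub_le_sup; last by exists x.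
by exists (dot x u) => _ [y Ky <-]; apply: xmax; rewrite inE.
Qed.

Lemma support_le u (c : R) : (forall x, K x -> dot x u <= c) -> support_fun K u <= c.
Proof. by have [x Kx ->] := support_attained u; exact. Qed.

Lemma dot_le_support x u : K x -> dot x u <= support_fun K u.
Proof.
move=> Kx; apply: ub_le_sup; last by exists x.
have dotu_cont : {within K, continuous (fun x => dot x u)}.
  apply: continuous_subspaceT; apply: (@lipschitz_continuous_rV _ _ _ (enorm u)) => y z.
  by rewrite -dotBl mulrC norm_dot.
have [y _ ymax] := @EVT_max_rV R n (fun x => dot x u) K K0 cK dotu_cont.
by exists (dot y u) => _ [z Kz <-]; apply: ymax; rewrite inE.
Qed.

Lemma compact_enorm_bounded : exists2 B : R, 0 <= B & forall x, K x -> enorm x <= B.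
Proof.
have cont : {within K, continuous (@enorm R n)}.
  apply: continuous_subspaceT; apply: (@lipschitz_continuous_rV _ _ _ 1) => y z.
  by rewrite mul1r enorm_lipschitz.
have [y _ ymax] := @EVT_max_rV R n (@enorm R n) K K0 cK cont.
by exists (enorm y); [exact: enorm_ge0|move=> x Kx; apply: ymax; rewrite inE].
Qed.

Lemma support_lipschitz (B : R) : (forall x, K x -> enorm x <= B) ->
  forall u v, `|support_fun K u - support_fun K v| <= B * enorm (u - v).
Proof.
move=> KB.
have h u v : support_fun K u <= support_fun K v + B * enorm (u - v).
  apply: support_le => x Kx; rewrite -[in leLHS](subrK v u) dotDr addrC lerD//.
    exact: dot_le_support.
  by rewrite (le_trans (cauchy_schwarz _ _))// ler_wpM2r ?enorm_ge0// KB.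
move=> u v; have := h u v; have := h v u; rewrite (enorm_distC v u) ler_norml; lra.
Qed.

Lemma support_continuous : continuous (support_fun K).
Proof.
have [B _ KB] := compact_enorm_bounded.
exact: lipschitz_continuous_rV (support_lipschitz KB).
Qed.

Lemma support_le_enorm (B : R) u : (forall x, K x -> enorm x <= B) ->
  support_fun K u <= B * enorm u.
Proof.
move=> KB; apply: support_le => x Kx.
by rewrite (le_trans (cauchy_schwarz _ _))// ler_wpM2r ?enorm_ge0// KB.
Qed.

Lemma support_ge_enorm (rho : R) u : 0 < rho -> (forall x, enorm x <= rho -> K x) ->
  rho * enorm u <= support_fun K u.
Proof.
move=> rho0 rhoK; have [->|u0] := eqVneq u 0.
  rewrite enorm0 mulr0; have [x Kx] := K0.
  by apply: le_trans (dot_le_support _ Kx); rewrite -(scale0r x) dotZr mul0r.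
have e0 := enorm_gt0 u0.
apply: (@le_trans _ _ (dot ((rho / enorm u) *: u) u)).
  by rewrite dotZl -sqr_enorm expr2 mulrA divfK ?gt_eqF.
apply: dot_le_support; apply: rhoK; rewrite enormZ ger0_norm ?divr_ge0 ?(ltW rho0) ?(ltW e0)//.
by rewrite divfK// gt_eqF.
Qed.

Hypothesis vK : convex_closed K.

(** By the variational inequality K lies in the half-space through the nearest point with this
    normal, so the nearest point attains the support value. *)
Lemma support_normal x : 0 < body_dist K x ->
  support_fun K (outer_normal K x) = dot (nearest K x) (outer_normal K x).
Proof.
move=> x0; apply/eqP; rewrite eq_le; apply/andP; split.
  apply: support_le => z Kz; rewrite -subr_le0 -dotBl dotC.
  exact: normal_dot.
by apply: dot_le_support; exact: nearest_in.
Qed.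

Lemma dot_normal x : 0 < body_dist K x ->
  dot x (outer_normal K x) = support_fun K (outer_normal K x) + body_dist K x.
Proof.
move=> x0; rewrite support_normal// {1}(body_decomp x0) dotDl dotZl.
by rewrite -sqr_enorm enorm_normal// expr1n mulr1.
Qed.

Lemma body_dist_ge z u : enorm u = 1 -> dot z u - support_fun K u <= body_dist K z.
Proof.
move=> u1; have := dot_le_support u (nearest_in cK K0 z).
have := cauchy_schwarz (z - nearest K z) u; rewrite u1 mulr1 dotBl /body_dist; lra.
Qed.

(** The distance of (1 + s) x is tested against the supporting half-space of K with the normal of x:
    in that direction the point has height (1 + s) (h + d), for h the support value and d the
    distance of x. *)
Lemma body_dist_scale x (s : R) : 0 <= s -> 0 < body_dist K x ->
  body_dist K x + s * (support_fun K (outer_normal K x) + body_dist K x) <= body_dist K ((1 + s) *: x).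
Proof.
move=> s0 x0; have := body_dist_ge ((1 + s) *: x) (enorm_normal x0).
rewrite dotZl (dot_normal x0).
by move: (support_fun K _) (body_dist K x) (body_dist K _) => h d D; lra.
Qed.

(** Pointwise form of the inclusion of K + e B in (1 + e/rho) K: the rescaled x is the combination,
    with weight e / (rho + e), of the nearest point and of a multiple of x - nearest of norm at most
    rho. *)
Lemma sub_scaled_body (rho e : R) x : 0 < rho -> 0 < e ->
  (forall x, enorm x <= rho -> K x) -> body_dist K x <= e -> K ((1 + e / rho)^-1 *: x).
Proof.
move=> rho0 e0 rhoK xe; pose c := e / (rho + e).
have re0 : 0 < rho + e by rewrite addr_gt0.
have c01 : 0 <= c <= 1.
  by rewrite divr_ge0 ?(ltW e0) ?(ltW re0)//= ler_pdivrMr// mul1r lerDr ltW.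
have Ky : K ((rho / e) *: (x - nearest K x)).
  apply: rhoK; rewrite enormZ ger0_norm ?divr_ge0 ?(ltW rho0) ?(ltW e0)// mulrAC ler_pdivrMr//.
  by rewrite ler_pM2l.
have := vK (nearest_in cK K0 x) Ky c01.
congr (K _); rewrite scalerA.
have -> : c * (rho / e) = (1 + e / rho)^-1.
  by rewrite /c; field; rewrite !gt_eqF// addr_gt0.
have -> : 1 - c = (1 + e / rho)^-1.
  by rewrite /c; field; rewrite !gt_eqF// addr_gt0.
by rewrite -scalerDr [nearest K x + _]addrC subrK.
Qed.

End support_function.

(** Along its own normal, the point z = x + t y has height h_K + d, and as a sum it has height at
    most h_K + t h_L. *)
Lemma body_dist_minkowski (R : realType) n (K L : set 'rV[R]_n) (t : R) x y :
  compact K -> convex_closed K -> compact L -> L !=set0 -> 0 <= t -> K x -> L y ->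
  0 < body_dist K (x + t *: y) ->
  body_dist K (x + t *: y) <= t * support_fun L (outer_normal K (x + t *: y)).
Proof.
move=> cK vK cL L0 t0 Kx Ly; set z := x + t *: y => z0.
have K0 : K !=set0 by exists x.
have := dot_normal cK K0 vK z0; rewrite /z dotDl dotZl -/z => h.
have h1 := dot_le_support cK K0 (outer_normal K z) Kx.
have h2 := ler_wpM2l t0 (dot_le_support cL L0 (outer_normal K z) Ly); lra.
Qed.

Section convex_bodies.
Context {R : realType} {n : nat}.
Implicit Types K L : set 'rV[R]_n.

Lemma convex_set_closed K : convex_set K -> convex_closed K.
Proof.
move=> vK x y Kx Ky c /andP[c0 c1].
have oc1 : (0 <= 1 - c <= 1) by rewrite subr_ge0 c1 gerBl.
pose l : {i01 R} := Itv01 (proj1 (andP oc1)) (proj2 (andP oc1)).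
have := vK x y l; rewrite !inE => /(_ Kx Ky).
by rewrite /conv/= [unstable.onem _]subKr.
Qed.

Lemma interior0_enorm K : interior K 0 ->
  exists2 rho : R, 0 < rho & forall x, enorm x <= rho -> K x.
Proof.
move=> /nbhs_ballP[e /= e0 eK]; exists (e / 2); first by rewrite divr_gt0.
move=> x xe; apply/eK/ball_rVP => // j; rewrite mxE sub0r normrN.
by rewrite (le_lt_trans (coord_le_enorm _ _))// (le_lt_trans xe)//; lra.
Qed.

End convex_bodies.

(** * Volumes of parallel bodies *)

Section lebV_scaling.
Context {R : realType} {n : nat}.

Lemma lebV_preimage_scale (a : R) (A : set (borel R n)) : a != 0 -> measurable A ->
  lebV R n A = ((`|a| ^+ n)%:E * lebV R n [set x | A (a *: (x : 'rV[R]_n))])%E.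
Proof.
move=> a0 mA; rewrite -!lebVE//; first exact: lebesgue_rV_preimage_scale.
exact: measurable_preimage_scale.
Qed.

Lemma ge0_integral_lebV_scale (a : R) (f : borel R n -> \bar R) : a != 0 ->
  measurable_fun setT f -> (forall x, 0 <= f x)%E ->
  (\int[lebV R n]_x f x = (`|a| ^+ n)%:E * \int[lebV R n]_x f (a *: (x : 'rV[R]_n))%R)%E.
Proof.
move=> a0 mf f0.
have mscale_a : measurable_fun setT ( *:%R a : borel R n -> borel R n).
  by apply: continuous_measurable_rVV => x; exact: scaler_continuous.
have an0 : 0 <= `|a| ^+ n by rewrite exprn_ge0.
pose c := NngNum an0.
transitivity (\int[mscale c (pushforward_measure (lebV R n) mscale_a)]_x f x)%E.
  by apply: eq_measure_integral => A mA _; rewrite [LHS](lebV_preimage_scale a0).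
rewrite ge0_integral_mscale//; congr (_ * _)%E.
by rewrite ge0_integral_pushforward.
Qed.

End lebV_scaling.

Section parallel_bodies.
Context {R : realType} {n : nat} (K : set 'rV[R]_n) (rho : R).
Hypotheses (cK : compact K) (vK : convex_closed K).
Hypotheses (rho0 : 0 < rho) (rhoK : forall x, enorm x <= rho -> K x).
Implicit Types (x u : 'rV[R]_n) (e s : R).

Local Notation leb := (lebV R n).
Local Notation V := (fine (leb K)).
Local Notation dist := (body_dist K).

Let K0 : K !=set0.
Proof. by exists 0; apply: rhoK; rewrite enorm0 ltW. Qed.

Lemma measurable_body : measurable (K : set (borel R n)).
Proof.
apply: closed_measurable_rV; apply: compact_closed => //; exact: norm_hausdorff.
Qed.

Lemma parallel_sub_cube e : exists2 M : R, 0 <= M & [set x | dist x <= e] `<=` cube n M.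
Proof.
have [B B0 KB] := compact_enorm_bounded cK K0.
exists (B + `|e|); first by rewrite addr_ge0.
move=> x /= xe j; rewrite (le_trans (coord_le_enorm x j))// -(subrK (nearest K x) x) addrC.
rewrite (le_trans (enorm_triangle _ _))// lerD//; first by apply: KB; exact: nearest_in.
by rewrite (le_trans xe)// ler_norm.
Qed.

Lemma leb_parallel_fin_num e (A : set (borel R n)) : measurable A ->
  A `<=` [set x | dist x <= e] -> leb A \is a fin_num.
Proof.
move=> mA Ae; have [M M0 eM] := parallel_sub_cube e.
by apply: lebV_fin_num M0 mA _; exact: subset_trans eM.
Qed.

Lemma leb_body_fin_num : leb K \is a fin_num.
Proof.
apply: (@leb_parallel_fin_num 0); first exact: measurable_body.
by move=> x /(body_dist_eq0 cK K0) /= ->.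
Qed.

Lemma leb_parallel_le e : 0 < e ->
  (leb [set x | (dist x <= e)%R] <= ((1 + e / rho) ^+ n * V)%:E)%E.
Proof.
move=> e0; pose c := 1 + e / rho.
have c0 : 0 < c by rewrite addr_gt0// divr_gt0.
have ci0 : c^-1 != 0 by rewrite invr_eq0 gt_eqF.
apply: (@le_trans _ _ (leb [set x | K (c^-1 *: x)])).
  apply: le_measure; rewrite ?inE//.
  - exact: measurable_body_dist_le.
  - by apply: measurable_preimage_scale; exact: measurable_body.
  - by move=> x; exact: sub_scaled_body.
have := lebV_preimage_scale ci0 measurable_body.
rewrite EFinM fineK ?leb_body_fin_num// => ->.
rewrite muleA -EFinM -exprMn ger0_norm ?invr_ge0 ?(ltW c0)//.
by rewrite divff ?gt_eqF// expr1n mul1e.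
Qed.

Lemma local_parallel_sub e (w : set 'rV[R]_n) :
  local_parallel_set K e w `<=` [set x | dist x <= e].
Proof. by rewrite local_parallel_setE// => x /= [/andP[]]. Qed.

Lemma leb_local_parallel_fin_num e (w : set (borel R n)) : measurable w ->
  leb (local_parallel_set K e w) \is a fin_num.
Proof.
move=> mw; apply: (@leb_parallel_fin_num e); last exact: local_parallel_sub.
exact: measurable_local_parallel_set.
Qed.

Definition cutoff e x : R := Num.max 0 (1 - dist x / e).

Lemma cutoff_ge0 e x : 0 <= cutoff e x.
Proof. by rewrite le_max lexx. Qed.

Lemma measurable_cutoff e : measurable_fun setT (cutoff e : borel R n -> R).
Proof.
apply: measurable_maxr => //; apply: measurable_funB => //.
apply: measurable_funM => //.
by apply: continuous_measurable_rV; exact: body_dist_continuous.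
Qed.

Lemma integral_cutoff_le e : 0 < e ->
  (\int[leb]_x (cutoff e x)%:E <= ((1 + e / rho) ^+ n * V)%:E)%E.
Proof.
move=> e0; apply: le_trans (leb_parallel_le e0).
rewrite -[leRHS]mul1e -(setIT [set x | _]) -integral_indic//; last exact: measurable_body_dist_le.
rewrite mul1e; apply: ge0_le_integral => //.
- by move=> x _; rewrite lee_fin cutoff_ge0.
- by apply/measurable_EFinP; exact: measurable_cutoff.
- by apply/measurable_EFinP; apply: measurable_indic; exact: measurable_body_dist_le.
- move=> x _; rewrite lee_fin indicE /cutoff ge_max ler0n/=.
  have [xe|xe] := boolP (_ \in _).
    by rewrite gerBl divr_ge0 ?(ltW e0)// body_dist_ge0.
  rewrite subr_le0 ler_pdivlMr// mul1r; move: xe; rewrite notin_setE/= => /negP.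
  by rewrite -ltNge => /ltW.
Qed.

Lemma cutoff_profile_le (e d D : R) : 0 < e -> d <= D ->
  Num.max 0 (1 - D / e) <= Num.max 0 (1 - d / e).
Proof.
move=> e0 dD; rewrite ge_max le_max lexx/= le_max; apply/orP; right.
by rewrite lerD2l lerN2 ler_wpM2r ?invr_ge0 ?(ltW e0).
Qed.

(** The ramp max(0, 1 - d/e) has slope -1/e up to d = e. The bound on d leaves room for a full drop
    of s a / e before the truncation at 0 sets in. *)
Lemma cutoff_profile_step (e s a h d D : R) : 0 < e -> 0 <= s -> a <= h ->
  d <= e - s * a -> d + s * h <= D ->
  Num.max 0 (1 - D / e) + s * a / e <= Num.max 0 (1 - d / e).
Proof.
move=> e0 s0 ah de dD.
have dDa : d + s * a <= D by apply: le_trans dD; rewrite lerD2l ler_wpM2l.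
rewrite -lerBrDr ge_max; apply/andP; split; rewrite lerBrDr le_max; apply/orP; right.
  by rewrite add0r lerBrDr -mulrDl ler_pdivrMr// mul1r addrC -lerBrDr.
by rewrite -addrA lerD2l -lerBrDr -opprD lerN2 -mulrDl ler_wpM2r ?invr_ge0 ?(ltW e0).
Qed.

(** Disjointness of the w_i leaves at most one nonzero indicator at x, and that case is
    [cutoff_profile_step]. Where all indicators vanish, the cutoff does not increase along the
    ray. *)
Lemma cutoff_scale N (w : 'I_N -> set 'rV[R]_n) (a : 'I_N -> R) e s x :
  0 < e -> 0 <= s ->
  (forall i j u, w i u -> w j u -> i = j) -> (forall i, 0 <= a i) ->
  (forall i u, enorm u = 1 -> w i u -> a i <= support_fun K u) ->
  cutoff e ((1 + s) *: x) +
    \sum_(i < N) s * a i / e * \1_(local_parallel_set K (e - s * a i) (w i)) x <=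
  cutoff e x.
Proof.
move=> e0 s0 w_disj a0 wa.
have ind0 i : ~ local_parallel_set K (e - s * a i) (w i) x ->
    s * a i / e * \1_(local_parallel_set K (e - s * a i) (w i)) x = 0.
  by move=> xi; rewrite indicE memNset// mulr0.
have [Kx|/(body_dist_gt0 cK K0) x0] := pselect (K x).
  rewrite big1 => [|i _]; last first.
    apply: ind0; rewrite local_parallel_setE// => -[/andP[]].
    by have /(body_dist_eq0 cK K0) -> := Kx; rewrite ltxx.
  rewrite addr0 /cutoff; have /(body_dist_eq0 cK K0) -> := Kx.
  rewrite mul0r subr0 le_max; apply/orP; right.
  rewrite ge_max ler01/= gerBl divr_ge0 ?(ltW e0)// body_dist_ge0//.
have hx : rho <= support_fun K (outer_normal K x).
  have := support_ge_enorm cK K0 (outer_normal K x) rho0 rhoK.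
  by rewrite enorm_normal// mulr1.
have dx : dist x + s * support_fun K (outer_normal K x) <= dist ((1 + s) *: x).
  apply: le_trans (body_dist_scale cK K0 vK s0 x0).
  by rewrite lerD2l ler_wpM2l// lerDl ltW.
have [[i xi]|noi] := pselect (exists i, local_parallel_set K (e - s * a i) (w i) x).
  move: (xi); rewrite local_parallel_setE// => -[/andP[_ xe] wi].
  rewrite (bigD1 i)//= big1 ?addr0; last first.
    move=> j ji; apply: ind0; rewrite local_parallel_setE// => -[_ wj].
    by move/eqP: ji; apply; exact: w_disj wj wi.
  rewrite indicE mem_set// mulr1.
  apply: (cutoff_profile_step e0 s0 _ xe dx).
  by apply: wa => //; exact: enorm_normal.
rewrite big1 => [|i _]; last by apply: ind0 => xi; apply: noi; exists i.
rewrite addr0; apply: cutoff_profile_le e0 (le_trans _ dx).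
by rewrite lerDl mulr_ge0// (le_trans _ hx)// ltW.
Qed.

(** Bernoulli for the nonnegative base 1/(1 + s), together with 1/(1 + s) >= 1 - s. *)
Lemma bernoulli_inv (s : R) : 0 <= s -> 1 - n%:R * s <= ((1 + s) ^+ n)^-1.
Proof.
move=> s0; have s1 : 0 < 1 + s by rewrite ltr_wpDr.
rewrite -exprVn; set y := (1 + s)^-1.
have y0 : 0 <= y by rewrite invr_ge0 ltW.
have ys : 1 - s <= y by rewrite /y -div1r ler_pdivlMr//; nra.
have bern m : 1 + m%:R * (y - 1) <= y ^+ m.
  elim: m => [|m IH]; first by rewrite mul0r addr0 expr0.
  rewrite exprS; apply: le_trans (ler_wpM2l y0 IH).
  rewrite -(natr1 m) -subr_ge0 [leRHS](_ : _ = m%:R * (y - 1) ^+ 2); last by ring.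
  by rewrite mulr_ge0// sqr_ge0.
by apply: le_trans (bern n); have : 0 <= n%:R :> R by []; nra.
Qed.

(** Integrates [cutoff_scale]. A change of variables divides the integral I of the cutoff by (1 +
    s)^n, so the shells carry at most I - I/(1 + s)^n <= n s I. Multiplication by e/s removes s from
    the right side, which leaves s free to be chosen relative to e. *)
Lemma lower_sum N (w : nat -> set (borel R n)) (a : nat -> R) e s :
  0 < e -> 0 < s -> (forall i, measurable (w i)) ->
  (forall i j u, w i u -> w j u -> i = j) -> (forall i, 0 <= a i) ->
  (forall i (u : 'rV[R]_n), enorm u = 1 -> w i u -> a i <= support_fun K u) ->
  \sum_(i < N) a i * fine (leb (local_parallel_set K (e - s * a i) (w i))) <=
  n%:R * e * ((1 + e / rho) ^+ n * V).
Proof.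
move=> e0 s0 mw w_disj a0 wa.
have s1 : 1 + s != 0 by rewrite gt_eqF// ltr_wpDl.
have s1n : 0 < (1 + s) ^+ n by rewrite exprn_gt0// ltr_wpDl.
pose A (i : 'I_N) := local_parallel_set K (e - s * a i) (w i).
have mA i : measurable (A i : set (borel R n)) by exact: measurable_local_parallel_set.
set W := (1 + e / rho) ^+ n * V.
pose I' := (\int[leb]_x (cutoff e x)%:E)%E.
pose J := (\int[leb]_x (cutoff e ((1 + s) *: (x : 'rV[R]_n))%R)%:E)%E.
have Ile : (I' <= W%:E)%E := integral_cutoff_le e0.
have I0 : (0 <= I')%E.
  by apply: integral_ge0 => x _; rewrite lee_fin cutoff_ge0.
have Ifin : I' \is a fin_num.
  by rewrite ge0_fin_numE// (le_lt_trans Ile)// ltry.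
have mcs : measurable_fun setT (fun x : borel R n => cutoff e ((1 + s) *: (x : 'rV[R]_n))).
  apply: (measurableT_comp (measurable_cutoff e)).
  by apply: continuous_measurable_rVV => x; exact: scaler_continuous.
have scaleI : (I' = ((1 + s) ^+ n)%:E * J)%E.
  rewrite [LHS](@ge0_integral_lebV_scale _ _ (1 + s))//.
  - by rewrite ger0_norm// addr_ge0// ltW.
  - by apply/measurable_EFinP; exact: measurable_cutoff.
  - by move=> x; rewrite lee_fin cutoff_ge0.
have key : (J + \sum_(i < N) (s * a i / e)%:E * leb (A i) <= I')%E.
  have c0 (i : 'I_N) : 0 <= s * a i / e by rewrite divr_ge0 ?mulr_ge0 ?(ltW e0) ?(ltW s0).
  have mind (i : 'I_N) : measurable_fun setT (fun x : borel R n => (s * a i / e * \1_(A i) x)%:E).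
    by apply/measurable_EFinP; apply: measurable_funM => //; exact: measurable_indic.
  have -> : (\sum_(i < N) (s * a i / e)%:E * leb (A i) =
      \int[leb]_x \sum_(i < N) (s * a i / e * \1_(A i) x)%:E)%E.
    rewrite ge0_integral_sum//; last first.
      by move=> i x _; rewrite lee_fin mulr_ge0// indicE.
    apply: eq_bigr => i _; under eq_integral do rewrite EFinM.
    rewrite ge0_integralZl ?integral_indic ?setIT ?lee_fin//.
    by apply/measurable_EFinP; exact: measurable_indic.
  rewrite -ge0_integralD//; last 4 first.
  - by move=> x _; rewrite lee_fin cutoff_ge0.
  - exact/measurable_EFinP.
  - by move=> x _; apply: sume_ge0 => i _; rewrite lee_fin mulr_ge0// indicE.
  - exact: emeasurable_sum.
  apply: ge0_le_integral => //.
  - move=> x _; rewrite adde_ge0 ?lee_fin ?cutoff_ge0//.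
    by apply: sume_ge0 => i _; rewrite lee_fin mulr_ge0// indicE.
  - by apply: emeasurable_funD; [exact/measurable_EFinP|exact: emeasurable_sum].
  - by apply/measurable_EFinP; exact: measurable_cutoff.
  - move=> x _; rewrite sumEFin -EFinD lee_fin.
    apply: (@cutoff_scale N (fun i => w i) (fun i => a i)) => //; first exact: ltW.
    - by move=> i j u wi wj; apply/val_inj; exact: w_disj wi wj.
    - by move=> i u; exact: wa.
clearbody I' J.
set I := fine I'; have IE : I' = I%:E by rewrite fineK.
have JE : J = (I / (1 + s) ^+ n)%:E.
  by rewrite mulrC EFinM -IE scaleI muleA -EFinM mulVf ?mul1e// gt_eqF.
move: key Ile I0; rewrite JE IE !lee_fin => key IW I0.
have {}key : I / (1 + s) ^+ n + \sum_(i < N) s * a i / e * fine (leb (A i)) <= I.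
  rewrite -lee_fin EFinD -sumEFin; apply: le_trans key.
  rewrite leeD2l// lee_sum// => i _; rewrite EFinM fineK//.
  exact: leb_local_parallel_fin_num.
have : \sum_(i < N) s * a i / e * fine (leb (A i)) <= n%:R * s * I.
  have := ler_wpM2l I0 (bernoulli_inv (ltW s0)); lra.
rewrite (_ : \sum_(i < N) _ = s / e * \sum_(i < N) a i * fine (leb (A i))); last first.
  by rewrite mulr_sumr; apply: eq_bigr => i _; ring.
move=> h; have se0 : 0 < s / e by rewrite divr_gt0.
rewrite -(ler_pM2l se0) (le_trans h)//.
rewrite [leRHS](_ : _ = n%:R * s * W); last by field; rewrite gt_eqF.
by rewrite ler_wpM2l// mulr_ge0// ltW.
Qed.

(** The union C of K and the shells is measurable by construction and contains K + t L.
    Brunn-Minkowski bounds its volume below by (1 + t)^n V >= (1 + n t) V, subadditivity bounds it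
    above by V plus the sum. *)
Lemma upper_sum (L : set 'rV[R]_n) N (w : nat -> set (borel R n)) (b : nat -> R) t :
  compact L -> convex_closed L -> L !=set0 -> 0 < t ->
  leb (L : set (borel R n)) = leb K ->
  (forall i, measurable (w i)) -> (forall i, 0 <= b i) ->
  (forall u : 'rV[R]_n, enorm u = 1 ->
     exists2 i, (i < N)%N & w i u /\ support_fun L u <= b i) ->
  n%:R * t * V <= \sum_(i < N) fine (leb (local_parallel_set K (t * b i) (w i))).
Proof.
move=> cL vL L0 t0 LK mw b0 wb.
pose A i := local_parallel_set K (t * b i) (w i).
have mA i : measurable (A i : set (borel R n)) by exact: measurable_local_parallel_set.
pose U : set (borel R n) := \big[setU/set0]_(i < N) A i.
have mU : measurable U by exact: bigsetU_measurable.
pose C : set (borel R n) := K `|` U.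
have mK := measurable_body.
have mC : measurable C by exact: measurableU.
have UP x : U x <-> exists2 i, (i < N)%N & A i x.
  by rewrite /U -bigcup_mkord; split => [[i /= iN Aix]|[i iN Aix]]; exists i.
have AB i : (i < N)%N -> t * b i <= t * \sum_(i < N) b i.
  move=> iN; rewrite ler_wpM2l ?(ltW t0)// (bigD1 (Ordinal iN))//= lerDl.
  by apply: sumr_ge0.
have CB : C `<=` [set x | dist x <= t * \sum_(i < N) b i].
  move=> x [/(body_dist_eq0 cK K0) /= ->|/UP[i iN Aix]].
    by rewrite mulr_ge0 ?(ltW t0)// sumr_ge0.
  by apply: le_trans (AB _ iN); exact: local_parallel_sub Aix.
have s1 : 0 < 1 + t by rewrite ltr_wpDl.
pose C' : set (borel R n) := [set x | C ((1 + t) *: (x : 'rV[R]_n))].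
have mC' : measurable C' by exact: measurable_preimage_scale.
have [M1 M10 CM] : exists2 M : R, 0 <= M & C `<=` cube n M.
  have [M M0 h] := parallel_sub_cube (t * \sum_(i < N) b i).
  by exists M => //; exact: subset_trans CB h.
have [M2 M20 LM] := compact_enorm_bounded cL L0.
pose M := Num.max M1 M2.
have M0 : 0 <= M by rewrite le_max M10.
have CM' : C `<=` cube n M by move=> x /CM xM j; rewrite le_max xM.
have VC' : V <= fine (leb C').
  (* With this weight, (1 + t) ((1 - l) x + l y) = x + t y. *)
  pose l := t / (1 + t).
  have l01 : 0 < l < 1.
    by rewrite divr_gt0//= ltr_pdivrMr// mul1r ltrDr.
  have mL : measurable (L : set (borel R n)).
    by apply: closed_measurable_rV; apply: compact_closed => //; exact: norm_hausdorff.
  apply: (brunn_minkowski_eq l01 M0 mK mL mC') => //.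
  - by move=> x Kx; apply: CM'; left.
  - by move=> x Lx j; rewrite le_max; apply/orP; right; exact: le_trans (coord_le_enorm x j) (LM _ Lx).
  - move=> x /CM' xM j; have := xM j; rewrite mxE normrM ger0_norm ?(ltW s1)//.
    by apply: le_trans; rewrite mulrDl mul1r lerDl mulr_ge0// ltW.
  - move=> x y Kx Ly; rewrite /C'/= scalerDr !scalerA.
    have -> : (1 + t) * (1 - l) = 1 by rewrite /l; field; rewrite gt_eqF.
    have -> : (1 + t) * l = t by rewrite /l; field; rewrite gt_eqF.
    rewrite scale1r; set z := x + t *: y.
    have [Kz|/(body_dist_gt0 cK K0) z0] := pselect (K z); first by left.
    right; have [i iN [wi hb]] := wb _ (enorm_normal z0).
    apply/UP; exists i => //; rewrite /A local_parallel_setE//; split => //.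
    rewrite z0/= (le_trans (body_dist_minkowski cK vK cL L0 (ltW t0) Kx Ly z0))//.
    by rewrite ler_wpM2l// ltW.
  - by rewrite LK.
have CE := lebV_preimage_scale (lt0r_neq0 s1) mC.
have C'fin : leb C' \is a fin_num.
  apply: (lebV_fin_num M0 mC') => x /CM' xM j; have := xM j; rewrite mxE normrM ger0_norm ?(ltW s1)//.
  by apply: le_trans; rewrite mulrDl mul1r lerDl mulr_ge0// ltW.
have hC : leb C = ((1 + t) ^+ n * fine (leb C'))%:E.
  by rewrite CE ger0_norm ?(ltW s1)// EFinM fineK.
have : (leb C <= leb K + \sum_(i < N) leb (A i))%E.
  apply: (le_trans (measureU2 _ mK mU)); rewrite leeD2l//.
  by apply: Boole_inequality => i.
rewrite hC -[leb K]fineK ?leb_body_fin_num//.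
under eq_bigr => i _ do rewrite -[leb (A i)]fineK ?leb_local_parallel_fin_num//.
rewrite sumEFin -EFinD lee_fin => h.
have V0 : 0 <= V by exact: fine_ge0.
have bern : 1 + n%:R * t <= (1 + t) ^+ n.
  elim: (n) => [|m IH]; first by rewrite mul0r addr0 expr0.
  rewrite exprS; apply: le_trans (ler_wpM2l (ltW s1) IH).
  have : 0 <= m%:R :> R by []; rewrite -(natr1 m); nra.
have h1 := ler_wpM2r V0 bern.
have h2 := ler_wpM2l (exprn_ge0 n (ltW s1)) VC'.
rewrite /A in h; lra.
Qed.

End parallel_bodies.

(** * The surface area measure *)

Lemma cvg_sum_ord (R : realType) (T : Type) (F : set_system T) {FF : Filter F} N
    (f : nat -> T -> R) (l : nat -> R) :
  (forall i, (i < N)%N -> f i x @[x --> F] --> l i) ->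
  (\sum_(i < N) f i x) @[x --> F] --> \sum_(i < N) l i.
Proof.
elim: N => [|N IH] fl.
  by under eq_fun do rewrite big_ord0; rewrite big_ord0; exact: cvg_cst.
under eq_fun do rewrite big_ord_recr/=.
rewrite big_ord_recr/=; apply: cvgD; last exact: fl.
by apply: IH => i iN; apply: fl; exact: ltnW.
Qed.

(** Lets the shells have radii that are different constant multiples of one parameter tending to
    0. *)
Lemma cvg_right_mul (R : realType) (T : topologicalType) (f : R -> T) (l : T) (c : R) :
  0 < c -> f e @[e --> 0^'+] --> l -> f (c * e) @[e --> 0^'+] --> l.
Proof.
move=> c0 fl A /fl[d /= d0 dA]; exists (d / c); first by rewrite /= divr_gt0.
move=> x; rewrite /= sub0r normrN => xd x0.
apply: dA; last by rewrite mulr_gt0.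
by rewrite /= sub0r normrN normrM (gtr0_norm c0) mulrC -ltr_pdivlMr.
Qed.

Section surface_area_measure.
Context {R : realType} {n : nat} (K : set 'rV[R]_n) (rho : R).
Hypotheses (cK : compact K) (vK : convex_closed K).
Hypotheses (rho0 : 0 < rho) (rhoK : forall x, enorm x <= rho -> K x).
Variable S : {measure set (borel R n) -> \bar R}.
Hypothesis hS : is_surface_area_measure K S.

Local Notation leb := (lebV R n).
Local Notation V := (fine (leb K)).
Local Notation sphere := (@unit_sphere R n : set (borel R n)).

Let K0 : K !=set0.
Proof. by exists 0; apply: rhoK; rewrite enorm0 ltW. Qed.

Lemma surface_cvg (w : set (borel R n)) : measurable w ->
  (leb (local_parallel_set K e w) * (e^-1)%:E)%E @[e --> (0 : R)^'+] --> S w.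
Proof.
move=> mw.
suff <- : (fun e : R => lebesgue_rV (local_parallel_set K e w) * (e^-1)%:E)%E =
          (fun e : R => leb (local_parallel_set K e w) * (e^-1)%:E)%E by exact: hS.
by apply/funext => e; rewrite lebVE//; exact: measurable_local_parallel_set.
Qed.

Lemma measurable_sphere : measurable sphere.
Proof.
apply: closed_measurable_rV; rewrite (_ : sphere = @enorm R n @^-1` [set 1])//.
apply: closed_comp; last exact: closed_eq.
move=> x _; apply: (@lipschitz_continuous_rV _ _ _ 1) => y z.
by rewrite mul1r enorm_lipschitz.
Qed.

(** Since h_K >= rho on the sphere, the finite-radius cutoff bound with constant weight rho bounds
    the volume of a shell by a multiple of its radius. *)
Lemma surface_lt_pinfty (w : set (borel R n)) : measurable w -> (S w < +oo)%E.
Proof.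
move=> mw; pose C := 2 * n%:R / rho * ((1 + 2 / rho) ^+ n * V).
apply: (@le_lt_trans _ _ C%:E); last exact: ltry.
apply: cvge_to_le (surface_cvg mw) _.
near=> e.
have e0 : 0 < e by near: e; exact: nbhs_right_gt.
have e1 : e <= 1 by near: e; exact: nbhs_right_le.
rewrite lee_pdivrMr// -EFinM -[leLHS]fineK ?lee_fin; last first.
  exact: (@leb_local_parallel_fin_num _ _ _ rho).
(* With cutoff radius 2e and s = e/rho, the shell radius 2e - s rho equals e. The family consists of
   w, padded by empty sets. *)
have := @lower_sum _ _ _ _ cK vK rho0 rhoK 1 (fun i => if i == 0%N then w else set0)
  (fun i => if i == 0%N then rho else 0) (2 * e) (e / rho).
rewrite big_ord1/= => h.
have {h} : rho * fine (leb (local_parallel_set K (2 * e - e / rho * rho) w)) <=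
    n%:R * (2 * e) * ((1 + 2 * e / rho) ^+ n * V).
  apply: h.
  - by rewrite mulr_gt0.
  - by rewrite divr_gt0.
  - by move=> i; case: ifP.
  - by move=> [|i] [|j].
  - by move=> [|i]//=; exact: ltW.
  - move=> [|i] u u1//= _; have := support_ge_enorm cK K0 u rho0 rhoK.
    by rewrite u1 mulr1.
rewrite divfK ?gt_eqF// (_ : 2 * e - e = e); last by ring.
move=> h; rewrite -(ler_pM2l rho0) (le_trans h)//.
rewrite /C [leRHS](_ : _ = n%:R * (2 * e) * ((1 + 2 / rho) ^+ n * V)); last first.
  by field; rewrite gt_eqF.
rewrite ler_wpM2l ?mulr_ge0 ?(ltW e0)// ler_wpM2r ?fine_ge0// lerXn2r ?nnegrE//.
- by rewrite addr_ge0// divr_ge0 ?mulr_ge0 ?(ltW e0) ?(ltW rho0).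
- by rewrite addr_ge0// divr_ge0 ?(ltW rho0).
- by rewrite lerD2l ler_wpM2r ?invr_ge0 ?(ltW rho0)// ler_piMr.
Unshelve. all: by end_near. Qed.

Lemma surface_fin_num (w : set (borel R n)) : measurable w -> S w \is a fin_num.
Proof. by move=> mw; rewrite ge0_fin_numE// surface_lt_pinfty. Qed.

Lemma surface_fine_cvg (w : set (borel R n)) : measurable w ->
  fine (leb (local_parallel_set K e w)) / e @[e --> (0 : R)^'+] --> fine (S w).
Proof.
move=> mw; have := surface_cvg mw; rewrite -(fineK (surface_fin_num mw)).
move=> /fine_cvg h.
suff <- : fine \o (fun e : R => leb (local_parallel_set K e w) * (e^-1)%:E)%E =
          (fun e => fine (leb (local_parallel_set K e w)) / e) by exact: h.
apply/funext => e /=; rewrite fineM//.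
exact: (@leb_local_parallel_fin_num _ _ _ rho).
Qed.

Lemma surface_lower N (w : nat -> set (borel R n)) (a : nat -> R) :
  (forall i, measurable (w i)) ->
  (forall i j u, w i u -> w j u -> i = j) -> (forall i, 0 <= a i) ->
  (forall i (u : 'rV[R]_n), enorm u = 1 -> w i u -> a i <= support_fun K u) ->
  \sum_(i < N) a i * fine (S (w i)) <= n%:R * V.
Proof.
move=> mw w_disj a0 wa.
(* At fixed eta, the choice s = eta e makes the shell radii (1 - eta a_i) e, and the limit in e then
   costs a factor 1 - eta a_i on each term. *)
have step (eta : R) : 0 < eta -> (forall i, (i < N)%N -> 0 < 1 - eta * a i) ->
    \sum_(i < N) a i * ((1 - eta * a i) * fine (S (w i))) <= n%:R * V.
  move=> eta0 c0.
  have hl : (\sum_(i < N) a i * ((1 - eta * a i) *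
       (fine (leb (local_parallel_set K ((1 - eta * a i) * e) (w i))) /
         ((1 - eta * a i) * e)))) @[e --> (0 : R)^'+] -->
      \sum_(i < N) a i * ((1 - eta * a i) * fine (S (w i))).
    apply: (@cvg_sum_ord R R _ _ N (fun i e => a i * ((1 - eta * a i) *
       (fine (leb (local_parallel_set K ((1 - eta * a i) * e) (w i))) /
         ((1 - eta * a i) * e))))
       (fun i => a i * ((1 - eta * a i) * fine (S (w i))))) => i iN.
    apply: cvgM; first exact: cvg_cst.
    apply: cvgM; first exact: cvg_cst.
    exact: (cvg_right_mul (c0 _ iN) (surface_fine_cvg (mw i))).
  have hr : n%:R * ((1 + e / rho) ^+ n * V) @[e --> (0 : R)^'+] --> n%:R * V.
    have c : continuous (fun e : R => n%:R * ((1 + e / rho) ^+ n * V)).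
      move=> x; apply: cvgM; first exact: cvg_cst.
      apply: cvgM; last exact: cvg_cst.
      apply: (@continuous_comp _ _ _ (fun e : R => 1 + e / rho) (fun y : R => y ^+ n)).
        apply: cvgD; first exact: cvg_cst.
        by apply: cvgM; [exact: cvg_id|exact: cvg_cst].
      exact: exprn_continuous.
    by have := cvg_at_right_filter (c 0); rewrite mul0r addr0 expr1n mul1r.
  apply: ler_cvg_to hl hr _.
  near=> e.
  have e0 : 0 < e by near: e; exact: nbhs_right_gt.
  have := @lower_sum _ _ _ _ cK vK rho0 rhoK N w a e (eta * e) e0 (mulr_gt0 eta0 e0)
    mw w_disj a0 wa.
  rewrite [X in _ -> _ <= X](_ : _ = (n%:R * e * ((1 + e / rho) ^+ n * V)) / e); last first.
    by field; rewrite gt_eqF.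
  rewrite ler_pdivlMr//; apply: le_trans.
  rewrite mulr_suml ler_sum// => i _.
  have ci := c0 i (ltn_ord i).
  rewrite le_eqVlt; apply/orP; left; apply/eqP.
  rewrite (_ : e - eta * e * a i = (1 - eta * a i) * e); last by ring.
  by field; rewrite !gt_eqF.
apply/ler_addgt0Pr => eps eps0.
pose D := \sum_(i < N) a i.
pose Q := \sum_(i < N) a i * (a i * fine (S (w i))).
have D0 : 0 <= D by exact: sumr_ge0.
have Q0 : 0 <= Q by apply: sumr_ge0 => i _; rewrite !mulr_ge0// fine_ge0.
(* The first bound keeps every 1 - eta a_i positive, because a_i <= D; the second makes the loss eta
   Q at most eps. The added 1 avoids a zero denominator. *)
pose eta := Num.min (1 / (D + 1)) (eps / (Q + 1)).
have eta0 : 0 < eta by rewrite lt_min !divr_gt0// ltr_wpDl.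
have eta1 : eta * (D + 1) <= 1 by rewrite -ler_pdivlMr ?ltr_wpDl// ge_min lexx.
have eta2 : eta * (Q + 1) <= eps by rewrite -ler_pdivlMr ?ltr_wpDl// ge_min lexx orbT.
have := step eta eta0 _.
have -> : \sum_(i < N) a i * ((1 - eta * a i) * fine (S (w i))) =
    \sum_(i < N) a i * fine (S (w i)) - eta * Q.
  by rewrite /Q mulr_sumr -sumrB; apply: eq_bigr => i _; ring.
move=> h; have {}h : \sum_(i < N) a i * fine (S (w i)) - eta * Q <= n%:R * V.
  apply: h => i iN; rewrite subr_gt0.
  have : a i <= D by rewrite /D (bigD1 (Ordinal iN))//= lerDl sumr_ge0.
  by move=> aD; have := ler_wpM2l (ltW eta0) aD; lra.
lra.
Unshelve. all: by end_near. Qed.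

(** Shells of radius b_i t contribute b_i S(w_i) after division by t; positivity of b_i makes b_i t
    tend to 0 from the right. *)
Lemma surface_upper (L : set 'rV[R]_n) N (w : nat -> set (borel R n)) (b : nat -> R) :
  compact L -> convex_closed L -> L !=set0 -> leb (L : set (borel R n)) = leb K ->
  (forall i, measurable (w i)) -> (forall i, 0 < b i) ->
  (forall u : 'rV[R]_n, enorm u = 1 ->
     exists2 i, (i < N)%N & w i u /\ support_fun L u <= b i) ->
  n%:R * V <= \sum_(i < N) b i * fine (S (w i)).
Proof.
move=> cL vL L0 LK mw b0 wb.
have hr : (\sum_(i < N) b i *
     (fine (leb (local_parallel_set K (b i * t) (w i))) / (b i * t)))
       @[t --> (0 : R)^'+] --> \sum_(i < N) b i * fine (S (w i)).
  apply: (@cvg_sum_ord R R _ _ N (fun i t => b i *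
     (fine (leb (local_parallel_set K (b i * t) (w i))) / (b i * t)))
     (fun i => b i * fine (S (w i)))) => i _.
  apply: cvgM; first exact: cvg_cst.
  exact: (cvg_right_mul (b0 i) (surface_fine_cvg (mw i))).
apply: cvgr_to_ge hr _; near=> t.
have t0 : 0 < t by near: t; exact: nbhs_right_gt.
rewrite -(ler_pM2r t0) mulrAC.
have := @upper_sum _ _ _ _ cK vK rho0 rhoK L N w b t cL vL L0 t0 LK mw
  (fun i => ltW (b0 i)) wb.
move=> h; apply: le_trans h _; rewrite mulr_suml ler_sum// => i _.
rewrite (mulrC t) le_eqVlt; apply/orP; left; apply/eqP.
by field; rewrite !gt_eqF.
Unshelve. all: by end_near. Qed.

Lemma surface_setT_bound N (w : nat -> set (borel R n)) :
  (forall i, measurable (w i)) -> (forall i j u, w i u -> w j u -> i = j) ->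
  \sum_(i < N) fine (S (w i)) <= fine (S setT).
Proof.
move=> mw w_disj.
have <- : fine (S (\big[setU/set0]_(i < N) w i)) = \sum_(i < N) fine (S (w i)).
  rewrite measure_semi_additive//.
  - by rewrite sum_fine// => i _; exact: surface_fin_num.
  - apply/trivIsetP => i j _ _ /eqP ij; apply/seteqP; split => // u [wi wj].
    by apply: ij; exact: w_disj wi wj.
  - exact: bigsetU_measurable.
apply: fine_le; rewrite ?surface_fin_num//; first exact: bigsetU_measurable.
by apply: le_measure; rewrite ?inE//; exact: bigsetU_measurable.
Qed.

(** Cuts the range of f into half-open bands of height eta; the lower and upper sums enclose the
    integral and differ by eta times the mass of the bands. *)
Lemma sphere_partition (f : borel R n -> R) (B eta : R) :
  measurable_fun setT f -> (forall u, sphere u -> 0 <= f u <= B) -> 0 < eta ->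
  exists (N : nat) (w : nat -> set (borel R n)),
  [/\ forall i, measurable (w i),
      forall i j u, w i u -> w j u -> i = j,
      forall i u, w i u -> i%:R * eta <= f u < i.+1%:R * eta,
      forall u, sphere u -> exists2 i, (i < N)%N & w i u &
      ((\sum_(i < N) i%:R * eta * fine (S (w i)))%:E <= \int[S]_(u in sphere) (f u)%:E)%E
      /\
      (\int[S]_(u in sphere) (f u)%:E <= (\sum_(i < N) i.+1%:R * eta * fine (S (w i)))%:E)%E].
Proof.
move=> mf fB eta0.
pose w (i : nat) : set (borel R n) := sphere `&` [set u | i%:R * eta <= f u < i.+1%:R * eta].
(* The successor includes the band that contains the value B itself. *)
pose N := (Num.truncn (B / eta)).+1.
have msp := measurable_sphere.
have mw i : measurable (w i).
  apply: measurableI => //.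
  rewrite (_ : [set u | _] = f @^-1` `[i%:R * eta, i.+1%:R * eta[).
    by rewrite -[X in measurable X]setTI; exact: mf.
  by apply/seteqP; split => u /=; rewrite in_itv.
have w_disj i j u : w i u -> w j u -> i = j.
  move=> [_ /= /andP[i1 i2]] [_ /= /andP[j1 j2]].
  have := le_lt_trans i1 j2; have := le_lt_trans j1 i2.
  rewrite !ltr_pM2r// !ltr_nat !ltnS => ji ij.
  by apply/eqP; rewrite eqn_leq ij ji.
have w_cov u : sphere u -> exists2 i, (i < N)%N & w i u.
  move=> su; have /andP[f0 fb] := fB u su.
  have fe0 : 0 <= f u / eta by rewrite divr_ge0// ltW.
  exists (Num.truncn (f u / eta)).
    rewrite ltnS; apply: le_truncn.
    by rewrite ler_wpM2r// invr_ge0 ltW.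
  split => //=; have /andP[h1 h2] := truncn_itv fe0.
  by rewrite -ler_pdivlMr// h1 -ltr_pdivrMr.
have sum_ind (c : nat -> R) : (forall i, 0 <= c i) ->
   (\int[S]_(u in sphere) (\sum_(i < N) c i * \1_(w i) u)%:E =
    (\sum_(i < N) c i * fine (S (w i)))%:E)%E.
  move=> c0; under eq_integral => u _ do rewrite -sumEFin.
  rewrite ge0_integral_sum//; last 2 first.
  - by move=> i; apply/measurable_EFinP; apply: measurable_funM.
  - by move=> i u _; rewrite lee_fin mulr_ge0// indicE.
  rewrite -sumEFin; apply: eq_bigr => i _; rewrite EFinM fineK ?surface_fin_num//.
  under eq_integral do rewrite EFinM.
  rewrite ge0_integralZl ?lee_fin//; last first.
    by apply/measurable_EFinP; exact: measurable_indic.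
  rewrite integral_indic//; congr (_ * S _)%E.
  by apply/seteqP; split => u [] //; case.
have sum_at (c : nat -> R) u i : (i < N)%N -> w i u ->
    \sum_(i < N) c i * \1_(w i) u = c i.
  move=> iN wi; rewrite (bigD1 (Ordinal iN))//= indicE mem_set// mulr1 big1 ?addr0//.
  move=> j ji; rewrite indicE memNset ?mulr0// => wj.
  by move/eqP: ji; apply; apply/val_inj; exact: w_disj wj wi.
exists N, w; split => //.
  by move=> i u [].
have i0 i : 0 <= i%:R * eta by rewrite mulr_ge0// ltW.
have msum (c : nat -> R) : measurable_fun sphere (fun u => (\sum_(i < N) c i * \1_(w i) u)%:E).
  by apply/measurable_EFinP; apply: measurable_sum => i; apply: measurable_funM.
have mfs : measurable_fun sphere (fun u => (f u)%:E).
  by apply/measurable_EFinP; exact: measurable_funTS.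
split.
  rewrite -(sum_ind (fun i => i%:R * eta))//; apply: ge0_le_integral => //.
  - by move=> u su; rewrite lee_fin; have [i iN wi] := w_cov u su; 
    rewrite (sum_at (fun i => i%:R * eta) _ _ iN wi).
  - exact: (msum (fun i => i%:R * eta)).
  - move=> u su; rewrite lee_fin; have [i iN wi] := w_cov u su.
    by rewrite (sum_at (fun i => i%:R * eta) _ _ iN wi); have [_ /andP[]] := wi.
rewrite -(sum_ind (fun i => i.+1%:R * eta))//; apply: ge0_le_integral => //.
- by move=> u su; rewrite lee_fin; have /andP[] := fB u su.
- exact: (msum (fun i => i.+1%:R * eta)).
- move=> u su; rewrite lee_fin; have [i iN wi] := w_cov u su.
  by rewrite (sum_at (fun i => i.+1%:R * eta) _ _ iN wi); have [_ /andP[_ /ltW]] := wi.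
Qed.

Lemma support_sphere_bounds (L : set 'rV[R]_n) : compact L -> interior L 0 ->
  exists2 B, 0 < B & exists2 b, 0 < b & forall u, sphere u -> b <= support_fun L u <= B.
Proof.
move=> cL /interior0_enorm[b b0 bL].
have L0 : L !=set0 by exists 0; apply: bL; rewrite enorm0 ltW.
have [B B0 LB] := compact_enorm_bounded cL L0.
exists (B + 1); first by rewrite ltr_wpDl.
exists b => // u u1; apply/andP; split.
  by have := support_ge_enorm cL L0 u b0 bL; rewrite u1 mulr1.
have := support_le_enorm cL L0 u LB; rewrite u1 mulr1 => h.
by rewrite (le_trans h)// lerDl.
Qed.

Lemma measurable_support (L : set 'rV[R]_n) : compact L -> L !=set0 ->
  measurable_fun setT (support_fun L : borel R n -> R).
Proof. by move=> cL L0; apply: continuous_measurable_rV; exact: support_continuous. Qed.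

(** On each band the lower value i eta is an admissible weight for [surface_lower]; passing to the
    upper sum costs at most eta times the total mass, hence at most eps. *)
Lemma integral_support_self_le :
  (\int[S]_(u in sphere) (support_fun K u)%:E <= (n%:R * V)%:E)%E.
Proof.
apply/lee_addgt0Pr => eps eps0.
have K_int : interior K 0.
  apply/nbhs_ballP; exists (rho / (n%:R + 1)); first by rewrite /= divr_gt0// ltr_wpDl.
  move=> x; rewrite mx_norm_ball /ball_/= sub0r normrN ltr_pdivlMr ?ltr_wpDl// => xr.
  apply: rhoK; apply: le_trans (enorm_le_norm x) _; apply: le_trans (ltW xr).
  by rewrite mulrC ler_wpM2l// lerDl.
have [B B0 [b b0 hB]] := support_sphere_bounds cK K_int.
pose T := fine (S setT).
have T0 : 0 <= T by exact: fine_ge0.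
pose eta := eps / (T + 1).
have T1 : 0 < T + 1 by rewrite ltr_wpDl.
have eta0 : 0 < eta by rewrite divr_gt0.
have [|N [w [mw w_disj wf w_cov [_ hint]]]] := @sphere_partition (support_fun K) B eta
    (measurable_support cK K0) _ eta0.
  by move=> u /hB /andP[h ->]; rewrite (le_trans _ h)// ltW.
apply: le_trans hint _; rewrite -EFinD lee_fin.
have hl := @surface_lower N w (fun i => i%:R * eta) mw w_disj _ _.
have {}hl : \sum_(i < N) i%:R * eta * fine (S (w i)) <= n%:R * V.
  apply: hl => [i|i u _ /wf /andP[]//].
  by rewrite mulr_ge0// ltW.
have ht := surface_setT_bound N mw w_disj.
have -> : \sum_(i < N) i.+1%:R * eta * fine (S (w i)) =
    \sum_(i < N) i%:R * eta * fine (S (w i)) + eta * \sum_(i < N) fine (S (w i)).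
  by rewrite mulr_sumr -big_split/=; apply: eq_bigr => i _; rewrite -natr1; ring.
have := ler_wpM2l (ltW eta0) ht.
have : eta * (T + 1) = eps by rewrite /eta divfK// gt_eqF.
rewrite -/T; lra.
Qed.

(** Each band takes its upper value (i + 1) eta, positive even for i = 0 as [surface_upper] asks. *)
Lemma integral_support_ge (L : set 'rV[R]_n) :
  compact L -> convex_closed L -> interior L 0 -> leb (L : set (borel R n)) = leb K ->
  ((n%:R * V)%:E <= \int[S]_(u in sphere) (support_fun L u)%:E)%E.
Proof.
move=> cL vL L_int LK.
apply/lee_addgt0Pr => eps eps0.
have [B B0 [b b0 hB]] := support_sphere_bounds cL L_int.
have L0 : L !=set0 by exists 0; exact: nbhs_singleton L_int.
pose T := fine (S setT).
have T0 : 0 <= T by exact: fine_ge0.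
pose eta := eps / (T + 1).
have T1 : 0 < T + 1 by rewrite ltr_wpDl.
have eta0 : 0 < eta by rewrite divr_gt0.
have [|N [w [mw w_disj wf w_cov [hint _]]]] := @sphere_partition (support_fun L) B eta
    (measurable_support cL L0) _ eta0.
  by move=> u /hB /andP[h ->]; rewrite (le_trans _ h)// ltW.
have hu := @surface_upper L N w (fun i => i.+1%:R * eta) cL vL L0 LK mw _ _.
have {}hu : n%:R * V <= \sum_(i < N) i.+1%:R * eta * fine (S (w i)).
  apply: hu => [i|u u1]; first by rewrite mulr_gt0.
  have [i iN wi] := w_cov u u1; exists i => //; split => //.
  by have /andP[_ /ltW] := wf _ _ wi.
apply: le_trans (leeD2r eps%:E hint); rewrite -EFinD lee_fin.
have ht := surface_setT_bound N mw w_disj.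
move: hu; have -> : \sum_(i < N) i.+1%:R * eta * fine (S (w i)) =
    \sum_(i < N) i%:R * eta * fine (S (w i)) + eta * \sum_(i < N) fine (S (w i)).
  by rewrite mulr_sumr -big_split/=; apply: eq_bigr => i _; rewrite -natr1; ring.
have := ler_wpM2l (ltW eta0) ht.
have : eta * (T + 1) = eps by rewrite /eta divfK// gt_eqF.
rewrite -/T; lra.
Qed.

End surface_area_measure.

(** * The cone-volume measure *)

Section density.
Local Open Scope ereal_scope.
Context d (T : measurableType d) (R : realType).
Variables (mu nu : {measure set T -> \bar R}) (D : set T) (g : T -> R).
Hypotheses (mD : measurable D) (mg : measurable_fun D g).
Hypotheses (g0 : forall x, D x -> (0 <= g x)%R).
Hypothesis (nuE : forall A, measurable A -> A `<=` D -> nu A = \int[mu]_(x in A) (g x)%:E).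

Import HBNNSimple.

(** Simple functions, then monotone convergence on both sides. The density identity is assumed for
    subsets of D only, so the level sets are intersected with D before it is applied. *)
Lemma integral_density (f : T -> \bar R) : measurable_fun D f ->
  (forall x, D x -> 0 <= f x) ->
  \int[nu]_(x in D) f x = \int[mu]_(x in D) (f x * (g x)%:E).
Proof.
move=> mf f0; pose h := nnsfun_approx mD mf.
have -> : \int[nu]_(x in D) f x = limn (fun n => \int[nu]_(x in D) (h n x)%:E).
  rewrite -monotone_convergence//.
  - apply: eq_integral => x /[!inE] Dx; apply/esym/cvg_lim => //.
    exact: cvg_nnsfun_approx.
  - by move=> n; apply/measurable_EFinP; exact/measurable_funTS/measurable_funP.
  - by move=> n x _; rewrite lee_fin.
  - by move=> x _ m n mn; rewrite lee_fin; exact/lefP/nd_nnsfun_approx.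
have -> : \int[mu]_(x in D) (f x * (g x)%:E) =
    limn (fun n => \int[mu]_(x in D) ((h n x)%:E * (g x)%:E)).
  rewrite -monotone_convergence//.
  - apply: eq_integral => x /[!inE] Dx; apply/esym/cvg_lim => //.
    by apply: cvgeZr => //; exact: cvg_nnsfun_approx.
  - move=> n; apply: emeasurable_funM; apply/measurable_EFinP => //.
    exact/measurable_funTS/measurable_funP.
  - by move=> n x Dx; rewrite mule_ge0 ?lee_fin ?g0.
  - move=> x Dx m n mn; rewrite lee_wpmul2r ?lee_fin ?g0//.
    exact/lefP/nd_nnsfun_approx.
congr (limn _); apply/funext => n.
transitivity (\int[nu]_(x in D)
   (\sum_(y \in range (h n)) (y * \1_(h n @^-1` [set y]) x)%:E)).
  by apply: eq_integral => t tD; rewrite fimfunE -fsumEFin.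
rewrite ge0_integral_fsum//; last 2 first.
- move=> y; apply/measurable_EFinP; apply: measurable_funM => //.
- by move=> m y Ey; exact: nnfun_muleindic_ge0.
transitivity (\int[mu]_(x in D) (\sum_(y \in range (h n))
    (y * \1_(h n @^-1` [set y]) x)%:E * (g x)%:E)).
  rewrite ge0_integral_fsum//; last 2 first.
  - move=> y; apply: emeasurable_funM; apply/measurable_EFinP => //.
    exact: measurable_funM.
  - move=> m y Ey; apply: mule_ge0; last by rewrite lee_fin g0.
    exact: nnfun_muleindic_ge0.
  apply: eq_fsbigr => r rhn.
  under eq_integral do rewrite EFinM.
  rewrite integralZl_indic_nnsfun => //.
  under [RHS]eq_integral do rewrite EFinM -muleA.
  rewrite ge0_integralZl//.
  - under [in RHS]eq_integral do rewrite muleC.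
    rewrite [in RHS](eq_integral ((EFin \o g) \_ (h n @^-1` [set r]))); last first.
      by move=> x xE; rewrite epatch_indic.
    rewrite -integral_mkcondr -nuE; first by rewrite integral_indic// setIC.
      exact: measurableI.
    by move=> x [].
  - by apply: emeasurable_funM; exact/measurable_EFinP.
  - by move=> t Et; rewrite mule_ge0 ?lee_fin ?g0.
  - by move: rhn; rewrite inE => -[t _ <-]; rewrite lee_fin.
apply: eq_integral => x xD.
rewrite -ge0_mule_fsuml => [|y]; last exact: nnfun_muleindic_ge0.
by rewrite fsumEFin // -(fimfunE _ x).
Qed.

End density.

(** * Pinsker inequality in integrated form *)

Section pinsker.
Context d (T : measurableType d) (R : realType).
Variables (mu : {measure set T -> \bar R}) (D : set T).
Hypotheses (mD : measurable D) (muD : mu D = 1%E).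

(** Morally Cauchy-Schwarz with the affine weight of [pinsker_pointwise], which integrates to 1. It
    is used in linearised form, as AM-GM with a parameter s that is optimised at the end. *)
Lemma pinsker_integral (f : T -> R) (a c eps : R) :
  measurable_fun D f -> (forall x, D x -> 0 < f x) -> 0 < a < 1 ->
  (\int[mu]_(x in D) (f x)%:E = 1)%E ->
  (\int[mu]_(x in D) (f x `^ a)%:E = c%:E)%E -> 1 - c <= a * eps ->
  (\int[mu]_(x in D) (`|f x - 1|)%:E <= (Num.sqrt (2 / (1 - a) * eps))%:E)%E.
Proof.
move=> mf f0 a01 f1 fc ceps; have /andP[a0 a1] := a01.
have ia1 : 0 < 1 - a by rewrite subr_gt0.
(* C is the reciprocal of the constant a (1 - a) / 2 of [pinsker_pointwise]. *)
have [C [CE C0]] : exists C : R, C = 2 / (a * (1 - a)) /\ 0 < C.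
  by exists (2 / (a * (1 - a))); rewrite divr_gt0// mulr_gt0.
have mfa : measurable_fun D (fun x => f x `^ a).
  by apply: (measurableT_comp (@measurable_powR R a)).
have mabs : measurable_fun D (fun x => `|f x - 1|).
  by apply: (measurableT_comp (@normr_measurable R setT)) => //; apply: measurable_funB.
have bound (s : R) : 0 < s ->
  (\int[mu]_(x in D) (`|f x - 1|)%:E <= (s / 2 + C * (1 - c) / (2 * s))%:E)%E.
  move=> s0.
  have a1' : 0 <= 1 + a by lra.
  have a2' : 0 <= 2 - a by lra.
  (* A and B collect the constant and the linear part of s w / 2 + C phi / (2 s); the power term
     goes to the other side so that all integrands are nonnegative. Their sum is s / 2 + C / (2
     s). *)
  have [A [AE A0]] : exists A : R, A = s * (1 + a) / 6 + C * (1 - a) / (2 * s) /\ 0 <= A.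
    exists (s * (1 + a) / 6 + C * (1 - a) / (2 * s)); split => //.
    by apply: addr_ge0; apply: divr_ge0; rewrite ?mulr_ge0 ?(ltW s0) ?(ltW C0) ?(ltW ia1).
  have [B [BE B0]] : exists B : R, B = s * (2 - a) / 6 + C * a / (2 * s) /\ 0 <= B.
    exists (s * (2 - a) / 6 + C * a / (2 * s)); split => //.
    by apply: addr_ge0; apply: divr_ge0; rewrite ?mulr_ge0 ?(ltW s0) ?(ltW C0) ?(ltW a0).
  have k0 : 0 <= C / (2 * s) by rewrite divr_ge0 ?mulr_ge0 ?(ltW s0) ?(ltW C0).
  have pw x : D x -> `|f x - 1| + C / (2 * s) * f x `^ a <= A + B * f x.
    move=> Dx; have fx := f0 _ Dx; have := pinsker_pointwise a01 fx.
    set w := _ / 3; set phi := 1 + _ - _ => h.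
    have w0 : 0 < w by rewrite divr_gt0// addr_gt0 ?mulr_gt0//; lra.
    have phi0 : 0 <= phi.
      rewrite -(pmulr_rge0 _ w0); apply: le_trans h.
      by rewrite mulr_ge0 ?sqr_ge0// divr_ge0// mulr_ge0 ?(ltW a0) ?(ltW ia1).
    suff : `|f x - 1| <= s * w / 2 + C * phi / (2 * s).
      rewrite -subr_ge0 => h2; rewrite -subr_ge0; apply: le_trans h2 _.
      rewrite le_eqVlt; apply/orP; left; apply/eqP.
      by rewrite AE BE /w /phi; field; rewrite gt_eqF.
    have h2 : (f x - 1) ^+ 2 <= w * (C * phi).
      rewrite [leRHS](_ : _ = C * (w * phi)); last by ring.
      apply: le_trans (ler_wpM2l (ltW C0) h).
      rewrite CE le_eqVlt; apply/orP; left; apply/eqP.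
      by field; rewrite !gt_eqF.
    have X0 : 0 <= s * w by rewrite mulr_ge0 ?(ltW s0) ?(ltW w0).
    have Y0 : 0 <= C * phi / s by rewrite divr_ge0 ?mulr_ge0 ?(ltW s0) ?(ltW C0).
    have XY : (f x - 1) ^+ 2 <= (s * w) * (C * phi / s).
      by rewrite (_ : s * w * _ = w * (C * phi))//; field; rewrite gt_eqF.
    have -> : s * w / 2 + C * phi / (2 * s) = (s * w + C * phi / s) / 2.
      by field; rewrite gt_eqF.
    rewrite -(@ler_pXn2r _ 2) ?nnegrE// ?divr_ge0 ?addr_ge0//.
    rewrite real_normK ?num_real//; apply: le_trans XY _.
    have := sqr_ge0 (s * w - C * phi / s); move: (s * w) (C * phi / s) => X Y; nra.
  have hc : 0 <= c by rewrite -lee_fin -fc; apply: integral_ge0 => x _; rewrite lee_fin powR_ge0.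
  have int1 : (\int[mu]_(x in D) (`|f x - 1| + C / (2 * s) * f x `^ a)%:E =
      \int[mu]_(x in D) (`|f x - 1|)%:E + (C / (2 * s) * c)%:E)%E.
    under eq_integral do rewrite EFinD.
    rewrite ge0_integralD//.
    - congr (_ + _)%E; under eq_integral do rewrite EFinM.
      rewrite ge0_integralZl ?fc ?EFinM ?lee_fin//.
      + exact/measurable_EFinP.
      + by move=> x _; rewrite lee_fin powR_ge0.
    - exact/measurable_EFinP.
    - by move=> x _; rewrite lee_fin mulr_ge0// powR_ge0.
    - by apply/measurable_EFinP; apply: measurable_funM.
  have int2 : (\int[mu]_(x in D) (A + B * f x)%:E = (A + B)%:E)%E.
    under eq_integral do rewrite EFinD.
    rewrite ge0_integralD//.
    - rewrite integral_cst// muD mule1 (EFinD A B); congr (_ + _)%E.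
      under eq_integral do rewrite EFinM.
      rewrite ge0_integralZl ?f1 ?mule1 ?lee_fin//; first exact/measurable_EFinP.
      by move=> x /f0 /ltW; rewrite lee_fin.
    - by move=> x Dx; rewrite lee_fin mulr_ge0// ltW// f0.
    - by apply/measurable_EFinP; apply: measurable_funM.
  have : (\int[mu]_(x in D) (`|f x - 1|)%:E + (C / (2 * s) * c)%:E <= (A + B)%:E)%E.
    rewrite -int1 -int2; apply: ge0_le_integral => //.
    - by move=> x _; rewrite lee_fin addr_ge0// mulr_ge0// powR_ge0.
    - by apply/measurable_EFinP; apply: measurable_funD => //; apply: measurable_funM.
    - by apply/measurable_EFinP; apply: measurable_funD => //; apply: measurable_funM.
  rewrite -leeBrDr// => h; apply: le_trans h _; rewrite -EFinB lee_fin.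
  rewrite le_eqVlt; apply/orP; left; apply/eqP.
  by rewrite AE BE; field; rewrite gt_eqF.
have J0 : (0 <= \int[mu]_(x in D) (`|f x - 1|)%:E)%E.
  by apply: integral_ge0 => x _; rewrite lee_fin.
have Jfin : (\int[mu]_(x in D) (`|f x - 1|)%:E)%E \is a fin_num.
  by rewrite ge0_fin_numE// (le_lt_trans (bound 1 ltr01))// ltry.
rewrite -(fineK Jfin) lee_fin.
set Q := 2 / (1 - a) * eps.
have QC : C * (1 - c) <= Q.
  apply: le_trans (ler_wpM2l (ltW C0) ceps) _.
  rewrite CE /Q le_eqVlt; apply/orP; left; apply/eqP.
  by field; rewrite !gt_eqF.
have {}bound (s : R) : 0 < s ->
    fine (\int[mu]_(x in D) (`|f x - 1|)%:E) <= s / 2 + Q / (2 * s).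
  move=> s0; rewrite -lee_fin fineK//; apply: le_trans (bound s s0) _.
  by rewrite lee_fin lerD2l ler_wpM2r// invr_ge0 mulr_ge0// ltW.
(* The bound s / 2 + Q / (2 s) is minimal at s = sqrt Q, with value sqrt Q. For Q <= 0 the square
   root is 0 by convention, and s is taken arbitrarily small. *)
have [Q0|Q0] := ltP 0 Q.
  have sQ : 0 < Num.sqrt Q by rewrite sqrtr_gt0.
  apply: le_trans (bound _ sQ) _.
  rewrite -{2}(sqr_sqrtr (ltW Q0)) le_eqVlt; apply/orP; left; apply/eqP.
  by field; rewrite gt_eqF.
rewrite ler0_sqrtr//; apply/ler_addgt0Pr => e e0; rewrite add0r.
apply: le_trans (bound e e0) _.
have : Q / (2 * e) <= 0 by rewrite mulr_le0_ge0// invr_ge0 mulr_ge0// ltW.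
lra.
Qed.

End pinsker.

Section cone_volume.
Context {R : realType} {n : nat} (K : set 'rV[R]_n).
Variable S : {measure set (borel R n) -> \bar R}.
Hypotheses (n_gt0 : (0 < n)%N) (cK : compact K) (vK : convex_closed K).
Hypothesis K_int : interior K 0.
Hypothesis hS : is_surface_area_measure K S.

Local Notation leb := (lebV R n).
Local Notation V := (fine (leb K)).
Local Notation sphere := (@unit_sphere R n : set (borel R n)).
Local Notation hK := (support_fun K).

Let K0 : K !=set0.
Proof. by exists 0; exact: nbhs_singleton K_int. Qed.

Lemma vol_fine : vol K = V.
Proof. by rewrite /vol lebVE//; exact: measurable_body. Qed.

Lemma vol_body_gt0 : 0 < vol K.
Proof.
have [rho rho0 rhoK] := interior0_enorm K_int.
rewrite vol_fine -lte_fin fineK; last exact: leb_body_fin_num rho0 rhoK.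
move: K_int => /nbhs_ballP[e /= e0 eK].
apply: (@lt_le_trans _ _ (leb (cube n (e / 2)))).
  by rewrite lebV_cube ?lte_fin ?exprn_gt0 ?mulr_gt0 ?divr_gt0// ltW// divr_gt0.
apply: le_measure; rewrite ?inE; [exact: measurable_cube|exact: measurable_body|].
move=> x xe; apply/eK/ball_rVP => // j; rewrite mxE sub0r normrN.
by rewrite (le_lt_trans (xe j))// ltr_pdivrMr// ltr_pMr// ltr1n.
Qed.

Local Notation cone_density := (fun u : borel R n => hK u / (n%:R * vol K)).

Let nV0 : 0 < n%:R * vol K.
Proof. by rewrite mulr_gt0 ?ltr0n// vol_body_gt0. Qed.

Let msp := @measurable_sphere R n.

Let hK_gt0 u : sphere u -> 0 < hK u.
Proof.
move=> u1; have [B _ [b b0 hb]] := support_sphere_bounds cK K_int.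
by have /andP[h _] := hb _ u1; exact: lt_le_trans h.
Qed.

Let mcone D : measurable_fun D cone_density.
Proof.
apply: measurable_funTS; apply: measurable_funM => //.
exact: measurable_support.
Qed.

(** [cone_volume_measure] is a bare set function, while integration lemmas ask for a measure.
    Positivity of h_K on the sphere makes it one, and the equality allows rewriting in both
    directions. *)
Lemma cone_volume_measure_ext : exists m : {measure set (borel R n) -> \bar R},
  m = cone_volume_measure S K :> (set (borel R n) -> \bar R).
Proof.
have g0 u : sphere u -> (0 <= (cone_density u)%:E)%E.
  by move=> u1; rewrite lee_fin divr_ge0// ltW// hK_gt0.
have h0 : cone_volume_measure S K set0 = 0%E.
  by rewrite /cone_volume_measure set0I integral_set0.
have hge0 A : (0 <= cone_volume_measure S K A)%E.
  by apply: integral_ge0 => u [_ u1]; exact: g0.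
have hadd : semi_sigma_additive (cone_volume_measure S K).
  move=> F mF tF mUF.
  have -> : cone_volume_measure S K (\bigcup_i F i) =
      (\sum_(i <oo) cone_volume_measure S K (F i))%E.
    rewrite /cone_volume_measure setI_bigcupl ge0_integral_bigcup//.
    - by move=> k; exact: measurableI.
    - by apply/measurable_EFinP; exact: mcone.
    - by move=> u [k _ [_ u1]]; exact: g0.
    - exact: trivIset_setIr.
  apply/cvg_closeP; split; last by rewrite closeE.
  by apply: is_cvg_nneseries => k _ _; exact: hge0.
pose h1 := isMeasure.Build _ _ _ (cone_volume_measure S K) h0 hge0 hadd.
pose m : {measure set (borel R n) -> \bar R} := HB.pack (cone_volume_measure S K) h1.
by exists m.
Qed.

Lemma integral_cone (f : borel R n -> R) : measurable_fun sphere f ->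
  (forall u, sphere u -> 0 <= f u) ->
  (\int[cone_volume_measure S K]_(u in sphere) (f u)%:E =
   \int[S]_(u in sphere) (f u * cone_density u)%:E)%E.
Proof.
move=> mf f0; have [m mE] := cone_volume_measure_ext; rewrite -mE.
rewrite (@integral_density _ _ _ S m sphere cone_density)//.
- by move=> u u1; rewrite divr_ge0// ltW// hK_gt0.
- by move=> A mA As; rewrite mE /cone_volume_measure (setIidl As).
- exact/measurable_EFinP.
Qed.

(** The inverse of h_K is written as its power -1, legitimate on the sphere where h_K > 0, so that
    measurability of real powers applies. *)
Lemma measurable_support_ratio (f : borel R n -> R) : measurable_fun setT f ->
  measurable_fun sphere (fun u => f u / hK u).
Proof.
move=> mf; apply: (eq_measurable_fun (fun u => f u * hK u `^ (-1))).
  by move=> u /[!inE] u1; rewrite powR_inv1// ltW// hK_gt0.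
apply: measurable_funTS; apply: measurable_funM => //.
apply: (measurableT_comp (@measurable_powR R (-1))).
exact: measurable_support.
Qed.

Lemma integral_cone_support (L : set 'rV[R]_n) : compact L -> interior L 0 ->
  (\int[cone_volume_measure S K]_(u in sphere) (support_fun L u / hK u)%:E =
   ((n%:R * vol K)^-1)%:E * \int[S]_(u in sphere) (support_fun L u)%:E)%E.
Proof.
move=> cL L_int.
have L0 : L !=set0 by exists 0; exact: nbhs_singleton L_int.
have [B _ [b b0 hb]] := support_sphere_bounds cL L_int.
have hL_ge0 u : sphere u -> 0 <= support_fun L u.
  by move=> u1; have /andP[h _] := hb _ u1; rewrite (le_trans _ h)// ltW.
have mL := measurable_support cL L0.
rewrite integral_cone; first last.
- by move=> u u1; rewrite divr_ge0 ?hL_ge0// ltW// hK_gt0.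
- exact: measurable_support_ratio.
rewrite -ge0_integralZl//; first last.
- by rewrite lee_fin invr_ge0 ltW.
- by apply/measurable_EFinP; exact: measurable_funTS.
apply: eq_integral => u /[!inE] u1; rewrite -EFinM; congr EFin.
by field; rewrite !gt_eqF ?hK_gt0 ?ltr0n ?vol_body_gt0.
Qed.

(** Minkowski's first inequality V_1(K, L) >= |K| for equal volumes, in normalised form. *)
Lemma integral_cone_support_ge1 (L : set 'rV[R]_n) :
  compact L -> convex_closed L -> interior L 0 -> vol K = vol L ->
  (1 <= \int[cone_volume_measure S K]_(u in sphere) (support_fun L u / hK u)%:E)%E.
Proof.
move=> cL vL L_int KL; rewrite integral_cone_support//.
have [rho rho0 rhoK] := interior0_enorm K_int.
have [sigma sigma0 sigmaL] := interior0_enorm L_int.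
have mL : measurable (L : set (borel R n)) by exact: measurable_body.
have LK : leb (L : set (borel R n)) = leb K.
  rewrite -[LHS]fineK; last exact: leb_body_fin_num sigma0 sigmaL.
  rewrite -[RHS]fineK; last exact: leb_body_fin_num rho0 rhoK.
  by rewrite -vol_fine KL /vol lebVE.
have := integral_support_ge cK vK rho0 rhoK hS cL vL L_int LK.
rewrite -vol_fine => h.
have := @lee_wpmul2l R ((n%:R * vol K)^-1)%:E _ _ _ h.
rewrite lee_fin invr_ge0 ltW// => /(_ isT); apply: le_trans.
by rewrite -EFinM mulVf// gt_eqF.
Qed.

(** The total mass is the integral of the ratio for L = K: at least 1 by Brunn-Minkowski, at most 1
    by the cutoff estimate. *)
Lemma cone_volume_sphere : cone_volume_measure S K sphere = 1%E.
Proof.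
have -> : cone_volume_measure S K sphere =
    (\int[cone_volume_measure S K]_(u in sphere) (hK u / hK u)%:E)%E.
  rewrite integral_cone_support// /cone_volume_measure setIid.
  rewrite -ge0_integralZl//; first last.
  - by rewrite lee_fin invr_ge0 ltW.
  - by move=> u u1; rewrite lee_fin ltW// hK_gt0.
  - by apply/measurable_EFinP; apply: measurable_funTS; exact: measurable_support.
  by apply: eq_integral => u _; rewrite -EFinM mulrC.
apply/eqP; rewrite eq_le; apply/andP; split; last exact: integral_cone_support_ge1.
rewrite integral_cone_support//.
have [rho rho0 rhoK] := interior0_enorm K_int.
have := integral_support_self_le cK vK rho0 rhoK hS; rewrite -vol_fine => h.
have := @lee_wpmul2l R ((n%:R * vol K)^-1)%:E _ _ _ h.
rewrite lee_fin invr_ge0 ltW// => /(_ isT) h2; apply: le_trans h2 _.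
by rewrite -EFinM mulVf// gt_eqF.
Qed.

(** For symmetric K, reflecting w reflects the local parallel sets, which keeps their volumes; the
    two Steiner limits agree by uniqueness. *)
Lemma surface_even (w : set (borel R n)) : K = opp_set K -> measurable w ->
  S [set u | w (- (u : 'rV[R]_n))] = S w.
Proof.
move=> KN mw.
have [rho rho0 rhoK] := interior0_enorm K_int.
have mw' : measurable ([set u | w (- (u : 'rV[R]_n))] : set (borel R n)).
  have -> : [set u | w (- (u : 'rV[R]_n))] = [set u | w ((-1) *: (u : 'rV[R]_n))].
    by apply/seteqP; split => u /=; rewrite scaleN1r.
  exact: measurable_preimage_scale.
have KNE x : K x -> K (- x) by rewrite [in X in _ -> X]KN => Kx; exists x.
have nearestN x y : nearest_point K x y -> nearest_point K (- x) (- y).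
  move=> [Ky ymin]; split; first exact: KNE.
  move=> z /KNE Kz; have := ymin _ Kz.
  rewrite (_ : - x - - y = - (x - y)); last by vring.
  by rewrite (_ : - x - z = - (x - - z)) ?enormN//; vring.
have lebN e : leb (local_parallel_set K e [set u | w (- (u : 'rV[R]_n))]) =
    leb (local_parallel_set K e w).
  have m1 : (-1 : R) != 0 by rewrite oppr_eq0 oner_eq0.
  rewrite [RHS](lebV_preimage_scale m1); last exact: measurable_local_parallel_set.
  rewrite normrN1 expr1n mul1e; congr (leb _).
  apply/seteqP; split => x /=; rewrite scaleN1r => -[y [ny xe wx]].
    exists (- y); rewrite (_ : - x - - y = - (x - y)); last by vring.
    by rewrite enormN scalerN; split => //; exact: nearestN.
  exists (- y); rewrite (_ : x - - y = - (- x - y)); last by vring.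
  split; [by have := nearestN _ _ ny; rewrite opprK|by rewrite enormN|].
  by rewrite /= enormN scalerN opprK.
have h1 := surface_cvg cK vK rho0 rhoK hS mw'.
have h2 := surface_cvg cK vK rho0 rhoK hS mw.
move: h1; under eq_fun do rewrite lebN; move=> h1.
exact: (cvg_unique (@ereal_hausdorff R) h1 h2).
Qed.

Lemma support_even u : K = opp_set K -> hK (- u) = hK u.
Proof.
move=> KN; rewrite /support_fun {1}KN; congr sup; apply/seteqP; split.
  by move=> _ [_ [x Kx <-] <-]; exists x => //; rewrite dotNl dotNr opprK.
by move=> _ [x Kx <-]; exists (- x); [exists x|rewrite dotNl dotNr opprK].
Qed.

(** Change of variables u -> -u: S is its own image by [surface_even], and the density is even by
    [support_even]. *)
Lemma integral_cone_even (f : borel R n -> R) : K = opp_set K ->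
  measurable_fun sphere f -> (forall u, sphere u -> 0 <= f u) ->
  (\int[cone_volume_measure S K]_(u in sphere) (f (- (u : 'rV[R]_n)))%:E =
   \int[cone_volume_measure S K]_(u in sphere) (f u)%:E)%E.
Proof.
move=> KN mf f0.
have mN : measurable_fun setT (-%R : borel R n -> borel R n).
  by apply: continuous_measurable_rVV => x; exact: opp_continuous.
have sN u : sphere u -> sphere (- (u : 'rV[R]_n)).
  by rewrite /unit_sphere/= enormN.
rewrite !integral_cone//; first last.
- by move=> u /sN; exact: f0.
- apply: (measurable_comp msp _ mf) => [_ [u /sN ? <-]//|].
  exact: measurable_funTS.
transitivity (\int[pushforward_measure S mN]_(u in sphere) (f u * cone_density u)%:E)%E.
  symmetry; apply: etrans (ge0_integral_pushforward mN S msp _ _) _.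
  - by apply/measurable_EFinP; apply: measurable_funM => //; exact: mcone.
  - move=> u /[!inE] u1; rewrite lee_fin mulr_ge0 ?f0// divr_ge0// ltW//.
    exact: hK_gt0.
  - rewrite [X in integral _ X](_ : _ = sphere); last first.
      apply/seteqP; split => u /=; last exact: sN.
      by move=> /sN; rewrite opprK.
    by apply: eq_integral => u _ /=; rewrite support_even.
by apply: eq_measure_integral => A mA _; exact: surface_even.
Qed.

End cone_volume.

(** * Stability *)

(** If x is extremal in L for u and y for -u, then (x - y)/2 attains the mean of the two support
    values. *)
Lemma support_fun_symmetrization (R : realType) n (L : set 'rV[R]_n) u :
  compact L -> L !=set0 ->
  support_fun (scale_set 2^-1 (minkowski_sum L (opp_set L))) u =
  (support_fun L u + support_fun L (- u)) / 2.
Proof.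
move=> cL L0.
have [x Lx xu] := support_attained cL L0 u.
have [y Ly yu] := support_attained cL L0 (- u).
have ub z : scale_set 2^-1 (minkowski_sum L (opp_set L)) z ->
    dot z u <= (support_fun L u + support_fun L (- u)) / 2.
  move=> [_ [a La [_ [b Lb <-] <-]] <-].
  rewrite dotZl dotDl dotNl mulrC ler_wpM2r ?invr_ge0// lerD//.
    exact: dot_le_support.
  by rewrite -dotNr; exact: dot_le_support.
have mem : scale_set 2^-1 (minkowski_sum L (opp_set L)) (2^-1 *: (x - y)).
  by exists (x - y) => //; exists x => //; exists (- y) => //; exists y.
apply/eqP; rewrite eq_le; apply/andP; split.
  apply: ge_sup; first by eexists; exists (2^-1 *: (x - y)).
  by move=> _ [z zL <-]; exact: ub.
apply: ub_le_sup.
  by exists ((support_fun L u + support_fun L (- u)) / 2) => _ [z zL <-]; exact: ub.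
exists (2^-1 *: (x - y)) => //.
by rewrite dotZl dotBl xu yu dotNr mulrC.
Qed.

Lemma symmetrization_opp (R : realType) n (L : set 'rV[R]_n) :
  scale_set 2^-1 (minkowski_sum L (opp_set L)) =
  opp_set (scale_set 2^-1 (minkowski_sum L (opp_set L))).
Proof.
have sub z : scale_set 2^-1 (minkowski_sum L (opp_set L)) z ->
    scale_set 2^-1 (minkowski_sum L (opp_set L)) (- z).
  move=> [_ [a La [_ [b Lb <-] <-]] <-]; exists (b - a).
    by exists b => //; exists (- a) => //; exists a.
  by rewrite -scalerN opprB.
apply/seteqP; split => z; first by move=> /sub zL; exists (- z) => //; rewrite opprK.
by move=> [y /sub + <-].
Qed.

(** For b <= a the tangent line at b gives p m^(p-1) (a - b) <= a^p - b^p, which is k^p <= M^p times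
    the difference of the normalised powers. The constant is M^p / (p m^(p-1)). *)
Lemma dist_le_powR_dist (R : realType) (p m M k a b : R) : 1 < p -> 0 < m ->
  m <= a -> m <= b -> 0 < k -> k <= M ->
  `|a - b| <= M / p * (M / m) `^ (p - 1) * `|(a / k) `^ p - (b / k) `^ p|.
Proof.
move=> p1 m0.
wlog ba : a b / b <= a.
  move=> h ma mb k0 kM; have [ba|/ltW ab] := leP b a; first exact: h.
  by rewrite distrC (distrC ((a / k) `^ p)); exact: h.
move=> ma mb k0 kM.
have a0 : 0 < a by exact: lt_le_trans ma.
have b0 : 0 < b by exact: lt_le_trans mb.
have M0 : 0 < M by exact: lt_le_trans kM.
have p0 : 0 < p by lra.
have h := powR_sub_ge (ltW p1) b0 ba.
have kp : 0 < k `^ p by exact: powR_gt0.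
have E x : 0 < x -> k `^ p * (x / k) `^ p = x `^ p.
  move=> x0; rewrite -powRM ?(ltW k0) ?divr_ge0 ?(ltW x0) ?(ltW k0)//.
  by rewrite mulrC divfK// gt_eqF.
have h1 : p * m `^ (p - 1) * (a - b) <= M `^ p * ((a / k) `^ p - (b / k) `^ p).
  apply: (@le_trans _ _ (p * b `^ (p - 1) * (a - b))).
    rewrite ler_wpM2r ?subr_ge0// ler_wpM2l ?(ltW p0)//.
    apply: ge0_ler_powR; rewrite ?nnegrE ?(ltW m0) ?(ltW b0)//.
    by rewrite subr_ge0 ltW.
  apply: le_trans h _; rewrite -(E a a0) -(E b b0) -mulrBr.
  rewrite ler_wpM2r//; last first.
    by apply: ge0_ler_powR; rewrite ?nnegrE ?(ltW p0) ?(ltW k0) ?(ltW M0).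
  rewrite subr_ge0; apply: ge0_ler_powR; rewrite ?nnegrE ?divr_ge0 ?(ltW p0) ?(ltW a0) ?(ltW b0) ?(ltW k0)//.
  by rewrite ler_wpM2r// invr_ge0 ltW.
have d0 : 0 <= (a / k) `^ p - (b / k) `^ p.
  rewrite subr_ge0; apply: ge0_ler_powR; rewrite ?nnegrE ?divr_ge0 ?(ltW p0) ?(ltW a0) ?(ltW b0) ?(ltW k0)//.
  by rewrite ler_wpM2r// invr_ge0 ltW.
rewrite ger0_norm ?subr_ge0// (ger0_norm d0).
have pm0 : 0 < p * m `^ (p - 1) by rewrite mulr_gt0// powR_gt0.
rewrite -(ler_pM2l pm0); apply: le_trans h1 _.
have -> : (M / m) `^ (p - 1) = M `^ (p - 1) / m `^ (p - 1).
  rewrite powRM ?invr_ge0 ?(ltW M0) ?(ltW m0)//; congr (_ * _).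
  by rewrite -powR_inv1 ?(ltW m0)// -powRrM mulN1r powRN.
have mp0 : 0 < m `^ (p - 1) by exact: powR_gt0.
have -> : M `^ p = M * M `^ (p - 1).
  rewrite -{2}(powRr1 (ltW M0)) -powRD ?(gt_eqF M0) ?implybT//.
  by rewrite addrC subrK.
rewrite le_eqVlt; apply/orP; left; apply/eqP.
by field; rewrite !gt_eqF.
Qed.

(** Triangle inequality through the common value c, meant for c = 1 + delta. *)
Lemma dist_le_scaled_dist (R : realType) (x y c : R) : 0 < c ->
  `|x - y| <= c * (`|x / c - 1| + `|y / c - 1|).
Proof.
move=> c0; have E z : c * `|z / c - 1| = `|z - c|.
  by rewrite -{1}(gtr0_norm c0) -normrM mulrBr mulr1 mulrC divfK// gt_eqF.
rewrite mulrDr !E (_ : x - y = (x - c) - (y - c)); last by ring.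
exact: ler_normB.
Qed.

Section integral_bounds.
Context d (T : measurableType d) (R : realType).
Variables (mu : {measure set T -> \bar R}) (D : set T).
Hypothesis mD : measurable D.

Lemma ge0_integral_le_scale (X F : T -> R) (c e : R) :
  measurable_fun D X -> measurable_fun D F ->
  (forall u, 0 <= X u) -> (forall u, 0 <= F u) -> 0 <= c ->
  (forall u, D u -> X u <= c * F u) ->
  (\int[mu]_(u in D) (F u)%:E <= e%:E)%E ->
  (\int[mu]_(u in D) (X u)%:E <= (c * e)%:E)%E.
Proof.
move=> mX mF X0 F0 c0 XF Fe.
apply: (@le_trans _ _ (\int[mu]_(u in D) (c%:E * (F u)%:E))%E).
  apply: ge0_le_integral => //.
  - by move=> u _; rewrite lee_fin.
  - exact/measurable_EFinP.
  - by apply: emeasurable_funM => //; exact/measurable_EFinP.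
rewrite ge0_integralZl//.
- by rewrite EFinM lee_wpmul2l.
- exact/measurable_EFinP.
- by move=> u _; rewrite lee_fin.
Qed.

Lemma ge0_integral_le_add (F G : T -> R) (e : R) :
  measurable_fun D F -> measurable_fun D G ->
  (forall u, 0 <= F u) -> (forall u, 0 <= G u) ->
  (\int[mu]_(u in D) (F u)%:E <= e%:E)%E ->
  (\int[mu]_(u in D) (G u)%:E <= e%:E)%E ->
  (\int[mu]_(u in D) (F u + G u)%:E <= (2 * e)%:E)%E.
Proof.
move=> mF mG F0 G0 Fe Ge; under eq_integral do rewrite EFinD.
rewrite ge0_integralD//.
- by rewrite mulr_natl mulr2n EFinD leeD.
- by move=> u _; rewrite lee_fin.
- exact/measurable_EFinP.
- by move=> u _; rewrite lee_fin.
- exact/measurable_EFinP.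
Qed.

End integral_bounds.

Section main.
Context {R : realType} {n : nat} (K L : set 'rV[R]_n).
Variables (S : {measure set (borel R n) -> \bar R}) (p : R).
Hypotheses (n_gt0 : (0 < n)%N) (cK : compact K) (vK : convex_closed K).
Hypotheses (cL : compact L) (vL : convex_closed L).
Hypotheses (K_int : interior K 0) (L_int : interior L 0).
Hypotheses (hS : is_surface_area_measure K S) (p_gt1 : 1 < p).
Hypothesis (volKL : vol K = vol L).

Local Notation sphere := (@unit_sphere R n : set (borel R n)).
Local Notation hK := (support_fun K).
Local Notation hL := (support_fun L).
Local Notation muK := (cone_volume_measure S K).
Local Notation delta := (Lp_deficit S p K L).
Local Notation q := (p / (p - 1)).

Let msp := @measurable_sphere R n.

Let K0 : K !=set0.
Proof. by exists 0; exact: nbhs_singleton K_int. Qed.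

Let L0 : L !=set0.
Proof. by exists 0; exact: nbhs_singleton L_int. Qed.

Let p0 : 0 < p. Proof. by rewrite (lt_trans _ p_gt1). Qed.

Let mL := measurable_support cL L0.

Let hK_gt0 u : sphere u -> 0 < hK u.
Proof.
move=> u1; have [B _ [b b0 hb]] := support_sphere_bounds cK K_int.
by have /andP[h _] := hb _ u1; exact: lt_le_trans h.
Qed.

Let hL_gt0 u : sphere u -> 0 < hL u.
Proof.
move=> u1; have [B _ [b b0 hb]] := support_sphere_bounds cL L_int.
by have /andP[h _] := hb _ u1; exact: lt_le_trans h.
Qed.

Lemma measurable_ratio_powR : measurable_fun sphere (fun u => (hL u / hK u) `^ p).
Proof.
apply: (measurableT_comp (@measurable_powR R p)).
exact: measurable_support_ratio.
Qed.

Lemma integral_ratio_powR : 0 < 1 + delta /\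
  (\int[muK]_(u in sphere) ((hL u / hK u) `^ p)%:E = (1 + delta)%:E)%E.
Proof.
have V0 := vol_body_gt0 cK K_int.
have nR : 0 < n%:R :> R by rewrite ltr0n.
have nV0 : 0 < n%:R * vol K by rewrite mulr_gt0.
have [BK BK0 [bK bK0 hbK]] := support_sphere_bounds cK K_int.
have [BL BL0 [bL bL0 hbL]] := support_sphere_bounds cL L_int.
have [m mE] := cone_volume_measure_ext S n_gt0 cK K_int.
have m1 : m sphere = 1%E by rewrite mE cone_volume_sphere.
have rp_ge0 u : 0 <= (hL u / hK u) `^ p by exact: powR_ge0.
set J := (\int[muK]_(u in sphere) ((hL u / hK u) `^ p)%:E)%E.
(* Two-sided bounds on the ratio make J finite and positive. Finiteness matters because
   [Lp_mixed_volume] is a real-valued integral, which would read an infinite value as 0. *)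
have J_le : (J <= ((BL / bK) `^ p)%:E)%E.
  rewrite /J -mE -[leRHS]mule1 -[X in (_ * X)%E]m1 -integral_cst//.
  apply: ge0_le_integral => //.
  - by move=> u _; rewrite lee_fin.
  - by apply/measurable_EFinP; exact: measurable_ratio_powR.
  - move=> u u1; rewrite lee_fin.
    have /andP[k1 k2] := hbK u u1; have /andP[l1 l2] := hbL u u1.
    have hk := hK_gt0 u1; have hl := hL_gt0 u1.
    apply: ge0_ler_powR; rewrite ?nnegrE ?divr_ge0 ?(ltW p0) ?(ltW hk) ?(ltW hl) ?(ltW BL0) ?(ltW bK0)//.
    by apply: ler_pM; rewrite ?invr_ge0 ?(ltW hk) ?(ltW hl)// lef_pV2.
have J_ge : (((bL / BK) `^ p)%:E <= J)%E.
  rewrite /J -mE -[leLHS]mule1 -[X in (_ * X)%E]m1 -integral_cst//.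
  apply: ge0_le_integral => //.
  - by move=> u _; rewrite lee_fin powR_ge0.
  - by apply/measurable_EFinP; exact: measurable_ratio_powR.
  - move=> u u1; rewrite lee_fin.
    have /andP[k1 k2] := hbK u u1; have /andP[l1 l2] := hbL u u1.
    have hk := hK_gt0 u1; have hl := hL_gt0 u1.
    apply: ge0_ler_powR; rewrite ?nnegrE ?divr_ge0 ?(ltW p0) ?(ltW hk) ?(ltW hl) ?(ltW bL0) ?(ltW BK0)//.
    by apply: ler_pM; rewrite ?invr_ge0 ?(ltW bL0) ?(ltW BK0)// lef_pV2.
have J0 : (0 <= J)%E by apply: le_trans J_ge; rewrite lee_fin powR_ge0.
have Jfin : J \is a fin_num by rewrite ge0_fin_numE// (le_lt_trans J_le)// ltry.
have IE : (\int[S]_(u in sphere) (hL u `^ p * hK u `^ (1 - p))%:E =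
    (n%:R * vol K)%:E * J)%E.
  rewrite /J integral_cone//; last exact: measurable_ratio_powR.
  rewrite -ge0_integralZl//; first last.
  - by rewrite lee_fin ltW.
  - by move=> u u1; rewrite lee_fin mulr_ge0// divr_ge0 ?(ltW nV0)// ltW// hK_gt0.
  - apply/measurable_EFinP; apply: measurable_funM; first exact: measurable_ratio_powR.
    apply: measurable_funTS; apply: measurable_funM => //; exact: measurable_support.
  apply: eq_integral => u /[!inE] u1; rewrite -EFinM; congr EFin.
  have hk := hK_gt0 u1; have hl := hL_gt0 u1.
  rewrite powRB ?(gt_eqF hk) ?implybT// powRr1 ?(ltW hk)//.
  rewrite powRM ?invr_ge0 ?(ltW hk) ?(ltW hl)//.
  have -> : (hK u)^-1 `^ p = (hK u `^ p)^-1.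
    by rewrite -powR_inv1 ?(ltW hk)// -powRrM mulN1r powRN.
  by field; rewrite !gt_eqF// powR_gt0.
have dE : 1 + delta = fine J.
  rewrite /Lp_deficit /Lp_mixed_volume /Rintegral IE fineM//.
  by rewrite /=; field; rewrite !gt_eqF.
rewrite dE fineK//; split => //.
rewrite -lte_fin fineK//; apply: lt_le_trans J_ge.
by rewrite lte_fin powR_gt0// divr_gt0.
Qed.

Lemma ratio_stability :
  (\int[muK]_(u in sphere) (`| (hL u / hK u) `^ p / (1 + delta) - 1 |)%:E
    <= (Num.sqrt (2 * q * delta))%:E)%E.
Proof.
have [d0 rp] := integral_ratio_powR.
have [m mE] := cone_volume_measure_ext S n_gt0 cK K_int.
have m1 : m sphere = 1%E by rewrite mE cone_volume_sphere.
have r_gt0 u : sphere u -> 0 < hL u / hK u.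
  by move=> u1; rewrite divr_gt0 ?hL_gt0 ?hK_gt0.
have a01 : 0 < p^-1 < 1 by rewrite invr_gt0 p0 invf_lt1.
set d1 := 1 + delta in d0 rp *.
pose f u := (hL u / hK u) `^ p / d1.
have mf : measurable_fun sphere f.
  by apply: measurable_funM => //; exact: measurable_ratio_powR.
have mr : measurable_fun sphere (fun u => hL u / hK u) by exact: measurable_support_ratio.
set I1 := (\int[muK]_(u in sphere) (hL u / hK u)%:E)%E.
have I1_ge1 : (1 <= I1)%E by exact: integral_cone_support_ge1.
have fa u : sphere u -> f u `^ p^-1 = (d1 `^ p^-1)^-1 * (hL u / hK u).
  move=> u1; rewrite /f powRM ?powR_ge0 ?invr_ge0 ?(ltW d0)//.
  rewrite -powRrM divff ?gt_eqF// powRr1 ?(ltW (r_gt0 _ u1))// mulrC; congr (_ * _).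
  by rewrite -powR_inv1 ?(ltW d0)// -powRrM mulN1r powRN.
have da0 : 0 < d1 `^ p^-1 by rewrite powR_gt0.
(* The ratio r satisfies r <= 1 + r^p, which is integrable. *)
have I1fin : I1 \is a fin_num.
  have I10 : (0 <= I1)%E by apply: le_trans I1_ge1.
  rewrite ge0_fin_numE//; apply: (@le_lt_trans _ _ (1 + d1%:E)%E); last by rewrite -EFinD ltry.
  have -> : (1 + d1%:E = \int[m]_(u in sphere) (1 + (hL u / hK u) `^ p)%:E)%E.
    under eq_integral do rewrite EFinD.
    rewrite ge0_integralD//.
    - by rewrite integral_cst// mul1e mE rp -mE m1.
    - by move=> u _; rewrite lee_fin powR_ge0.
    - by apply/measurable_EFinP; exact: measurable_ratio_powR.
  rewrite /I1 -mE; apply: ge0_le_integral => //.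
  - by move=> u u1; rewrite lee_fin ltW// r_gt0.
  - exact/measurable_EFinP.
  - by apply/measurable_EFinP; apply: measurable_funD => //; exact: measurable_ratio_powR.
  - move=> u u1; rewrite lee_fin.
    have := powR_ge_affine (ltW p_gt1) (r_gt0 _ u1).
    have := powR_ge0 (hL u / hK u) p; move: (hL u / hK u) (_ `^ _) => r X X0 rX.
    have [r1|/ltW r1] := leP r 1; first by lra.
    have : 0 <= (p - 1) * (r - 1) by rewrite mulr_ge0// subr_ge0// ltW.
    lra.
(* This is the integral of f^(1/p), because f^(1/p) is the ratio divided by (1 + delta)^(1/p). *)
pose c := (d1 `^ p^-1)^-1 * fine I1.
have := @pinsker_integral _ _ _ m sphere msp m1 f p^-1 c delta mf _ a01 _ _ _.
rewrite -mE => h.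
have -> : 2 * q * delta = 2 / (1 - p^-1) * delta.
  by congr (_ * _); field; rewrite !gt_eqF// subr_gt0 ?mul1r.
apply: h.
- by move=> u u1; rewrite divr_gt0// powR_gt0// r_gt0.
- rewrite /f; under eq_integral do rewrite EFinM.
  rewrite ge0_integralZr//.
  + by rewrite mE rp -EFinM divff// gt_eqF.
  + by apply/measurable_EFinP; exact: measurable_ratio_powR.
  + by move=> u _; rewrite lee_fin powR_ge0.
  + by rewrite lee_fin invr_ge0 ltW.
- rewrite /c EFinM fineK// /I1 -mE -ge0_integralZl//.
  + by apply: eq_integral => u /[!inE] u1; rewrite fa.
  + exact/measurable_EFinP.
  + by move=> u u1; rewrite lee_fin ltW// r_gt0.
  + by rewrite lee_fin invr_ge0 ltW.
- have h1 : (d1 `^ p^-1)^-1 <= c.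
    rewrite /c ler_peMr ?invr_ge0 ?(ltW da0)//.
    by rewrite -lee_fin fineK.
  (* For x = delta / p, concavity gives (1 + delta)^(1/p) <= 1 + x, and (1 - x) (1 + x) <= 1. When x
     >= 1 the left side is not positive. *)
  have h2 : 1 - p^-1 * delta <= (d1 `^ p^-1)^-1.
    have := @powR_le_affine _ p^-1 d1; rewrite (ltW (proj1 (andP a01))) (ltW (proj2 (andP a01))).
    move=> /(_ isT d0); rewrite (_ : d1 - 1 = delta); last by rewrite /d1; ring.
    set x := p^-1 * delta => hx.
    rewrite -[leRHS]div1r ler_pdivlMr//.
    have [x1|x1] := ltP x 1; last first.
      by apply: (@le_trans _ _ 0) => //; apply: mulr_le0_ge0; [lra|exact: ltW].
    have : (1 - x) * d1 `^ p^-1 <= (1 - x) * (1 + x) by rewrite ler_wpM2l// subr_ge0 ltW.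
    move=> h2; apply: le_trans h2 _; have := sqr_ge0 x; nra.
  lra.
Qed.

Let hLN_meas : measurable_fun setT (fun u : borel R n => hL (- (u : 'rV[R]_n))).
Proof.
apply: (measurableT_comp mL).
by apply: continuous_measurable_rVV => x; exact: opp_continuous.
Qed.

Let d1_gt0 : 0 < 1 + delta. Proof. by have [] := integral_ratio_powR. Qed.

Let measurable_ratio_dev : measurable_fun sphere
  (fun u => `|(hL u / hK u) `^ p / (1 + delta) - 1|).
Proof.
apply: (measurableT_comp (@normr_measurable R setT)) => //.
by apply: measurable_funB => //; apply: measurable_funM => //; exact: measurable_ratio_powR.
Qed.

Let measurable_ratio_powRN : measurable_fun sphere
  (fun u => (hL (- (u : 'rV[R]_n)) / hK u) `^ p).
Proof.
apply: (measurableT_comp (@measurable_powR R p)).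
exact: measurable_support_ratio.
Qed.

Let measurable_ratio_devN : measurable_fun sphere
  (fun u => `|(hL (- (u : 'rV[R]_n)) / hK u) `^ p / (1 + delta) - 1|).
Proof.
apply: (measurableT_comp (@normr_measurable R setT)) => //.
by apply: measurable_funB => //; apply: measurable_funM.
Qed.

Let measurable_ratio_diff : measurable_fun sphere
  (fun u => `|(hL u / hK u) `^ p - (hL (- (u : 'rV[R]_n)) / hK u) `^ p|).
Proof.
apply: (measurableT_comp (@normr_measurable R setT)) => //.
by apply: measurable_funB; [exact: measurable_ratio_powR|].
Qed.

(** Evenness of the measure gives the deviation at -u the same integral as at u, and evenness of h_K
    puts h_K(u) in both denominators; the two powers are then compared through 1 + delta. *)
Lemma reflection_stability : K = opp_set K ->
  (\int[muK]_(u in sphere)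
      (`| (hL u / hK u) `^ p - (hL (- (u : 'rV[R]_n)) / hK u) `^ p |)%:E
   <= (2 * (1 + delta) * Num.sqrt (2 * q * delta))%:E)%E.
Proof.
move=> KN.
have [m mE] := cone_volume_measure_ext S n_gt0 cK K_int.
have h1 := ratio_stability.
pose F u := `|(hL u / hK u) `^ p / (1 + delta) - 1|.
have F0 u : 0 <= F u by exact: normr_ge0.
have hE := integral_cone_even n_gt0 cK vK K_int hS KN measurable_ratio_dev (fun u _ => F0 u).
have FN : (fun u : borel R n => F (- (u : 'rV[R]_n))) =
    (fun u => `|(hL (- (u : 'rV[R]_n)) / hK u) `^ p / (1 + delta) - 1|).
  by apply/funext => u; rewrite /F (support_even u KN).
have mFN : measurable_fun sphere (fun u : borel R n => F (- (u : 'rV[R]_n))).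
  by rewrite FN; exact: measurable_ratio_devN.
have h2 : (\int[muK]_(u in sphere) (F (- (u : 'rV[R]_n)))%:E
    <= (Num.sqrt (2 * q * delta))%:E)%E by rewrite hE.
rewrite -mE in h1 h2 *.
have h3 := ge0_integral_le_add msp measurable_ratio_dev mFN F0 (fun u => F0 _) h1 h2.
rewrite [X in (_ <= X%:E)%E](_ : _ =
  (1 + delta) * (2 * Num.sqrt (2 * q * delta))); last by ring.
apply: (ge0_integral_le_scale msp measurable_ratio_diff
  (measurable_funD measurable_ratio_dev mFN) _ _ (ltW d1_gt0) _ h3) => [u|u|u u1].
- exact: normr_ge0.
- by rewrite addr_ge0.
have FNu := congr1 (fun f => f u) FN; rewrite /= in FNu.
rewrite /= FNu.
exact: dist_le_scaled_dist.
Qed.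

Section bounded.
Variables m M : R.
Hypotheses (KN : K = opp_set K) (m0 : 0 < m) (mM : m <= M).
Hypothesis KM : K `<=` scale_set M (@unit_ball R n).
Hypothesis mL_sub : scale_set m (@unit_ball R n) `<=` L.

Let measurable_support_diff : measurable_fun sphere
  (fun u : borel R n => `|hL u - hL (- (u : 'rV[R]_n))|).
Proof.
apply: (measurableT_comp (@normr_measurable R setT)) => //.
by apply: measurable_funTS; apply: measurable_funB.
Qed.

(** The bounds h_L >= m, at u and at -u, and h_K <= M turn the difference of powers into a pointwise
    bound on the difference of support values. *)
Lemma support_reflection_stability :
  (\int[muK]_(u in sphere) (`| hL u - hL (- (u : 'rV[R]_n)) |)%:E
   <= (2 * M * (1 + delta) / p * (M / m) `^ (p - 1) * Num.sqrt (2 * q * delta))%:E)%E.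
Proof.
have [mu muE] := cone_volume_measure_ext S n_gt0 cK K_int.
have M0 : 0 < M by exact: lt_le_trans mM.
have hLm u : sphere u -> m <= hL u.
  move=> u1; have := @support_ge_enorm R n L cL L0 m u m0; rewrite u1 mulr1; apply.
  move=> x xm; apply: mL_sub; exists (m^-1 *: x).
    rewrite /unit_ball/= enormZ ger0_norm ?invr_ge0 ?(ltW m0)//.
    by rewrite mulrC ler_pdivrMr// mul1r.
  by rewrite scalerA divff ?scale1r// gt_eqF.
have hKM u : sphere u -> hK u <= M.
  move=> u1; have := @support_le_enorm R n K cK K0 M u; rewrite u1 mulr1; apply.
  move=> x /KM [y y1 <-]; rewrite enormZ ger0_norm ?(ltW M0)//.
  by rewrite ler_piMr// ltW.
have sN u : sphere u -> sphere (- (u : 'rV[R]_n)) by rewrite /unit_sphere/= enormN.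
pose C := M / p * (M / m) `^ (p - 1).
have C0 : 0 <= C by rewrite mulr_ge0 ?powR_ge0// divr_ge0 ?(ltW M0) ?(ltW p0).
have h := reflection_stability KN; rewrite -muE in h *.
rewrite [X in (_ <= X%:E)%E](_ : _ = C * (2 * (1 + delta) * Num.sqrt (2 * q * delta)));
  last by rewrite /C; ring.
apply: (ge0_integral_le_scale msp measurable_support_diff measurable_ratio_diff _ _ C0 _ h)
  => [u|u|u u1]; try exact: normr_ge0.
apply: dist_le_powR_dist => //; [exact: hLm|exact/hLm/sN|exact: hK_gt0|exact: hKM].
Qed.

(** By [support_fun_symmetrization] the integrand is exactly half of the one for the reflection. *)
Lemma support_symmetrization_stability :
  (\int[muK]_(u in sphere)
     (`| hL u - support_fun (scale_set 2^-1 (minkowski_sum L (opp_set L))) u |)%:E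
   <= (M * (1 + delta) / p * (M / m) `^ (p - 1) * Num.sqrt (2 * q * delta))%:E)%E.
Proof.
have [mu muE] := cone_volume_measure_ext S n_gt0 cK K_int.
have dE u : `| hL u - support_fun (scale_set 2^-1 (minkowski_sum L (opp_set L))) u | =
    2^-1 * `| hL u - hL (- (u : 'rV[R]_n)) |.
  rewrite support_fun_symmetrization//.
  rewrite (_ : _ - _ = 2^-1 * (hL u - hL (- (u : 'rV[R]_n)))); last by field.
  by rewrite normrM ger0_norm ?invr_ge0.
have h := support_reflection_stability; rewrite -muE in h *.
under eq_integral do rewrite dE.
rewrite [X in (_ <= X%:E)%E](_ : _ = 2^-1 * (2 * M * (1 + delta) / p * (M / m) `^ (p - 1)
  * Num.sqrt (2 * q * delta))); last by field; rewrite gt_eqF.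
apply: (ge0_integral_le_scale msp _ measurable_support_diff _ _ _ _ h) => //.
by apply: measurable_funM.
Qed.

End bounded.

End main.

Unset Implicit Arguments.

Theorem theorem1p3 (R : realType) (n : nat) (K L : set 'rV[R]_n)
    (SK : {measure set (borel R n) -> \bar R}) (p : R)
    (n_gt0 : (0 < n)%N)
    (cK : convex_body K) (cL : convex_body L)
    (K_int0 : interior K 0) (L_int0 : interior L 0)
    (hSK : is_surface_area_measure K SK)
    (p_gt1 : 1 < p)
    (volKL : vol K = vol L) :
  let q := p / (p - 1) in
  let delta := Lp_deficit SK p K L in
  let muK := cone_volume_measure SK K in
  let hK := support_fun K in
  let hL := support_fun L in
  let r := fun u => hL u / hK u in
  let Lsym := scale_set (2^-1) (minkowski_sum L (opp_set L)) in
  [/\ (\int[muK]_(u in @unit_sphere R n)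
          (`| r u `^ p / (1 + delta) - 1 |)%:E
        <= (Num.sqrt (2 * q * delta))%:E)%E,
      K = opp_set K ->
      (\int[muK]_(u in @unit_sphere R n)
          (`| (hL u / hK u) `^ p - (hL (- u) / hK u) `^ p |)%:E
        <= (2 * (1 + delta) * Num.sqrt (2 * q * delta))%:E)%E &
      K = opp_set K ->
      forall m M : R, 0 < m -> m <= M ->
      scale_set m (@unit_ball R n) `<=` K ->
      K `<=` scale_set M (@unit_ball R n) ->
      scale_set m (@unit_ball R n) `<=` L ->
      L `<=` scale_set M (@unit_ball R n) ->
      [/\ (\int[muK]_(u in @unit_sphere R n) (`| hL u - hL (- u) |)%:E
            <= (2 * M * (1 + delta) / p * (M / m) `^ (p - 1)
                * Num.sqrt (2 * q * delta))%:E)%E,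
          Lsym = opp_set Lsym &
          (\int[muK]_(u in @unit_sphere R n) (`| hL u - support_fun Lsym u |)%:E
            <= (M * (1 + delta) / p * (M / m) `^ (p - 1)
                * Num.sqrt (2 * q * delta))%:E)%E]].
Proof.
case: cK => compK convK _; case: cL => compL convL _.
have vK := convex_set_closed convK; have vL := convex_set_closed convL.
move=> q delta muK hK hL r Lsym; split.
- exact: ratio_stability.
- exact: reflection_stability.
- move=> KN m M m0 mM _ KM mL _; split.
  + exact: support_reflection_stability.
  + exact: symmetrization_opp.
  + exact: support_symmetrization_stability.
Qed.
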